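(* Let $F=\mathbb{F}_q(t)$, let $f\in\mathbb{F}_q[t]$ be a monic irreducible polynomial of degree $d\ge 1$, let $\nu_p$ be the valuation of $F$ attached to the corresponding place $p$ (of degree $d$), and let $X$ be the Bruhat--Tits tree of the locally compact group $\mathsf{PGL}_2(F_{\nu_p})$. Then the orbit space (quotient graph) $\mathsf{PGL}_2(\mathcal{O}_{\{p\}})\backslash X$ is, up to isomorphism, the following multigraph. (1) If $d$ is odd, its set of vertices is $\{X_n \mid n\in\mathbb{N}_0\}$ (pairwise distinct), and its edges are precisely: - 1 edge between $X_n$ and $X_{n+d}$, for $n\in\mathbb{N}_0$; - 1 edge between $X_n$ and $X_{d-n}$, for $n\in\mathbb{N}_0$ with $n\ge 1$ and $d-n\geq 1$; - $q^{2l-1}+q^{2l-2}$ edges between $X_n$ and $X_{d-n-2l}$, for $n,l\in\mathbb{N}_0$ with $n\ge 1$, $l\ge 1$ and $d-n-2l\ge 1$; - $q^{2l-2}$ edges between $X_0$ and $X_{d-2l}$, for $l\in\mathbb{N}_0$ with $l\ge 1$ and $d-2l\ge 1$. (2) If $d$ is even, its set of vertices is $\{X_n, X_n' \mid n\in 2\mathbb{N}_0\}$ (pairwise distinct), and its edges are precisely: - 1 edge between $X_n$ and $X'_{n+d}$ and 1 edge between $X'_n$ and $X_{n+d}$, for $n\in 2\mathbb{N}_0$; - 1 edge between $X_n$ and $X'_{d-n}$, for $n\in 2\mathbb{N}_0$ with $n\ge 2$ and $d-n\ge 2$; - $q^{2l-1}+q^{2l-2}$ edges between $X_n$ and $X'_{d-n-2l}$,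 and equally many between $X'_n$ and $X_{d-n-2l}$, for $n\in 2\mathbb{N}_0$, $l\in\mathbb{N}_0$ with $l\ge 1$, $n\ge 2$ and $d-n-2l\ge 2$; - $q^{2l-2}$ edges between $X_0$ and $X'_{d-2l}$, and equally many between $X'_0$ and $X_{d-2l}$, for $l\in\mathbb{N}_0$ with $l\ge 1$ and $d-2l\ge 2$; - $q(q^{d-3}+1)/(q+1)$ edges between $X_0$ and $X'_0$ if $d>2$, and 1 edge between $X_0$ and $X_0'$ if $d=2$. For every unordered pair of vertices, the stated number is the total number of edges joining them (an unordered pair that arises from two different choices of parameters within one item is counted only once).
   Context: $\mathbb{F}_q$ is the finite field of order $q$, $F=\mathbb{F}_q(t)$ the rational function field, $\mathbb{N}_0=\{0,1,2,\dots\}$, and $2\mathbb{N}_0$ the set of even elements of $\mathbb{N}_0$. The place $p$ corresponds to the monic irreducible polynomial $f$ of degree $d$; $\nu_p$ is the $f$-adic valuation on $F$, $F_{\nu_p}$ is the completion of $F$ with respect to $\nu_p$, and $\mathcal{O}_p=\{x\in F : \nu_p(x)\ge 0\}$. The ring $\mathcal{O}_{\{p\}}$ is the subring of $F$ of elements having poles only at $p$ (so no pole at any other place, including the place $\infty$); explicitly $\mathcal{O}_{\{p\}}=\{a/f^r : r\in\mathbb{N}_0,\ a\in\mathbb{F}_q[t],\ \deg a\le rd\}$. For a commutative ring $R$ used here, $\mathsf{PGL}_2(R)$ means $\mathsf{GL}_2(R)/R^\times$. The Bruhat--Tits tree $X$ has as vertices the homothety classes (multiplication by $F^\times$) of rank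 two $\mathcal{O}_p$-lattices in $F^2$ (free $\mathcal{O}_p$-submodules of rank two spanning $F^2$); two vertices are adjacent if they have representatives $L\supset L'$ with $L/L'$ isomorphic to the residue field $\mathcal{O}_p/f\mathcal{O}_p$. The group $\mathsf{PGL}_2(F)$, and hence $\mathsf{PGL}_2(\mathcal{O}_{\{p\}})$, acts on $X$ by its natural left action on lattices. The orbit space $\mathsf{PGL}_2(\mathcal{O}_{\{p\}})\backslash X$ is the quotient multigraph: its vertices are the orbits of vertices of $X$, and its edges are the orbits of (unoriented) edges of $X$, each joining the orbits of its two endpoints. *)

(* Defs.v *)
From mathcomp Require Import all_boot all_order all_algebra.
From mathcomp Require Import boolp classical_sets functions.

Set Implicit Arguments.
Unset Strict Implicit.
Unset Printing Implicit Defensive.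

Import Order.TTheory GRing.Theory Num.Theory.

Local Open Scope classical_set_scope.
Local Open Scope ring_scope.

(** * Multigraphs *)

(* [ends G e] is the set of endpoints of [e]: a pair, or a singleton if [e] is
   a loop. Only its values on [edges G] matter. *)
Record multigraph (V E : Type) := Multigraph {
  vertices : set V;
  edges : set E;
  ends : E -> set V
}.

Definition multigraph_iso (V E V' E' : Type)
    (G : multigraph V E) (G' : multigraph V' E') : Prop :=
  exists (phi : V -> V') (psi : E -> E'),
    [/\ set_bij (vertices G) (vertices G') phi,
        set_bij (edges G) (edges G') psi &
        forall e, edges G e -> ends G' (psi e) = phi @` ends G e].

(* The multigraph on [vs] with [c] edges between [x] and [y] whenever
   [mult x y c]. The edges joining x and y are ({x, y}, 0), ..., ({x, y}, c-1),
   so an unordered pair that [mult] lists several times with the same [c] is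
   counted once, and a pair that it does not list is not joined. *)
Definition multigraph_of (V : Type) (vs : set V) (mult : V -> V -> nat -> Prop) :
    multigraph V (set V * nat) :=
  {| vertices := vs;
     edges := [set e | exists x y c,
       [/\ mult x y c, e.1 = [set x; y] & (e.2 < c)%N]];
     ends := fst |}.

(** * Places of the rational function field *)

Notation ratfun k := {fraction {poly k}}.

(* For a != 0 and a nonconstant g, the largest i such that g ^ i divides a. *)
Definition multiplicity (k : fieldType) (g a : {poly k}) : nat :=
  \max_(i < size a | g ^+ i %| a) i.

(* The g-adic valuation and the valuation deg (denominator) - deg (numerator)
   of the place at infinity, computed on a representative of the fraction; the
   values at 0 are irrelevant (see [valuation_ring]). *)
Definition nu (k : fieldType) (g : {poly k}) (x : ratfun k) : int :=
  (multiplicity g \n_(repr x))%:Z - (multiplicity g \d_(repr x))%:Z.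

Definition nu_infty (k : fieldType) (x : ratfun k) : int :=
  (size \d_(repr x))%:Z - (size \n_(repr x))%:Z.

(* The case x = 0 accounts for the convention that 0 has infinite valuation. *)
Definition valuation_ring (F : fieldType) (v : F -> int) : set F :=
  [set x | x = 0 \/ 0 <= v x].

Definition O_at (k : fieldType) (f : {poly k}) : set (ratfun k) :=
  valuation_ring (nu f).

Definition O_poles_at (k : fieldType) (f : {poly k}) : set (ratfun k) :=
  [set x | (forall g : {poly k}, g \is monic -> irreducible_poly g -> g <> f ->
              valuation_ring (nu g) x)
           /\ valuation_ring (@nu_infty k) x].

(** * PGL_2 of a subring R of a field F *)

Definition units_of (F : fieldType) (R : set F) : set F :=
  [set c | R c /\ exists2 d, R d & c * d = 1].

Definition mx_over (F : fieldType) (R : set F) : set 'M[F]_2 :=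
  [set g | forall i j, R (g i j)].

Definition GL2 (F : fieldType) (R : set F) : set 'M[F]_2 :=
  [set g | mx_over R g /\
           exists2 h, mx_over R h & g *m h = 1%:M /\ h *m g = 1%:M].

(* The elements of PGL_2(R) are the cosets of the group of scalar matrices. *)
Definition PGL2 (F : fieldType) (R : set F) : set (set 'M[F]_2) :=
  [set [set c *: g | c in units_of R] | g in GL2 R].

(** * The Bruhat-Tits tree *)

(* A free O-submodule of rank two of F^2 that spans F^2. *)
Definition lattice (F : fieldType) (O : set F) (L : set 'cV[F]_2) : Prop :=
  exists u v : 'cV[F]_2,
    [/\ L = [set w | exists a b, [/\ O a, O b & w = a *: u + b *: v]],
        forall a b, O a -> O b -> a *: u + b *: v = 0 -> a = 0 /\ b = 0 &
        forall w, exists a b : F, w = a *: u + b *: v].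

Definition homothety_class (F : fieldType) (L : set 'cV[F]_2) :
    set (set 'cV[F]_2) :=
  [set [set c *: x | x in L] | c in [set c : F | c != 0]].

Definition tree_vertices (F : fieldType) (O : set F) :
    set (set (set 'cV[F]_2)) :=
  [set homothety_class L | L in [set L | lattice O L]].

(* L / L' and M / M' are isomorphic O-modules, where L' and M' are
   O-submodules of L and M: [phi] lifts an isomorphism to representatives. *)
Definition quotients_iso (F : fieldType) (U W : lmodType F) (O : set F)
    (L L' : set U) (M M' : set W) : Prop :=
  exists phi : U -> W,
    [/\ forall x, L x -> M (phi x),
        forall a x y, O a -> L x -> L y ->
          M' (phi (a *: x + y) - (a *: phi x + phi y)),
        forall x, L x -> (M' (phi x) <-> L' x) &
        forall m, M m -> exists2 x, L x & M' (m - phi x)].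

Definition tree_adjacent (k : fieldType) (f : {poly k})
    (v w : set (set 'cV[ratfun k]_2)) : Prop :=
  exists L L', [/\ v L, w L', L' `<=` L &
    quotients_iso (W := (ratfun k)^o) (O_at f) L L'
      (O_at f) [set tofrac f * x | x in O_at f]].

Definition tree_edges (k : fieldType) (f : {poly k}) :
    set (set (set (set 'cV[ratfun k]_2))) :=
  [set e | exists v w, [/\ tree_vertices (O_at f) v, tree_vertices (O_at f) w,
             tree_adjacent f v w \/ tree_adjacent f w v & e = [set v; w]]].

(** * The quotient multigraph *)

(* Natural action of (a coset of) matrices on (homothety classes of) lattices. *)
Definition act (F : fieldType) (P : set 'M[F]_2) (v : set (set 'cV[F]_2)) :
    set (set 'cV[F]_2) :=
  [set M | exists g L, [/\ P g, v L & M = [set g *m x | x in L]]].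

Definition vertex_orbit (F : fieldType) (R : set F) (v : set (set 'cV[F]_2)) :=
  [set act P v | P in PGL2 R].

Definition edge_orbit (F : fieldType) (R : set F)
    (e : set (set (set 'cV[F]_2))) :=
  [set act P @` e | P in PGL2 R].

(* The ends of an orbit of edges are the orbits of the ends of its members. *)
Definition quotient_graph (k : fieldType) (f : {poly k}) :=
  let R := O_poles_at f in
  {| vertices := vertex_orbit R @` tree_vertices (O_at f);
     edges := edge_orbit R @` tree_edges f;
     ends := fun E : set (set (set (set 'cV[ratfun k]_2))) =>
       vertex_orbit R @` \bigcup_(e in E) e |}.

(** * The expected multigraphs *)

(* [odd_mult q d m n c]: there are c edges between X_m and X_n. *)
Inductive odd_mult (q d : nat) : nat -> nat -> nat -> Prop :=
| Odd_shift n : odd_mult q d n (n + d) 1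
| Odd_reflect n : (1 <= n)%N -> (1 <= d - n)%N -> odd_mult q d n (d - n) 1
| Odd_inner n l : (1 <= n)%N -> (1 <= l)%N -> (1 <= d - n - 2 * l)%N ->
    odd_mult q d n (d - n - 2 * l) (q ^ (2 * l - 1) + q ^ (2 * l - 2))
| Odd_zero l : (1 <= l)%N -> (1 <= d - 2 * l)%N ->
    odd_mult q d 0 (d - 2 * l) (q ^ (2 * l - 2)).

Definition odd_graph (q d : nat) : multigraph nat (set nat * nat) :=
  multigraph_of setT (odd_mult q d).

Variant even_vertex := X of nat | X' of nat.

Definition even_vertices : set even_vertex :=
  [set v | match v with X n | X' n => ~~ odd n end].

(* The division in [Even_zero_zero] is exact since d - 3 is odd. *)
Inductive even_mult (q d : nat) : even_vertex -> even_vertex -> nat -> Prop :=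
| Even_shift n : ~~ odd n -> even_mult q d (X n) (X' (n + d)) 1
| Even_shift' n : ~~ odd n -> even_mult q d (X' n) (X (n + d)) 1
| Even_reflect n : ~~ odd n -> (2 <= n)%N -> (2 <= d - n)%N ->
    even_mult q d (X n) (X' (d - n)) 1
| Even_inner n l : ~~ odd n ->
    (1 <= l)%N -> (2 <= n)%N -> (2 <= d - n - 2 * l)%N ->
    even_mult q d (X n) (X' (d - n - 2 * l)) (q ^ (2 * l - 1) + q ^ (2 * l - 2))
| Even_inner' n l : ~~ odd n ->
    (1 <= l)%N -> (2 <= n)%N -> (2 <= d - n - 2 * l)%N ->
    even_mult q d (X' n) (X (d - n - 2 * l)) (q ^ (2 * l - 1) + q ^ (2 * l - 2))
| Even_zero l : (1 <= l)%N -> (2 <= d - 2 * l)%N ->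
    even_mult q d (X 0) (X' (d - 2 * l)) (q ^ (2 * l - 2))
| Even_zero' l : (1 <= l)%N -> (2 <= d - 2 * l)%N ->
    even_mult q d (X' 0) (X (d - 2 * l)) (q ^ (2 * l - 2))
| Even_zero_zero : (2 < d)%N ->
    even_mult q d (X 0) (X' 0) (q * (q ^ (d - 3) + 1) %/ (q + 1))
| Even_zero_zero2 : d = 2%N -> even_mult q d (X 0) (X' 0) 1.

Definition even_graph (q d : nat) : multigraph even_vertex (set even_vertex * nat) :=
  multigraph_of even_vertices (even_mult q d).

(* Main.v *)
(* Work with integral matrices A over k[t] with det A = c f^e: their columns span
   an O_p-lattice, and after column reduction over k[t] their degrees m <= m + n
   add up to e d, so that A is also a basis reduced at infinity (geometrically,
   the lattice is a vector bundle O(m) + O(m + n) on the projective line). The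
   pair (n, e mod 2) is a complete invariant of the orbits of vertices, with
   odd n = odd (e d); it gives the X_n, respectively X_n and X_n'.

   The neighbours of the vertex of A are A diag(1, f), of invariant n + d, and
   A (f p; 0 1) for p mod f. If n < d and j is the degree of the first minimum
   of {(x, y) | x = p y mod f}, x having weight -n, then the latter has invariant
   d - n - 2 j. Counting the short vectors of all these lattices at once shows
   that q^(n + 1 + 2 J) residues p have j <= J when n + 2 J < d.

   Two residues give the same edge of the quotient exactly when an automorphism
   of the bundle O(m) + O(m + n) exchanges them. For n > 0 these act by
   p -> a p + w with deg w <= n, freely if j > 0 and transitively if j = 0. For
   n = 0 the group is PGL_2(k), of order q^3 - q, which is free on the residues
   with j > 0 except for the elements of F_(q^2) outside k; these form a single
   orbit, of size q^2 - q, and have j = d / 2. *)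

Require Import Defs.
From mathcomp Require Import all_boot all_order all_algebra all_field.
From mathcomp Require Import zify ring.
From mathcomp Require Import boolp classical_sets functions cardinality.

Set Implicit Arguments.
Unset Strict Implicit.
Unset Printing Implicit Defensive.

Import Order.TTheory GRing.Theory Num.Theory.

Local Open Scope classical_set_scope.
Local Open Scope ring_scope.
Local Open Scope quotient_scope.

Local Notation "x %:F" := (@FracField.tofrac _ x).

(** * Rings of rational functions *)

(** Every edge joins a vertex with [e] even to one with [e] odd, and the group preserves this
    parity. Hence no element inverts an edge, an orbit of edges can be inspected from whichever end
    is convenient, and an element carrying one residue edge at [A] to another fixes the vertex of
    [A]: this is why orbits of edges are orbits of residues under automorphisms. The choice of end
    matters. For n >= d all residues are equivalent, so the edge between n and n + d is counted from
    n + d; the other edges are counted from an end n < d. The obstacle is n = 0, where freeness of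
    PGL_2(k) may fail. A quadratic equation over k for a residue turns a first minimum into another
    solution of the same degree; when 2 j < d this is a constant multiple of the first one, so the
    residue is constant and j = 0. Hence only the edges between the two vertices of index 0 are
    affected. That the exceptional orbit really occurs there is not shown by constructing F_(q^2)
    but by arithmetic: without it q + 1 would divide a power of q. *)

Section Fractions.

Variables (k : fieldType) (F : fieldType) (iota : {rmorphism {poly k} -> F}).
Hypothesis iota_inj : injective iota.
Implicit Types (a b c e p : {poly k}) (x : F).

Lemma iota_eq0 p : (iota p == 0) = (p == 0).
Proof. by rewrite -(inj_eq iota_inj) rmorph0. Qed.

Lemma fraction_cancel p a b : p != 0 ->
  iota (p * a) / iota (p * b) = iota a / iota b.
Proof.
by move=> p0; rewrite !rmorphM -mulf_div divff ?mul1r // iota_eq0.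
Qed.

Lemma eq_fraction a b c e : b != 0 -> e != 0 ->
  iota a / iota b = iota c / iota e -> a * e = c * b.
Proof.
move=> b0 e0 /eqP; rewrite eqr_div ?iota_eq0 // -!rmorphM.
by move/eqP/iota_inj.
Qed.

Lemma coprime_fraction x : (exists a b, b != 0 /\ x = iota a / iota b) ->
  exists a b, [/\ coprimep a b, b != 0 & x = iota a / iota b].
Proof.
case=> n [d [d0 xE]].
have g0 : gcdp n d != 0 by rewrite gcdp_eq0 negb_and d0 orbT.
have nE := divpK (dvdp_gcdl n d); have dE := divpK (dvdp_gcdr n d).
have dd0 : d %/ gcdp n d != 0.
  by apply: contraNneq d0 => E; rewrite -dE E mul0r.
exists (n %/ gcdp n d), (d %/ gcdp n d); split=> //.
  by apply: coprimep_div_gcd; rewrite d0 orbT.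
have := fraction_cancel (n %/ gcdp n d) (d %/ gcdp n d) g0.
by rewrite ![gcdp n d * _]mulrC nE dE -xE.
Qed.

End Fractions.

Section RationalFunctions.

Variable k : fieldType.
Implicit Types (f g a b p : {poly k}) (x y : ratfun k).

Lemma ratfunE x : x = (\n_(repr x))%:F / (\d_(repr x))%:F.
Proof.
have d0 := denom_ratioP (repr x).
rewrite -{1}[x]reprK.
apply/(mulIf (x := (\d_(repr x))%:F)); first by rewrite tofrac_eq0.
rewrite divfK ?tofrac_eq0 // !piE.
apply/eqmodP => /=.
rewrite FracField.equivfE /FracField.mulf !numden_Ratio ?mulr1 ?oner_eq0 ?mul1r //.
by rewrite mulrC.
Qed.

Lemma tofrac_inj : injective (@FracField.tofrac {poly k}).
Proof. by move=> a b /eqP; rewrite tofrac_eq => /eqP. Qed.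

Lemma ratfun_fraction x : exists a b, b != 0 /\ x = a%:F / b%:F.
Proof. by exists \n_(repr x), \d_(repr x); rewrite denom_ratioP -ratfunE. Qed.

(** The bound i < [size a] in [multiplicity] loses nothing, because a nonconstant [g] has
    [size (g ^+ i)] greater than i. So a cofactor still divisible by [g] would contradict
    maximality. *)
Lemma multiplicityP g a : irreducible_poly g -> a != 0 ->
  exists2 b, ~~ (g %| b) & a = g ^+ multiplicity g a * b.
Proof.
move=> g_irr a0; have sa : (0 < size a)%N by rewrite size_poly_gt0.
have [[i ia] /= gia mE] : {i : 'I_(size a) | g ^+ i %| a &
    multiplicity g a = i}.
  apply: eq_bigmax_cond; apply/card_gt0P; exists (Ordinal sa).
  rewrite -topredE /=; exact: dvd1p.
have /dvdpP[b ab] := gia.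
exists b; last by rewrite mE mulrC.
apply/negP => /dvdpP[c bc].
have gSa : g ^+ i.+1 %| a by rewrite ab bc exprS -mulrA dvdp_mulIr.
have iSa : (i.+1 < size a)%N.
  apply: leq_trans (dvdp_leq a0 gSa).
  have g0 : g ^+ i.+1 != 0 by rewrite expf_neq0 ?irredp_neq0.
  have := size_exp g i.+1; have := g_irr.1; rewrite -size_poly_gt0 in g0.
  by case: (size g) => // -[|s] // _; case: (size _) g0 => //= s' _ ->; nia.
have := @leq_bigmax_cond _ (fun i : 'I_(size a) => g ^+ i %| a) val
  (Ordinal iSa) gSa.
by rewrite -[X in (_ <= X)%N]/(multiplicity g a) mE ltnn.
Qed.

Lemma irreducible_dvdpM g a b : irreducible_poly g ->
  (g %| a * b) = (g %| a) || (g %| b).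
Proof.
move=> g_irr; have [ga|nga] /= := boolP (g %| a); first exact: dvdp_mulr.
by rewrite Gauss_dvdpr // irreducible_poly_coprime.
Qed.

Lemma irreducible_dvdp1 g : irreducible_poly g -> ~~ (g %| 1).
Proof.
move=> g_irr; rewrite dvdp1; apply/eqP => s1.
by have := g_irr.1; rewrite s1.
Qed.

Lemma irreducible_dvdpX g a n : irreducible_poly g -> g %| a ^+ n -> g %| a.
Proof.
move=> g_irr; elim: n => [|n IH].
  by rewrite expr0 (negPf (irreducible_dvdp1 g_irr)).
by rewrite exprS irreducible_dvdpM // => /orP[|/IH].
Qed.

Lemma ndvdp_neq0 g a : ~~ (g %| a) -> a != 0.
Proof. by apply: contraNneq => ->; exact: dvdp0. Qed.

(** The representative [repr x] need not be in lowest terms: common powers of [g] are cancelled in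
    one direction, and in the other an arbitrary fraction is compared with it by cross
    multiplication. *)
Lemma valuation_ring_nu g x : irreducible_poly g ->
  valuation_ring (nu g) x <->
  exists a b, ~~ (g %| b) /\ x = a%:F / b%:F.
Proof.
move=> g_irr; have g0 := irredp_neq0 g_irr.
have d0 := denom_ratioP (repr x).
split.
  case=> [->|].
    exists 0, 1; split; first exact: irreducible_dvdp1.
    by rewrite tofrac0 mul0r.
  rewrite /nu => le0.
  have [n0|n0] := eqVneq \n_(repr x) 0.
    exists 0, 1; split; first exact: irreducible_dvdp1.
    by rewrite [x]ratfunE n0 !tofrac0 !mul0r.
  have [n' gn' nE] := multiplicityP g_irr n0.
  have [d' gd' dE] := multiplicityP g_irr d0.
  move: le0 nE dE.
  move: (multiplicity g \n_(repr x)) (multiplicity g \d_(repr x)) => i j.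
  rewrite subr_ge0 lez_nat => le1 nE dE.
  exists (g ^+ (i - j) * n'), d'; split=> //.
  rewrite [x]ratfunE nE dE.
  have -> : g ^+ i * n' = g ^+ j * (g ^+ (i - j) * n').
    by rewrite mulrA -exprD subnKC.
  by apply: (fraction_cancel tofrac_inj); rewrite expf_neq0.
case=> a [b [gb xE]].
have [x0|x0] := eqVneq x 0; [by left | right].
have b0 := ndvdp_neq0 gb.
have n0 : \n_(repr x) != 0.
  by apply: contraNneq x0 => n0; rewrite [x]ratfunE n0 tofrac0 mul0r.
have := ratfunE x; rewrite {1}xE => /(eq_fraction tofrac_inj b0 d0).
have [n' gn' nE] := multiplicityP g_irr n0.
have [d' gd' dE] := multiplicityP g_irr d0.
rewrite /nu; move: nE dE.
move: (multiplicity g \n_(repr x)) (multiplicity g \d_(repr x)) => i j.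
move=> -> -> E; rewrite subr_ge0 lez_nat leqNgt; apply/negP => lt_ij.
have : g ^+ i * (g * (a * g ^+ (j - i.+1) * d')) = g ^+ i * (n' * b).
  rewrite [RHS]mulrA -E mulrCA -[in RHS](subnKC lt_ij) exprD exprSr; ring.
move/(mulfI (expf_neq0 _ g0)) => E2.
have : g %| n' * b by rewrite -E2 dvdp_mulIl.
by rewrite irreducible_dvdpM // (negPf gn') (negPf gb).
Qed.

Lemma exists_irreducible_factor p : (1 < size p)%N ->
  exists2 g, g \is monic /\ irreducible_poly g & g %| p.
Proof.
have [n] := ubnP (size p); elim: n p => // n IH p lt_pn p_gt1.
have p0 : p != 0 by rewrite -size_poly_gt0 ltnW.
have [[q [q1 qp nqp]]|np] :=
  pselect (exists q : {poly k}, [/\ size q != 1%N, q %| p & ~~ (q %= p)]).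
  have lt_qp : (size q < size p)%N.
    by rewrite ltn_neqAle dvdp_leq // andbT dvdp_size_eqp.
  have [||g g_irr gq] := IH q; first exact: leq_trans lt_qp _.
    have q0 : q != 0 by apply: contraNneq p0 => q0; rewrite q0 dvd0p in qp.
    by rewrite ltn_neqAle eq_sym q1 size_poly_gt0.
  by exists g => //; exact: dvdp_trans gq qp.
have lp : (lead_coef p)^-1 != 0 by rewrite invr_eq0 lead_coef_eq0.
exists ((lead_coef p)^-1 *: p); last by rewrite dvdpZl.
split; first by rewrite monicE lead_coefZ mulVf // lead_coef_eq0.
split; first by rewrite size_scale.
move=> q q1; rewrite dvdpZr // => qp.
apply: (eqp_trans (y := p)); last by rewrite eqp_sym eqp_scale.
by apply: contrapT => /negP nqp; apply: np; exists q.
Qed.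

Lemma unique_prime_factor f b : f \is monic -> irreducible_poly f -> b != 0 ->
  (forall g, g \is monic -> irreducible_poly g -> g %| b -> g = f) ->
  exists c r, c != 0 /\ b = c *: f ^+ r.
Proof.
move=> f_monic f_irr b0 H; have f0 := irredp_neq0 f_irr.
have [b' fb' bE] := multiplicityP f_irr b0.
have b'0 := ndvdp_neq0 fb'.
have [/exists_irreducible_factor[g [gm gi] gb]|] := ltnP 1 (size b').
  have gf : g = f by apply: H => //; rewrite bE dvdp_mull.
  by rewrite -gf gb in fb'.
move=> /size1_polyC b'E.
exists b'`_0, (multiplicity f b); split.
  by apply: contraNneq b'0 => c0; rewrite b'E c0.
by rewrite {1}bE {1}b'E mulrC mul_polyC.
Qed.

Lemma size_irreducible_exp f d r : size f = d.+1 -> size (f ^+ r) = (r * d).+1.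
Proof.
move=> hd; have f0 : f != 0 by rewrite -size_poly_gt0 hd.
have := size_exp f r; rewrite hd /= mulnC.
by have := expf_neq0 r f0; rewrite -size_poly_gt0; case: size => //= n _ ->.
Qed.

Lemma nu_infty_ge0 x a b : b != 0 -> x = a%:F / b%:F ->
  valuation_ring (@nu_infty k) x <-> (size a <= size b)%N.
Proof.
move=> b0 xE; have d0 := denom_ratioP (repr x).
have [x0|x0] := eqVneq x 0.
  move: xE; rewrite x0 => /esym/eqP; rewrite mulf_eq0 invr_eq0 !tofrac_eq0.
  by rewrite (negPf b0) orbF => /eqP ->; rewrite size_poly0; split=> // _; left.
have n0 : \n_(repr x) != 0.
  by apply: contraNneq x0 => n0; rewrite [x]ratfunE n0 tofrac0 mul0r.
have a0 : a != 0 by apply: contraNneq x0 => a0; rewrite xE a0 tofrac0 mul0r.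
have := ratfunE x; rewrite {1}xE => /(eq_fraction tofrac_inj b0 d0) E.
have {}E : size (a * \d_(repr x)) = size (\n_(repr x) * b) by rewrite E.
rewrite !size_mul // in E.
have sa : (0 < size a)%N by rewrite size_poly_gt0.
have sb : (0 < size b)%N by rewrite size_poly_gt0.
have sn : (0 < size \n_(repr x))%N by rewrite size_poly_gt0.
have sd : (0 < size \d_(repr x))%N by rewrite size_poly_gt0.
rewrite /valuation_ring /nu_infty /=.
move: sa sb sn sd E.
move: (size a) (size b) (size \n_(repr x)) (size \d_(repr x)) => i j n m.
move=> sa sb sn sd E; split=> [[/eqP|]|H].
- by rewrite (negPf x0).
- rewrite subr_ge0 lez_nat => le1; lia.
- right; rewrite subr_ge0 lez_nat; lia.
Qed.

(** In lowest terms every monic irreducible divisor of the denominator is a pole, hence equals [f];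
    so the denominator is a constant times a power of [f], and regularity at infinity becomes the
    degree bound. *)
Lemma O_poles_atP f d x : f \is monic -> irreducible_poly f -> size f = d.+1 ->
  O_poles_at f x <->
  exists a r, (size a <= (r * d).+1)%N /\ x = a%:F / (f ^+ r)%:F.
Proof.
move=> f_monic f_irr hd; have f0 := irredp_neq0 f_irr; split.
  case=> H xinf; have [a [b [cop b0 /= xE]]] := coprime_fraction tofrac_inj (ratfun_fraction x).
  have [g gm gi gb|c [r [c0 bE]]] := unique_prime_factor f_monic f_irr b0.
    apply: contrapT => gf.
    have /(valuation_ring_nu _ gi)[a' [b' [gb' xE']]] := H g gm gi gf.
    have b'0 := ndvdp_neq0 gb'.
    have E : a * b' = a' * b by apply: (eq_fraction tofrac_inj); rewrite // -xE -xE'.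
    have : g %| a * b' by rewrite E dvdp_mull.
    rewrite irreducible_dvdpM // (negPf gb') orbF => ga.
    have /coprimepP/(_ g ga gb) := cop.
    by rewrite -size_poly_eq1 => /eqP s1; have := gi.1; rewrite s1.
  exists (c^-1 *: a), r; split.
    have /(nu_infty_ge0 b0 xE) := xinf.
    by rewrite bE !size_scale ?invr_eq0 // (size_irreducible_exp _ hd).
  rewrite xE bE -!mul_polyC !tofracM.
  have C0 : (c%:P)%:F != 0 by rewrite tofrac_eq0 polyC_eq0.
  have -> : (c^-1%:P)%:F = (c%:P)%:F^-1.
    by apply: (mulIf C0); rewrite mulVf // -tofracM -polyCM mulVf.
  by rewrite invfM mulrCA mulrA.
case=> a [r [sa xE]]; split.
  move=> g gm gi gf; apply/(valuation_ring_nu _ gi).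
  exists a, (f ^+ r); split=> //; apply/negP => /(irreducible_dvdpX gi) gdf.
  apply: gf.
  have : g %= f by apply: f_irr.2 => //; have := gi.1; case: size => [|[]].
  by rewrite eqp_monic // => /eqP.
by apply/(nu_infty_ge0 _ xE); rewrite ?expf_neq0 // (size_irreducible_exp _ hd).
Qed.

End RationalFunctions.

(** * Lattices in F^2 and orbits of vertices and edges *)

Definition mx2 (R : Type) (a b c d : R) : 'M[R]_2 :=
  \matrix_(i, j) if i == 0 then (if j == 0 then a else b)
                 else if j == 0 then c else d.

Lemma ord2P (P : 'I_2 -> Prop) : P 0 -> P 1 -> forall i, P i.
Proof.
move=> P0 P1 [[|[|//]] i_lt].
  by rewrite (_ : Ordinal _ = 0) //; apply: val_inj.
by rewrite (_ : Ordinal _ = 1) //; apply: val_inj.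
Qed.

Lemma sum_ord2 (R : nmodType) (G : 'I_2 -> R) : \sum_(i < 2) G i = G 0 + G 1.
Proof.
by rewrite big_ord_recl big_ord1; congr (_ + G _); apply: val_inj.
Qed.

Lemma mx2E (R : Type) (A : 'M[R]_2) : A = mx2 (A 0 0) (A 0 1) (A 1 0) (A 1 1).
Proof. by apply/matrixP; apply: ord2P; apply: ord2P; rewrite !mxE. Qed.

Lemma mulmx2 (R : pzSemiRingType) (a b c d a' b' c' d' : R) :
  mx2 a b c d *m mx2 a' b' c' d' =
  mx2 (a * a' + b * c') (a * b' + b * d') (c * a' + d * c') (c * b' + d * d').
Proof.
apply/matrixP; apply: ord2P; apply: ord2P;
  by rewrite !mxE !big_ord_recl big_ord0 !mxE addr0.
Qed.

Lemma scale_mx2 (R : pzSemiRingType) (e a b c d : R) :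
  e *: mx2 a b c d = mx2 (e * a) (e * b) (e * c) (e * d).
Proof. by apply/matrixP; apply: ord2P; apply: ord2P; rewrite !mxE. Qed.

Lemma mx2_1 (R : pzSemiRingType) : 1%:M = mx2 1 0 0 1 :> 'M[R]_2.
Proof. by apply/matrixP; apply: ord2P; apply: ord2P; rewrite !mxE. Qed.

Lemma det_mx2 (R : comPzRingType) (a b c d : R) :
  \det (mx2 a b c d) = a * d - b * c.
Proof.
rewrite (expand_det_row _ 0) !big_ord_recl big_ord0 addr0 /cofactor !det_mx11 !mxE /=.
by rewrite expr0 mul1r expr1 mulN1r mulrN.
Qed.

Lemma map_mx2 (R S : Type) (h : R -> S) (a b c d : R) :
  map_mx h (mx2 a b c d) = mx2 (h a) (h b) (h c) (h d).
Proof. by apply/matrixP; apply: ord2P; apply: ord2P; rewrite !mxE. Qed.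

Lemma invmxM (F : fieldType) n (A B : 'M[F]_n) :
  A \in unitmx -> B \in unitmx -> invmx (A *m B) = invmx B *m invmx A.
Proof.
move=> Au Bu; have ABu : A *m B \in unitmx by rewrite unitmx_mul Au.
have E : A *m B *m (invmx B *m invmx A) = 1%:M.
  by rewrite mulmxA -(mulmxA A) mulmxV // mulmx1 mulmxV.
by rewrite -[RHS](mulKmx ABu) E mulmx1.
Qed.

Lemma unitmx2 (F : fieldType) (a b c d : F) :
  (mx2 a b c d \in unitmx) = (a * d - b * c != 0).
Proof. by rewrite unitmxE det_mx2 unitfE. Qed.

Definition subring (F : fieldType) (O : set F) : Prop :=
  [/\ O 1, forall x y, O x -> O y -> O (x - y) &
      forall x y, O x -> O y -> O (x * y)].

Section Subring.

Variables (F : fieldType) (O : set F).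
Implicit Types (g h : 'M[F]_2) (c : F).
Hypothesis OO : subring O.

Lemma subring1 : O 1. Proof. by case: OO. Qed.

Lemma subringB x y : O x -> O y -> O (x - y). Proof. by case: OO => _ + _; apply. Qed.

Lemma subringM x y : O x -> O y -> O (x * y). Proof. by case: OO => _ _; apply. Qed.

Lemma subring0 : O 0. Proof. by rewrite -(subrr 1); apply: subringB subring1 subring1. Qed.

Lemma subringN x : O x -> O (- x).
Proof. by rewrite -sub0r; apply: subringB subring0. Qed.

Lemma subringD x y : O x -> O y -> O (x + y).
Proof. by move=> Ox Oy; rewrite -[y]opprK; apply: subringB Ox (subringN Oy). Qed.

Lemma subring_mulmx m n p (A : 'M[F]_(m, n)) (B : 'M[F]_(n, p)) :
  (forall i j, O (A i j)) -> (forall i j, O (B i j)) -> forall i j, O ((A *m B) i j).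
Proof.
move=> OA OB i j; rewrite mxE.
by apply: (big_ind O subring0 subringD) => l _; apply: subringM.
Qed.

Lemma subring_mx1 : mx_over O 1%:M.
Proof.
move=> i j; rewrite mxE; case: eqP => _; [exact: subring1 | exact: subring0].
Qed.

Lemma GL2_1 : GL2 O 1%:M.
Proof.
split; first exact: subring_mx1.
by exists 1%:M; rewrite ?mulmx1; first exact: subring_mx1.
Qed.

Lemma GL2_mul g h : GL2 O g -> GL2 O h -> GL2 O (g *m h).
Proof.
case=> Og [g' Og' [gg' g'g]] [Oh [h' Oh' [hh' h'h]]].
split; first exact: subring_mulmx.
exists (h' *m g'); first exact: subring_mulmx.
by rewrite !mulmxA -(mulmxA g) hh' mulmx1 gg' -(mulmxA h') g'g mulmx1 h'h.
Qed.

Lemma GL2_unitmx g : GL2 O g -> g \in unitmx.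
Proof. by case=> _ [h _ [gh _]]; have [] := mulmx1_unit gh. Qed.

Lemma GL2_invmx g : GL2 O g -> GL2 O (invmx g).
Proof.
move=> gO; have gu := GL2_unitmx gO; case: gO => Og [h Oh [gh hg]].
have -> : invmx g = h by rewrite -[RHS](mulKmx gu) gh mulmx1.
by split=> //; exists g.
Qed.

Lemma GL2P g : g \in unitmx ->
  GL2 O g <-> mx_over O g /\ mx_over O (invmx g).
Proof.
move=> gu; split=> [gO|[Og Oi]].
  by split; [case: gO | case: (GL2_invmx gO)].
by split=> //; exists (invmx g); rewrite ?mulmxV ?mulVmx.
Qed.

(** Every lattice has this form, with an invertible [g] unique up to right multiplication by
    [GL2 O]. The group acts by left multiplication, so change of basis and action commute. *)
Definition Lat (g : 'M[F]_2) : set 'cV[F]_2 :=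
  [set g *m x | x in [set x : 'cV[F]_2 | forall i j, O (x i j)]].

Lemma image_Lat h g : [set h *m x | x in Lat g] = Lat (h *m g).
Proof.
apply/seteqP; split=> w /=.
  by case=> _ [x Ox <-] <-; exists x; rewrite // mulmxA.
by case=> x Ox <-; exists (g *m x); rewrite ?mulmxA //; exists x.
Qed.

Lemma scale_Lat c g : [set c *: x | x in Lat g] = Lat (c *: g).
Proof.
apply/seteqP; split=> w /=.
  by case=> _ [x Ox <-] <-; exists x; rewrite // scalemxAl.
by case=> x Ox <-; exists (g *m x); rewrite ?scalemxAl //; exists x.
Qed.

Lemma Lat_subP g h : g \in unitmx ->
  Lat h `<=` Lat g <-> mx_over O (invmx g *m h).
Proof.
move=> gu; split.
  move=> sub i j.
  have [] : Lat g (h *m delta_mx j 0).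
    apply: sub; exists (delta_mx j 0) => // i' j'; rewrite mxE.
    by case: (_ && _); [exact: subring1 | exact: subring0].
  move=> x Ox /(congr1 (mulmx (invmx g))); rewrite mulKmx // mulmxA => E.
  have := Ox i 0; rewrite E -colE mxE; exact.
move=> Ogh _ [x Ox <-]; exists (invmx g *m h *m x).
  exact: subring_mulmx.
by rewrite !mulmxA mulmxV // mul1mx.
Qed.

Lemma Lat_eqP g h : g \in unitmx -> h \in unitmx ->
  Lat g = Lat h <-> GL2 O (invmx g *m h).
Proof.
move=> gu hu; have u : invmx g *m h \in unitmx by rewrite unitmx_mul unitmx_inv gu.
rewrite GL2P // invmxM ?unitmx_inv // invmxK.
split=> [E|[H1 H2]].
  by split; apply/Lat_subP => //; rewrite E.
by apply/seteqP; split; apply/Lat_subP.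
Qed.

Lemma Lat_mul_GL2 g h : g \in unitmx -> GL2 O h -> Lat (g *m h) = Lat g.
Proof.
move=> gu hO; apply/esym/Lat_eqP; rewrite ?unitmx_mul ?gu ?(GL2_unitmx hO) //.
by rewrite mulKmx.
Qed.

Lemma latticeP L : lattice O L <-> exists2 g, g \in unitmx & L = Lat g.
Proof.
split=> [[u [v [LE ind gen]]]|[g gu ->]].
  pose g := mx2 (u 0 0) (v 0 0) (u 1 0) (v 1 0).
  have gE (x : 'cV[F]_2) : g *m x = x 0 0 *: u + x 1 0 *: v.
    by apply/colP; apply: ord2P; rewrite !mxE sum_ord2 !mxE /= !(mulrC (x _ 0)).
  have gu : g \in unitmx.
    have [a [b E0]] := gen (delta_mx 0 0); have [c [e E1]] := gen (delta_mx 1 0).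
    suff /mulmx1_unit[] : g *m mx2 a c b e = 1%:M by [].
    rewrite mulmx2 mx2_1; congr mx2.
    - by have := congr1 (fun w : 'cV[F]_2 => w 0 0) E0; rewrite !mxE /= => E; rewrite (mulrC (u _ _)) (mulrC (v _ _)) -E.
    - by have := congr1 (fun w : 'cV[F]_2 => w 0 0) E1; rewrite !mxE /= => E; rewrite (mulrC (u _ _)) (mulrC (v _ _)) -E.
    - by have := congr1 (fun w : 'cV[F]_2 => w 1 0) E0; rewrite !mxE /= => E; rewrite (mulrC (u _ _)) (mulrC (v _ _)) -E.
    - by have := congr1 (fun w : 'cV[F]_2 => w 1 0) E1; rewrite !mxE /= => E; rewrite (mulrC (u _ _)) (mulrC (v _ _)) -E.
  exists g => //; rewrite LE; apply/seteqP; split=> w /=.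
    case=> a [b [Oa Ob ->]]; exists (\col_i (if i == 0 then a else b)).
      by move=> i j; rewrite !mxE; case: ifP.
    by rewrite gE !mxE.
  by case=> x Ox <-; exists (x 0 0), (x 1 0); split; rewrite ?gE //; apply: Ox.
have gE (x : 'cV[F]_2) : g *m x = x 0 0 *: col 0 g + x 1 0 *: col 1 g.
  by apply/colP => i; rewrite !mxE sum_ord2 !(mulrC (x _ 0)).
have gE2 a b : a *: col 0 g + b *: col 1 g = g *m \col_i (if i == 0 then a else b).
  by rewrite gE !mxE.
exists (col 0 g), (col 1 g); split.
- apply/seteqP; split=> w /=.
    by case=> x Ox <-; exists (x 0 0), (x 1 0); split; rewrite ?gE //; apply: Ox.
  case=> a [b [Oa Ob ->]]; rewrite gE2.
  by eexists; last reflexivity; move=> i j; rewrite !mxE; case: ifP.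
- move=> a b _ _; rewrite gE2 => /(congr1 (mulmx (invmx g))).
  rewrite mulKmx // mulmx0 => /colP E.
  by have := E 0; have := E 1; rewrite !mxE.
- by move=> w; exists ((invmx g *m w) 0 0), ((invmx g *m w) 1 0); rewrite -gE mulKVmx.
Qed.

Definition vtx (g : 'M[F]_2) : set (set 'cV[F]_2) := homothety_class (Lat g).

Lemma vtxE g M : vtx g M <-> exists2 c, c != 0 & M = Lat (c *: g).
Proof.
by split=> [[c c0 <-]|[c c0 ->]]; exists c => //; exact/scale_Lat.
Qed.

Lemma vtx_Lat g : vtx g (Lat g).
Proof. by apply/vtxE; exists 1; rewrite ?scale1r ?oner_neq0. Qed.

Lemma vtx_eqP g h : vtx g = vtx h <-> exists2 c, c != 0 & Lat h = Lat (c *: g).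
Proof.
split=> [E|[c c0 E]].
  by apply/vtxE; rewrite E; exact: vtx_Lat.
apply/seteqP; split=> M /vtxE[b b0 ->]; apply/vtxE.
  exists (b / c); first by rewrite mulf_neq0 ?invr_neq0.
  by rewrite -[RHS]scale_Lat E scale_Lat scalerA divfK.
exists (b * c); first exact: mulf_neq0.
by rewrite -scale_Lat E scale_Lat scalerA.
Qed.

Lemma vtx_scale c g : c != 0 -> vtx (c *: g) = vtx g.
Proof. by move=> c0; apply/esym/vtx_eqP; exists c. Qed.

Lemma vtx_mul_GL2 g h : g \in unitmx -> GL2 O h -> vtx (g *m h) = vtx g.
Proof. by move=> gu hO; rewrite /vtx Lat_mul_GL2. Qed.

Lemma tree_verticesP v :
  tree_vertices O v <-> exists2 g, g \in unitmx & v = vtx g.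
Proof.
split; first by case=> L /latticeP[g gu ->] <-; exists g.
by case=> g gu ->; exists (Lat g) => //; apply/latticeP; exists g.
Qed.

Lemma vtx_mulr h g g' : vtx g = vtx g' -> vtx (h *m g) = vtx (h *m g').
Proof.
move=> /vtx_eqP[c c0 E]; apply/vtx_eqP; exists c => //.
by rewrite -image_Lat E image_Lat scalemxAr.
Qed.

End Subring.

Section Action.

Variables (F : fieldType) (O R : set F).
Implicit Types (g h l : 'M[F]_2).
Hypotheses (OO : subring O) (RR : subring R).

Local Notation vtx := (vtx O).

Lemma units_of_neq0 c : units_of R c -> c != 0.
Proof.
case=> _ [d _ E]; apply/eqP => c0; move: E.
by rewrite c0 mul0r => /esym/eqP; rewrite oner_eq0.
Qed.

(** Homothety classes absorb scalars, so a coset acts through any of its matrices; this replaces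
    PGL_2 by matrices from here on. *)
Lemma act_vtx h g : act [set c *: h | c in units_of R] (vtx g) = vtx (h *m g).
Proof.
apply/seteqP; split=> M.
  case=> _ [_ [[c cR <-] /vtxE[b b0 ->] ->]]; apply/vtxE.
  exists (c * b); first exact: mulf_neq0 (units_of_neq0 cR) b0.
  by rewrite image_Lat -scalemxAl -scalemxAr scalerA.
case/vtxE => b b0 ->; exists h, (Lat O (b *: g)); split.
- exists 1; last by rewrite scale1r.
  by split; [exact: subring1 RR | exists 1; [exact: (subring1 RR) | rewrite mulr1]].
- by apply/vtxE; exists b.
- by rewrite image_Lat scalemxAr.
Qed.

Lemma vertex_orbit_vtx g :
  vertex_orbit R (vtx g) = [set vtx (h *m g) | h in GL2 R].
Proof.
apply/seteqP; split=> v.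
  by case=> _ [h hR <-] <-; exists h; rewrite ?act_vtx.
by case=> h hR <-; exists [set c *: h | c in units_of R]; rewrite ?act_vtx //; exists h.
Qed.

Lemma edge_orbit_vtx g g' :
  edge_orbit R [set vtx g; vtx g'] =
  [set [set vtx (h *m g); vtx (h *m g')] | h in GL2 R].
Proof.
have E h : act [set c *: h | c in units_of R] @` [set vtx g; vtx g'] =
    [set vtx (h *m g); vtx (h *m g')].
  apply/seteqP; split=> v; first by case=> _ [->|->] <-; rewrite act_vtx; [left|right].
  by case=> ->; [exists (vtx g) | exists (vtx g')]; rewrite ?act_vtx //; [left|right].
apply/seteqP; split=> e.
  by case=> _ [h hR <-] <-; exists h; rewrite ?E.
case=> h hR <-; exists [set c *: h | c in units_of R]; last exact: E.
by exists h.
Qed.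

Lemma vertex_orbit_eqP g g' :
  vertex_orbit R (vtx g) = vertex_orbit R (vtx g') <->
  exists2 h, GL2 R h & vtx g' = vtx (h *m g).
Proof.
rewrite !vertex_orbit_vtx; split=> [E|[h hR E]].
  have : [set vtx (h *m g) | h in GL2 R] (vtx g').
    by rewrite E; exists 1%:M; [exact: GL2_1 RR | rewrite mul1mx].
  by case=> h hR <-; exists h.
have hu := GL2_unitmx hR.
apply/seteqP; split=> _ [l lR <-].
  exists (l *m invmx h); first exact: (GL2_mul RR lR (GL2_invmx hR)).
  rewrite (vtx_mulr _ E) mulmxA mulmxKV //.
exists (l *m h); first exact: (GL2_mul RR).
by rewrite (vtx_mulr _ E) mulmxA.
Qed.

(** The pairs stay unordered at this point; a swap of the two ends is excluded only later, by
    parity. *)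
Lemma edge_orbit_eqP g1 g2 g1' g2' :
  edge_orbit R [set vtx g1; vtx g2] = edge_orbit R [set vtx g1'; vtx g2'] <->
  exists2 h, GL2 R h &
    [set vtx g1'; vtx g2'] = [set vtx (h *m g1); vtx (h *m g2)].
Proof.
rewrite !edge_orbit_vtx; split=> [E|[h hR E]].
  have : [set [set vtx (h *m g1); vtx (h *m g2)] | h in GL2 R] [set vtx g1'; vtx g2'].
    by rewrite E; exists 1%:M; [exact: GL2_1 RR | rewrite !mul1mx].
  by case=> h hR <-; exists h.
have hu := GL2_unitmx hR.
have key l : [set vtx (l *m g1'); vtx (l *m g2')] =
    [set vtx (l *m h *m g1); vtx (l *m h *m g2)].
  have im a b : [set vtx (l *m a); vtx (l *m b)] =
      act [set c *: l | c in units_of R] @` [set vtx a; vtx b].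
    apply/seteqP; split=> v.
      by case=> ->; [exists (vtx a)|exists (vtx b)]; rewrite ?act_vtx //; [left|right].
    by case=> _ [->|->] <-; rewrite act_vtx; [left|right].
  by rewrite im E -!mulmxA im.
apply/seteqP; split=> _ [l lR <-].
  exists (l *m invmx h); first exact: (GL2_mul RR lR (GL2_invmx hR)).
  by rewrite key mulmxKV.
by exists (l *m h); [exact: (GL2_mul RR) | rewrite key].
Qed.

End Action.

(** * Bases reduced at infinity *)

(* [F] plays the fraction field of [k[t]] through [iota]; keeping it abstract
   prevents unification from unfolding the quotient type [{fraction _}]. *)
Section LocalRing.

Variables (k : fieldType) (F : fieldType) (iota : {rmorphism {poly k} -> F}).
Hypothesis iota_inj : injective iota.
Hypothesis iota_frac : forall x, exists a b, b != 0 /\ x = iota a / iota b.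
Variable f : {poly k}.
Hypothesis f_irr : irreducible_poly f.
Implicit Types (a b p : {poly k}) (x y u : F).

Definition loc_ring : set F :=
  [set x | exists a b, ~~ (f %| b) /\ x = iota a / iota b].

Local Notation O := loc_ring.

Let f0 : f != 0 := irredp_neq0 f_irr.

Lemma iota_neq0 p : p != 0 -> iota p != 0.
Proof. by rewrite iota_eq0. Qed.

Lemma loc_ring_poly p : O (iota p).
Proof. by exists p, 1; rewrite irreducible_dvdp1 // rmorph1 divr1. Qed.

Lemma loc_ring_inv b : ~~ (f %| b) -> O (iota b)^-1.
Proof. by move=> fb; exists 1, b; rewrite rmorph1 div1r. Qed.

Lemma subring_loc : subring O.
Proof.
split.
- by rewrite -(rmorph1 iota); exact: loc_ring_poly.
- move=> x y [a [b [fb ->]]] [a' [b' [fb' ->]]].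
  exists (a * b' - a' * b), (b * b'); split.
    by rewrite irreducible_dvdpM // negb_or fb.
  have b0 := iota_neq0 (ndvdp_neq0 fb).
  have b'0 := iota_neq0 (ndvdp_neq0 fb').
  by rewrite rmorphB !rmorphM; field; rewrite b0 b'0.
- move=> x y [a [b [fb ->]]] [a' [b' [fb' ->]]].
  exists (a * a'), (b * b'); rewrite irreducible_dvdpM // negb_or fb; split=> //.
  by rewrite mulf_div !rmorphM.
Qed.

Lemma loc_ring_total x : O x \/ O x^-1.
Proof.
have [a [b [cop b0 ->]]] := coprime_fraction iota_inj (iota_frac x).
have [fb|fb] := boolP (f %| b); last by left; exists a, b.
right; exists b, a; rewrite invf_div; split=> //.
apply/negP => fa; have /coprimepP/(_ f fa fb) := cop.
by rewrite -size_poly_eq1 => /eqP s1; have := f_irr.1; rewrite s1.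
Qed.

(** A unit times a power of [f], written with two natural exponents so that negative valuations need
    no separate treatment. *)
Lemma loc_ring_decomp x : x != 0 -> exists i j u,
  [/\ u != 0, O u, O u^-1 & x * iota (f ^+ i) = u * iota (f ^+ j)].
Proof.
have [a [b [b0 ->]]] := iota_frac x => x0.
have a0 : a != 0 by apply: contraNneq x0 => ->; rewrite rmorph0 mul0r.
have [a' fa' aE] := multiplicityP f_irr a0.
have [b' fb' bE] := multiplicityP f_irr b0.
exists (multiplicity f b), (multiplicity f a), (iota a' / iota b').
have a'0 := iota_neq0 (ndvdp_neq0 fa').
have b'0 := iota_neq0 (ndvdp_neq0 fb').
split.
- by rewrite mulf_neq0 ?invr_eq0.
- by exists a', b'.
- by exists b', a'; rewrite invf_div.
- have P0 i := iota_neq0 (expf_neq0 i f0).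
  rewrite {1}aE {1}bE !rmorphM; field.
  by rewrite b'0 P0.
Qed.

(** A Bezout relation inverts the denominator modulo [f ^+ i], so residues of [O] have polynomial
    representatives. *)
Lemma loc_ring_approx i x : O x -> exists p y, O y /\ x = iota p + iota (f ^+ i) * y.
Proof.
case=> a [b [fb ->]]; have b0 := ndvdp_neq0 fb.
have cop : coprimep b (f ^+ i).
  by rewrite coprimep_expr // coprimep_sym irreducible_poly_coprime.
have /Bezout_eq1_coprimepP[[u v] /= E] := cop.
exists (a * u), (iota (a * v) / iota b); split; first by exists (a * v), b.
have B0 := iota_neq0 b0.
apply: (mulIf B0); rewrite divfK // mulrDl mulrA divfK // -!rmorphM -rmorphD.
by congr (iota _); rewrite -[LHS]mulr1 -E; ring.
Qed.

(** O_p meets k[t][1/f] in k[t]; this turns changes of basis over [O] into changes of basis over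
    k[t]. *)
Lemma loc_ring_pole a r : O (iota a / iota (f ^+ r)) -> exists p, a = p * f ^+ r.
Proof.
case=> c [e [fe /(eq_fraction iota_inj (expf_neq0 r f0) (ndvdp_neq0 fe)) E]].
apply/dvdpP; have : f ^+ r %| a * e by rewrite E dvdp_mull.
by rewrite Gauss_dvdpl // coprimep_expl // irreducible_poly_coprime.
Qed.

Lemma loc_ring_nonunit x : O x -> ~ O x^-1 -> exists2 y, O y & x = iota f * y.
Proof.
case=> a [b [fb ->]] nu; have [/dvdpP[c ->]|fa] := boolP (f %| a).
  exists (iota c / iota b); first by exists c, b.
  by rewrite rmorphM mulrA [iota f * _]mulrC.
by case: nu; exists b, a; rewrite invf_div.
Qed.

Lemma loc_ring_dvd p y : O y -> iota p = iota f * y -> f %| p.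
Proof.
case=> a [b [fb ->]] E; have B0 := iota_neq0 (ndvdp_neq0 fb).
have E2 : p * b = f * a.
  by apply: iota_inj; rewrite !rmorphM E -mulrA divfK.
have : f %| p * b by rewrite E2 dvdp_mulIl.
by rewrite irreducible_dvdpM // (negPf fb) orbF.
Qed.

Implicit Types (A B U : 'M[{poly k}]_2).

Local Notation iotamx A := (map_mx iota A).

Lemma mx_over_iota A : mx_over O (iotamx A).
Proof. by move=> i j; rewrite mxE; exact: loc_ring_poly. Qed.

Lemma iotamx_inj m n : injective (fun A : 'M[{poly k}]_(m, n) => iotamx A).
Proof.
move=> A B /matrixP E; apply/matrixP => i j.
by have := E i j; rewrite !mxE => /iota_inj.
Qed.

Lemma unit_iotamx A : (iotamx A \in unitmx) = (\det A != 0).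
Proof. by rewrite unitmxE det_map_mx unitfE iota_eq0. Qed.

Lemma invmx_iota A : \det A != 0 ->
  invmx (iotamx A) = (iota (\det A))^-1 *: iotamx (\adj A).
Proof. by move=> A0; rewrite /invmx unit_iotamx A0 det_map_mx map_mx_adj. Qed.

Lemma GL2_iota A : ~~ (f %| \det A) -> GL2 O (iotamx A).
Proof.
move=> fA; have A0 := ndvdp_neq0 fA.
have Au : iotamx A \in unitmx by rewrite unit_iotamx.
apply/(GL2P O Au); split; first exact: mx_over_iota.
move=> i j; rewrite invmx_iota // !mxE.
by apply: (subringM subring_loc); [exact: loc_ring_inv | exact: loc_ring_poly].
Qed.

Lemma ndvdp_const (c : k) : c != 0 -> ~~ (f %| c%:P).
Proof.
move=> c0; apply/negP => /dvdp_leq; rewrite polyC_eq0 c0 size_polyC c0 => /(_ isT).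
by rewrite leqNgt f_irr.1.
Qed.

Lemma Lat_scale_unit u (g : 'M[F]_2) : g \in unitmx -> u != 0 -> O u -> O u^-1 ->
  Lat O (u *: g) = Lat O g.
Proof.
move=> gu u0 Ou OVu; rewrite -mul_mx_scalar; apply: (Lat_mul_GL2 subring_loc) => //.
have sc v : O v -> mx_over O (v%:M : 'M_2).
  move=> Ov i j; rewrite mxE; case: eqP => _; first by rewrite mulr1n.
  by rewrite mulr0n; exact: (subring0 subring_loc).
split; first exact: sc.
by exists u^-1%:M; [exact: sc | rewrite -!scalar_mxM divff ?mulVf].
Qed.

Definition pole_ring (d : nat) : set F :=
  [set x | exists (a : {poly k}) r, (size a <= (r * d).+1)%N /\ x = iota a / iota (f ^+ r)].

Variable d : nat.
Hypotheses (f_monic : f \is monic) (hd : size f = d.+1).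

Local Notation R := (pole_ring d).

(** All large exponents are allowed so that several elements can be given a common denominator. *)
Lemma pole_ringP x : R x -> exists r0, forall r, (r0 <= r)%N ->
  exists2 a : {poly k}, (size a <= (r * d).+1)%N & x * iota (f ^+ r) = iota a.
Proof.
case=> a [r0 [sa ->]]; exists r0 => r le_r; exists (a * f ^+ (r - r0)).
  apply: leq_trans (size_polyMleq _ _) _.
  rewrite (size_irreducible_exp _ hd) addnS /=.
  by move: (size a) sa => s sa; rewrite -ltnS -addSn; nia.
by rewrite -{1}(subnK le_r) addnC exprD !rmorphM mulrA divfK // iota_neq0 ?expf_neq0.
Qed.

Lemma subring_pole : subring R.
Proof.
have X0 i := iota_neq0 (expf_neq0 i f0).
split.
- exists 1, 0%N; rewrite expr0 rmorph1 divr1; split=> //.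
  by rewrite size_poly1.
- move=> x y /pole_ringP[r1 H1] /pole_ringP[r2 H2].
  have [a sa xE] := H1 _ (leq_maxl r1 r2); have [b sb yE] := H2 _ (leq_maxr r1 r2).
  exists (a - b), (maxn r1 r2); split.
    by apply: leq_trans (size_polyD _ _) _; rewrite size_polyN geq_max sa.
  by apply: (mulIf (X0 (maxn r1 r2))); rewrite divfK // rmorphB -xE -yE mulrBl.
- move=> x y [a [r [sa ->]]] [b [s [sb ->]]]; exists (a * b), (r + s)%N; split.
    apply: leq_trans (size_polyMleq _ _) _; move: sa sb.
    by move: (size a) (size b) => i j; rewrite mulnDl; lia.
  by rewrite exprD !rmorphM mulf_div.
Qed.

Lemma d_gt0 : (0 < d)%N.
Proof. by have := f_irr.1; rewrite hd. Qed.

Lemma f_exp_size_inj (c c' : k) e e' : c != 0 -> c' != 0 ->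
  c *: f ^+ e = c' *: f ^+ e' -> e = e'.
Proof.
move=> c0 c'0 E; have : size (c *: f ^+ e) = size (c' *: f ^+ e') by rewrite E.
rewrite !size_scale // !(size_irreducible_exp _ hd) => -[]/eqP.
by rewrite eqn_pmul2r ?d_gt0 // => /eqP.
Qed.

Lemma dvdp_f_exp p r : p %| f ^+ r -> exists2 c : k, c != 0 & exists i, p = c *: f ^+ i.
Proof.
move=> pf; have p0 : p != 0.
  by apply: contraTneq pf => ->; rewrite dvd0p expf_neq0.
have [|c [i [c0 pE]]] := unique_prime_factor f_monic f_irr p0.
  move=> g gm gi gp; have /(irreducible_dvdpX gi) gdf := dvdp_trans gp pf.
  have : g %= f by apply: f_irr.2 => //; have := gi.1; case: (size g) => [|[]].
  by rewrite eqp_monic // => /eqP.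
by exists c => //; exists i.
Qed.

(** The numerators are constants times f^i and f^j with i + j = r + s. Regularity at infinity gives
    i <= r and j <= s, so both are equalities. *)
Lemma pole_ring_unit x y : R x -> R y -> x * y = 1 -> exists2 c : k, c != 0 & x = iota c%:P.
Proof.
have X0 i := iota_neq0 (expf_neq0 i f0).
case=> a [r [sa xE]] [b [s [sb yE]]] xy1.
have ab : a * b = f ^+ (r + s).
  apply: iota_inj; rewrite rmorphM exprD rmorphM.
  move: xy1; rewrite xE yE mulf_div => /divr1_eq; exact.
have [c c0 [i aE]] : exists2 c : k, c != 0 & exists i, a = c *: f ^+ i.
  by apply: (@dvdp_f_exp _ (r + s)); rewrite -ab dvdp_mulIl.
have [c' c'0 [j bE]] : exists2 c : k, c != 0 & exists i, b = c *: f ^+ i.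
  by apply: (@dvdp_f_exp _ (r + s)); rewrite -ab dvdp_mulIr.
have ij : (i + j = r + s)%N.
  apply: (@f_exp_size_inj (c * c') 1); rewrite ?mulf_neq0 ?oner_neq0 // scale1r -ab.
  by rewrite aE bE -scalerAl -scalerAr scalerA exprD.
have ir : (i <= r)%N.
  by move: sa; rewrite aE size_scale // (size_irreducible_exp _ hd) ltnS leq_pmul2r // d_gt0.
have js : (j <= s)%N.
  by move: sb; rewrite bE size_scale // (size_irreducible_exp _ hd) ltnS leq_pmul2r // d_gt0.
exists c => //.
have {}ij : i = r by lia.
by rewrite xE aE ij -mul_polyC rmorphM mulfK.
Qed.

Lemma pole_ring_det (g : 'M[F]_2) : GL2 R g -> exists2 c : k, c != 0 & \det g = iota c%:P.
Proof.
have Rdet h : mx_over R h -> R (\det h).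
  move=> Rh; rewrite [h]mx2E det_mx2.
  by apply: (subringB subring_pole); apply: (subringM subring_pole); apply: Rh.
case=> Rg [h Rh [gh _]]; apply: (@pole_ring_unit _ (\det h)); try exact: Rdet.
by rewrite -det_mulmx gh det1.
Qed.

(* The columns of [A] form a basis of a lattice which is also a reduced basis
   at infinity: the column degrees add up to the degree of the determinant. *)
Definition fdet A e := exists2 c : k, c != 0 & \det A = c *: f ^+ e.

Definition frame A m n e :=
  [/\ fdet A e, forall i, (size (A i 0%R) <= m.+1)%N,
      forall i, (size (A i 1%R) <= n.+1)%N & (m + n = e * d)%N].

Lemma fdet_neq0 A e : fdet A e -> \det A != 0.
Proof. by case=> c c0 ->; rewrite scaler_eq0 negb_or c0 expf_neq0. Qed.

Lemma unit_fdet A e : fdet A e -> iotamx A \in unitmx.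
Proof. by move/fdet_neq0; rewrite unit_iotamx. Qed.

Lemma fdetM A B e e' : fdet A e -> fdet B e' -> fdet (A *m B) (e + e').
Proof.
case=> a a0 aE [b b0 bE]; exists (a * b); first by rewrite mulf_neq0.
by rewrite det_mulmx aE bE -scalerAl -scalerAr scalerA exprD.
Qed.

Lemma fdetZ A e i : fdet A e -> fdet (f ^+ i *: A) (e + 2 * i).
Proof.
case=> c c0 cE; exists c => //.
by rewrite detZ cE -scalerAr -exprM -exprD addnC mulnC.
Qed.

Lemma fdet_unimodular U : fdet U 0 -> ~~ (f %| \det U).
Proof. by case=> c c0 ->; rewrite expr0 alg_polyC; exact: ndvdp_const. Qed.

Lemma GL2_unimodular U : fdet U 0 -> GL2 O (iotamx U).
Proof. by move/fdet_unimodular; exact: GL2_iota. Qed.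

Lemma invmx_fdet A e (c : k) : c != 0 -> \det A = c *: f ^+ e ->
  invmx (iotamx A) = (iota (f ^+ e))^-1 *: iotamx ((c^-1)%:P *: \adj A).
Proof.
move=> c0 cE; have A0 : \det A != 0 by apply: (@fdet_neq0 _ e); exists c.
have C0 : iota c%:P != 0 by rewrite iota_neq0 ?polyC_eq0.
have CV : iota (c^-1)%:P = (iota c%:P)^-1.
  by apply: (mulfI C0); rewrite -rmorphM -polyCM !divff // rmorph1.
rewrite invmx_iota // map_mxZ scalerA; congr (_ *: _).
by rewrite cE -mul_polyC rmorphM invfM CV mulrC.
Qed.

(** The entries of A^(-1) B lie in [O] and have only powers of [f] as denominators, so they are
    polynomials; the same holds for B^(-1) A. *)
Lemma Lat_eq_unimodular A B e e' : fdet A e -> fdet B e' ->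
  Lat O (iotamx A) = Lat O (iotamx B) -> e = e' /\ exists2 U, fdet U 0 & B = A *m U.
Proof.
have polyq C D i : fdet C i -> \det D != 0 ->
    Lat O (iotamx C) = Lat O (iotamx D) -> exists U, D = C *m U.
  move=> hC D0 E; have Cu := unit_fdet hC; case: hC => c c0 cE.
  have Du : iotamx D \in unitmx by rewrite unit_iotamx.
  have [H _] : GL2 O (invmx (iotamx C) *m iotamx D).
    by apply/(Lat_eqP subring_loc).
  have /boolp.choice[U0 HU0] : forall ij : 'I_2 * 'I_2, exists p,
      (invmx (iotamx C) *m iotamx D) ij.1 ij.2 = iota p.
    case=> i0 j0 /=; have := H i0 j0.
    rewrite (invmx_fdet c0 cE) -scalemxAl -map_mxM mxE mxE mulrC.
    move=> Hij; have [p pE] := loc_ring_pole Hij; exists p.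
    by rewrite pE rmorphM mulfK // iota_neq0 // expf_neq0.
  exists (\matrix_(i0, j0) U0 (i0, j0)); apply: iotamx_inj.
  rewrite map_mxM -[LHS](mulKVmx Cu); congr (_ *m _).
  by apply/matrixP => i0 j0; rewrite (HU0 (i0, j0)) !mxE.
move=> hA hB E.
have [U BE] := polyq _ _ _ hA (fdet_neq0 hB) E.
have [V AE] := polyq _ _ _ hB (fdet_neq0 hA) (esym E).
have UV : \det U * \det V = 1.
  apply: (mulfI (fdet_neq0 hA)); rewrite mulr1 mulrA.
  by rewrite -!det_mulmx -BE -AE.
have [c c0 cU] : exists2 c : k, c != 0 & \det U = c%:P.
  have : \det U %| 1 by rewrite -UV dvdp_mulIl.
  rewrite dvdp1 => /size_poly1P[c c0 ->]; by exists c.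
have hU : fdet U 0 by exists c; rewrite // expr0 alg_polyC.
split; last by exists U.
have := fdetM hA hU; rewrite -BE addn0 => -[c1 c10 E1]; case: hB => c2 c20 E2.
by apply: (f_exp_size_inj c10 c20); rewrite -E1 -E2.
Qed.

End LocalRing.

Section PolySize.

Variable k : idomainType.
Implicit Types a b p x y : {poly k}.

Lemma size_mulS a b s t : (size a <= s.+1)%N -> (size b <= t.+1)%N ->
  (size (a * b)%R <= (s + t).+1)%N.
Proof.
move=> sa sb; apply: leq_trans (size_polyMleq _ _) _; move: sa sb.
by move: (size a) (size b) => i j; lia.
Qed.

Lemma size_subS a b s : (size a <= s)%N -> (size b <= s)%N -> (size (a - b)%R <= s)%N.
Proof.
by move=> sa sb; apply: leq_trans (size_polyD _ _) _; rewrite size_polyN geq_max sa.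
Qed.

Lemma size_addS a b s : (size a <= s)%N -> (size b <= s)%N -> (size (a + b)%R <= s)%N.
Proof.
by move=> sa sb; apply: leq_trans (size_polyD _ _) _; rewrite geq_max sa.
Qed.

Lemma adj_mx2 (a b c e : {poly k}) : \adj (mx2 a b c e) = mx2 e (- b) (- c) a.
Proof.
apply/matrixP; apply: ord2P; apply: ord2P;
  by rewrite !mxE /cofactor det_mx11 !mxE /= ?expr0 ?expr1 ?mul1r ?mulN1r //
     /GRing.exp /= ?mulN1r ?mulrN1 ?opprK ?mul1r.
Qed.

(* Cramer's rule: the coordinates of a short vector in a reduced basis are small. *)
Lemma cramer_size (A : 'M[{poly k}]_2) m n p q x y s :
  (forall i, (size (A i 0%R) <= m.+1)%N) -> (forall i, (size (A i 1%R) <= n.+1)%N) ->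
  size (\det A) = (m + n).+1 ->
  A 0 0 * p + A 0 1 * q = x -> A 1 0 * p + A 1 1 * q = y ->
  (size x <= s.+1)%N -> (size y <= s.+1)%N ->
  (p != 0 -> (size p + m <= s.+1)%N) /\ (q != 0 -> (size q + n <= s.+1)%N).
Proof.
move=> c0 c1 sD xE yE sx sy.
have D0 : \det A != 0 by rewrite -size_poly_gt0 sD.
have pE : \det A * p = A 1 1 * x - A 0 1 * y.
  by rewrite {1}[A]mx2E det_mx2 -xE -yE; ring.
have qE : \det A * q = A 0 0 * y - A 1 0 * x.
  by rewrite {1}[A]mx2E det_mx2 -xE -yE; ring.
split=> [p0|q0].
  have : (size (\det A * p)%R <= (n + s).+1)%N.
    by rewrite pE; apply: size_subS; exact: size_mulS.
  by rewrite size_mul // sD; move: (size p) => z; lia.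
have : (size (\det A * q)%R <= (m + s).+1)%N.
  by rewrite qE; apply: size_subS; exact: size_mulS.
by rewrite size_mul // sD; move: (size q) => z; lia.
Qed.

End PolySize.

Section Frames.

Variables (k : fieldType) (F : fieldType) (iota : {rmorphism {poly k} -> F}).
Hypothesis iota_inj : injective iota.
Hypothesis iota_frac : forall x, exists a b, b != 0 /\ x = iota a / iota b.
Variables (f : {poly k}) (d : nat).
Hypotheses (f_monic : f \is monic) (f_irr : irreducible_poly f).
Hypothesis hd : size f = d.+1.

Implicit Types (a : {poly k}) (x u : F) (A B C U : 'M[{poly k}]_2).
Implicit Types (g h : 'M[F]_2) (v w : set (set 'cV[F]_2)).

Local Notation O := (loc_ring iota f).
Local Notation R := (pole_ring iota f d).
Local Notation iotamx A := (map_mx iota A).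
Local Notation frame := (frame f d).
Local Notation fdet := (fdet f).

Let f0 : f != 0 := irredp_neq0 f_irr.
Let OO : subring O := subring_loc iota_inj f_irr.
Let RR : subring R := subring_pole iota_inj f_irr f_monic hd.
Let X0 i : iota (f ^+ i) != 0.
Proof. by rewrite iota_neq0 // expf_neq0. Qed.

Lemma frame_fdet A m n e : frame A m n e -> fdet A e.
Proof. by case. Qed.

Lemma frame_unit A m n e : frame A m n e -> iotamx A \in unitmx.
Proof. by move/frame_fdet; exact: unit_fdet. Qed.

Lemma frame_size_det A m n e : frame A m n e -> size (\det A) = (m + n).+1.
Proof.
by case=> [[c c0 ->] _ _ ->]; rewrite size_scale // (size_irreducible_exp _ hd).
Qed.

(** The entries of B adj(A) have degree at most m + n = e d, the degree of [f ^+ e], so dividing by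
    det A creates no pole at infinity. *)
Lemma frame_transfer A B m n e : frame A m n e -> frame B m n e ->
  GL2 R (iotamx B *m invmx (iotamx A)).
Proof.
have H C D : frame C m n e -> frame D m n e -> mx_over R (iotamx D *m invmx (iotamx C)).
  case=> [[c c0 cE] C0 C1 mn] [_ D0 D1 _] i j.
  rewrite (invmx_fdet iota_inj f_irr c0 cE) -scalemxAr -map_mxM mxE mxE mulrC.
  exists ((D *m ((c^-1)%:P *: \adj C)) i j), e; split=> //.
  rewrite -scalemxAr mxE mul_polyC; apply: leq_trans (size_scale_leq _ _) _.
  rewrite -mn [C]mx2E adj_mx2 [D]mx2E mulmx2.
  move: i j; apply: ord2P; apply: ord2P; rewrite !mxE /= ?mulrN ?[- _ + _]addrC.
  - by apply: size_subS; [|rewrite addnC]; exact: size_mulS.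
  - by apply: size_subS; [rewrite addnC|]; exact: size_mulS.
  - by apply: size_subS; [|rewrite addnC]; exact: size_mulS.
  - by apply: size_subS; [rewrite addnC|]; exact: size_mulS.
move=> hA hB; have Au := frame_unit hA; have Bu := frame_unit hB.
split; first exact: H.
exists (iotamx A *m invmx (iotamx B)); first exact: H.
by rewrite !mulmxA !mulmxKV // !mulmxV.
Qed.

Lemma frame_unimodular_size A m n e B m' n' e' U :
  frame A m n e -> frame B m' n' e' -> B = A *m U ->
  [/\ U 0 0 != 0 -> (size (U 0%R 0%R) + m <= m'.+1)%N,
      U 1 0 != 0 -> (size (U 1%R 0%R) + n <= m'.+1)%N,
      U 0 1 != 0 -> (size (U 0%R 1%R) + m <= n'.+1)%N &
      U 1 1 != 0 -> (size (U 1%R 1%R) + n <= n'.+1)%N].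
Proof.
move=> hA hB BE; have sA := frame_size_det hA; case: hA => _ A0 A1 _.
have Bij i j : A i 0 * U 0 j + A i 1 * U 1 j = B i j by rewrite BE mxE sum_ord2.
case: hB => _ B0 B1 _.
have [? ?] := cramer_size A0 A1 sA (Bij 0 0) (Bij 1 0) (B0 0) (B0 1).
by have [? ?] := cramer_size A0 A1 sA (Bij 0 1) (Bij 1 1) (B1 0) (B1 1).
Qed.

(** Uniqueness of the splitting type of a vector bundle: if m' < m <= n, Cramer's bounds force the
    first column of the unimodular change of basis to vanish. *)
Lemma frame_unique A m n e B m' n' e' : (m <= n)%N -> (m' <= n')%N ->
  frame A m n e -> frame B m' n' e' -> Lat O (iotamx A) = Lat O (iotamx B) ->
  [/\ e = e', m = m' & n = n'].
Proof.
have H C D i j l i' j' l' : (i <= j)%N -> frame C i j l -> frame D i' j' l' ->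
    Lat O (iotamx C) = Lat O (iotamx D) -> l = l' /\ (i <= i')%N.
  move=> ij hC hD E.
  have [ll [U hU DE]] := Lat_eq_unimodular iota_inj f_irr hd
    (frame_fdet hC) (frame_fdet hD) E.
  split=> //; rewrite leqNgt; apply/negP => lt_i.
  have [U00 U10 _ _] := frame_unimodular_size hC hD DE.
  have U00z : U 0 0 = 0.
    apply: contrapT => /eqP nz; have := U00 nz; move: nz.
    by rewrite -size_poly_gt0; move: (size _) => s; lia.
  have U10z : U 1 0 = 0.
    apply: contrapT => /eqP nz; have := U10 nz; move: nz.
    by rewrite -size_poly_gt0; move: (size _) => s; lia.
  have := fdet_neq0 f_irr hU.
  by rewrite [U]mx2E det_mx2 U00z U10z mul0r mulr0 subrr eqxx.
move=> mn mn' hA hB E; have [ee le1] := H _ _ _ _ _ _ _ _ mn hA hB E.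
have [_ le2] := H _ _ _ _ _ _ _ _ mn' hB hA (esym E).
case: hA => _ _ _ s1; case: hB => _ _ _ s2; rewrite -ee -s1 in s2; split=> //; lia.
Qed.

Lemma frameZ A m n e i : frame A m n e ->
  frame (f ^+ i *: A) (m + i * d) (n + i * d) (e + 2 * i).
Proof.
case=> hA A0 A1 mn; split.
- exact: fdetZ.
- move=> j; rewrite mxE mulrC; apply: size_mulS => //.
  by rewrite (size_irreducible_exp _ hd).
- move=> j; rewrite mxE mulrC; apply: size_mulS => //.
  by rewrite (size_irreducible_exp _ hd).
- rewrite mulnDl -mn; lia.
Qed.

Lemma iotamxZ A i : iotamx (f ^+ i *: A) = iota (f ^+ i) *: iotamx A.
Proof. by rewrite map_mxZ. Qed.

Lemma vtxZ A i : vtx O (iotamx (f ^+ i *: A)) = vtx O (iotamx A).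
Proof. by rewrite iotamxZ vtx_scale. Qed.

Lemma vtx_eq_Lat A B e e' : fdet A e -> fdet B e' ->
  vtx O (iotamx A) = vtx O (iotamx B) ->
  exists i j, Lat O (iotamx (f ^+ i *: A)) = Lat O (iotamx (f ^+ j *: B)).
Proof.
move=> hA hB /vtx_eqP[c c0 E].
have [i [j [u [u0 Ou OVu cE]]]] := loc_ring_decomp iota_inj iota_frac f_irr c0.
exists j, i; rewrite !iotamxZ -[RHS]scale_Lat E scale_Lat scalerA.
rewrite [iota _ * c]mulrC cE -scalerA -iotamxZ Lat_scale_unit //.
exact: (unit_fdet iota_inj f_irr (fdetZ j hA)).
Qed.

(** Clearing denominators by [f ^+ r] makes the entries of h polynomials of degree at most r d,
    which raises both column bounds by r d. As det h is constant, the determinant grows by exactly 2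
    r d, so the degrees still add up. *)
Lemma pole_frame h A m n e : GL2 R h -> frame A m n e ->
  exists r C, frame C (m + r * d) (n + r * d) (e + 2 * r) /\
    iotamx C = iota (f ^+ r) *: (h *m iotamx A).
Proof.
move=> hR hA; have [c c0 cE] := pole_ring_det iota_inj f_irr f_monic hd hR.
have [Rh _] := hR.
have [r [Q [sQ QE]]] : exists r (Q : 'M[{poly k}]_2),
    (forall i j, (size (Q i j) <= (r * d).+1)%N) /\ iotamx Q = iota (f ^+ r) *: h.
  have P i j := pole_ringP iota_inj f_irr f_monic hd (Rh i j).
  have [r00 H00] := P 0 0; have [r01 H01] := P 0 1.
  have [r10 H10] := P 1 0; have [r11 H11] := P 1 1.
  pose r := (r00 + r01 + r10 + r11)%N.
  have [a sa aE] : exists2 a : {poly k}, (size a <= (r * d).+1)%N & h 0 0 * iota (f ^+ r) = iota a.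
    by apply: H00; rewrite /r; lia.
  have [b sb bE] : exists2 a : {poly k}, (size a <= (r * d).+1)%N & h 0 1 * iota (f ^+ r) = iota a.
    by apply: H01; rewrite /r; lia.
  have [a' sa' aE'] : exists2 a : {poly k}, (size a <= (r * d).+1)%N & h 1 0 * iota (f ^+ r) = iota a.
    by apply: H10; rewrite /r; lia.
  have [b' sb' bE'] : exists2 a : {poly k}, (size a <= (r * d).+1)%N & h 1 1 * iota (f ^+ r) = iota a.
    by apply: H11; rewrite /r; lia.
  exists r, (mx2 a b a' b'); split; last first.
    by rewrite map_mx2 [h]mx2E scale_mx2 -aE -bE -aE' -bE' !(mulrC (iota (f ^+ r))).
  by apply: ord2P; apply: ord2P; rewrite !mxE.
exists r, (Q *m A); rewrite map_mxM QE scalemxAl; split=> //.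
case: hA => [[c' c'0 AE] A0 A1 mn]; split.
- exists (c * c'); first exact: mulf_neq0.
  rewrite det_mulmx AE.
  have -> : \det Q = c *: f ^+ (2 * r).
    apply: iota_inj; rewrite -det_map_mx QE detZ cE -mul_polyC rmorphM mulrC.
    by rewrite mulnC exprM -rmorphXn.
  by rewrite -scalerAl -scalerAr scalerA -exprD addnC.
- move=> i; rewrite mxE sum_ord2 addnC.
  by apply: size_addS; apply: size_mulS.
- move=> i; rewrite mxE sum_ord2 addnC.
  by apply: size_addS; apply: size_mulS.
- rewrite mulnDl -mn; lia.
Qed.

(* [n] is the index of the vertex X_n of the quotient; for even [d], [b] tells
   X_n and X_n' apart. *)
Definition vtype v n (b : bool) := exists A m m' e,
  [/\ frame A m m' e, (m + n = m')%N, odd e = b & v = vtx O (iotamx A)].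

Lemma vtype_frame_eq v n b A m m' e : vtype v n b -> (m <= m')%N ->
  frame A m m' e -> v = vtx O (iotamx A) -> (m + n = m')%N /\ odd e = b.
Proof.
case=> C [i [j [l [hC ij lb ->]]]] mm hA E.
have [s [t E2]] := vtx_eq_Lat (frame_fdet hC) (frame_fdet hA) E.
have le1 : (i + s * d <= j + s * d)%N by lia.
have le2 : (m + t * d <= m' + t * d)%N by lia.
have [E3 E4 E5] := frame_unique le1 le2 (frameZ s hC) (frameZ t hA) E2.
split; first lia.
by rewrite -lb; move: E3; clear; lia.
Qed.

Lemma vtype_fun v n b n' b' : vtype v n b -> vtype v n' b' -> n = n' /\ b = b'.
Proof.
move=> h1 [A [m [m' [e [hA mE eb vE]]]]].
have mm : (m <= m')%N by lia.
by have [? ?] := vtype_frame_eq h1 mm hA vE; split; [lia | rewrite -eb].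
Qed.

Lemma vtype_act h g n b : GL2 R h -> vtype (vtx O g) n b -> vtype (vtx O (h *m g)) n b.
Proof.
move=> hR [A [m [m' [e [hA mE eb gE]]]]].
have [r [C [hC CE]]] := pole_frame hR hA.
exists C, (m + r * d)%N, (m' + r * d)%N, (e + 2 * r)%N; split=> //; first lia.
  by rewrite oddD oddM /= addbF.
by rewrite CE vtx_scale // (vtx_mulr _ gE).
Qed.

Lemma vtype_orbit v w n b : vtype v n b -> vtype w n b ->
  exists A m m' e h, [/\ frame A m m' e, (m + n = m')%N, odd e = b, v = vtx O (iotamx A) &
    GL2 R h /\ w = vtx O (h *m iotamx A)].
Proof.
case=> A [m [m' [e [hA mE eb vE]]]] [B [i [i' [l [hB iE lb wE]]]]].
(* Scaling by powers of [f] changes the exponent by even amounts, so equal parity permits a common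
   exponent; 2 m + n = e d then fixes both column degrees. *)
have [s [t E]] : exists s t, (e + 2 * s = l + 2 * t)%N.
  have : odd e = odd l by rewrite eb.
  by exists (l./2), (e./2); lia.

have hA' := frameZ s hA; have hB' := frameZ t hB.
exists (f ^+ s *: A), (m + s * d)%N, (m' + s * d)%N, (e + 2 * s)%N,
  (iotamx (f ^+ t *: B) *m invmx (iotamx (f ^+ s *: A))); split=> //.
- lia.
- by rewrite oddD oddM /= addbF.
- by rewrite vtxZ.
split; last by rewrite mulmxKV ?vtxZ // (frame_unit hA').
apply: (@frame_transfer _ _ (m + s * d) (m' + s * d) (e + 2 * s)) => //.
case: (hA') (hB') => _ _ _ s1 [_ _ _ s2].
have [E1 E2] : (m + s * d = i + t * d /\ m' + s * d = i' + t * d)%N.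
  by rewrite -E -s1 in s2; lia.
by rewrite E1 E2 E.
Qed.

(** The relation 2 m + n = e d modulo 2. *)
Lemma vtype_parity v n b : vtype v n b -> odd n = odd d && b.
Proof.
case=> A [m [m' [e [[_ _ _ E] mE <- _]]]].
have := congr1 odd E; rewrite -mE oddM addnA addnn oddD odd_double /= => ->.
by rewrite andbC.
Qed.

End Frames.

(** * Column reduction over k[t] *)

Section Reduction.

Variable k : fieldType.
Implicit Types (a b : {poly k}) (A U V : 'M[{poly k}]_2).

Lemma coefM_top a b m n : (size a <= m.+1)%N -> (size b <= n.+1)%N ->
  (a * b)`_(m + n) = a`_m * b`_n.
Proof.
move=> sa sb; rewrite coefM (bigD1 (inord m)) //= big1 ?addr0.
  by rewrite inordK ?addKn // ltnS leq_addr.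
move=> i; have i_lt := ltn_ord i; rewrite -val_eqE /= inordK ?ltnS ?leq_addr // => ni.
have [im|mi] := ltnP i m.
  by rewrite (nth_default _ (s := b)) ?mulr0 //; apply: leq_trans sb _; lia.
by rewrite (nth_default _ (s := a)) ?mul0r //; apply: leq_trans sa _; lia.
Qed.

Lemma size_topless a m : (size a <= m.+1)%N -> a`_m = 0 -> (size a <= m)%N.
Proof.
move=> sa am; apply/leq_sizeP => j; rewrite leq_eqVlt => /orP[/eqP <-//|lt_mj].
by rewrite nth_default // (leq_trans sa).
Qed.

Definition reducible_basis A := exists U m n,
  [/\ exists2 c, c != 0 & \det U = c%:P,
      forall i, (size ((A *m U) i 0%R) <= m.+1)%N,
      forall i, (size ((A *m U) i 1%R) <= n.+1)%N &
      size (\det A) = (m + n).+1].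

Lemma reducible_basis_mul A V : (exists2 c, c != 0 & \det V = c%:P) ->
  reducible_basis (A *m V) -> reducible_basis A.
Proof.
case=> c c0 cV [U [m [n [[b b0 bU] h0 h1 sD]]]]; exists (V *m U), m, n.
rewrite mulmxA; split=> //.
  by exists (c * b); rewrite ?mulf_neq0 // det_mulmx cV bU polyCM.
by rewrite -sD det_mulmx cV mulrC mul_polyC size_scale.
Qed.

(* Cancel leading terms between the two columns until the degree bounds of the
   columns add up to the degree of the determinant. *)
Lemma reduce_basis A : \det A != 0 -> reducible_basis A.
Proof.
pose m := \max_i size (A i 0%R); pose n := \max_i size (A i 1%R).
have Am i : (size (A i 0%R) <= m.+1)%N by rewrite leqW // (leq_bigmax (F := fun i => size (A i _)) i).
have An i : (size (A i 1%R) <= n.+1)%N by rewrite leqW // (leq_bigmax (F := fun i => size (A i _)) i).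
move: m n Am An => m n.
have [N] := ubnP (m + n); elim: N A m n => // N IH A m n.
wlog le_mn : A m n / (m <= n)%N => [H|] lt_N Am An A0.
  have [le_mn|/ltnW le_nm] := leqP m n; first exact: (H A m n).
  pose S : 'M[{poly k}]_2 := mx2 0 1 1 0.
  have dS : exists2 c : k, c != 0 & \det S = c%:P.
    exists (-1); first by rewrite oppr_eq0 oner_eq0.
    by rewrite det_mx2 mulr0 mulr1 sub0r polyCN.
  have AS : A *m S = mx2 (A 0 1) (A 0 0) (A 1 1) (A 1 0).
    by rewrite {1}[A]mx2E mulmx2 !(mulr0, mulr1, add0r, addr0).
  apply: (reducible_basis_mul dS); apply: (H _ n m) => //; first by rewrite [(n + m)%N]addnC.
  - by rewrite AS; apply: ord2P; rewrite mxE /=.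
  - by rewrite AS; apply: ord2P; rewrite mxE /=.
  - case: dS => c c0 cS; by rewrite det_mulmx cS mulf_neq0 ?polyC_eq0.
have detE : \det A = A 0 0 * A 1 1 - A 0 1 * A 1 0 by rewrite {1}[A]mx2E det_mx2.
have sD : (size (\det A) <= (m + n).+1)%N.
  by rewrite detE; apply: size_subS; [|rewrite addnC]; apply: size_mulS.
have [sE|nsE] := eqVneq (size (\det A)) (m + n).+1.
  exists 1%:M, m, n; rewrite mulmx1; split=> //.
  by exists 1; rewrite ?oner_eq0 ?det1.
(* The coefficient of det A in degree m + n is the determinant of the leading coefficients. It
   vanishes because the degree is too small, so the leading columns are proportional. *)
have coef0 : (A 0 0)`_m * (A 1 1)`_n = (A 0 1)`_n * (A 1 0)`_m.
  apply/eqP; rewrite -subr_eq0 -!coefM_top // [(n + m)%N]addnC -coefB -detE.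
  by rewrite nth_default // -ltnS ltn_neqAle nsE.
have [/andP[/eqP a0 /eqP c0]|nz] := boolP (((A 0 0)`_m == 0) && ((A 1 0)`_m == 0)).
  have Am' : forall i, (size (A i 0%R) <= m)%N.
    by apply: ord2P; apply: size_topless.
  case: m Am' {Am nsE sD coef0 a0 c0} le_mn lt_N => [|m] Am le_mn lt_N.
    have z i : A i 0 = 0 by apply/eqP; rewrite -size_poly_eq0 -leqn0.
    by move: A0; rewrite detE !z mul0r mulr0 subrr eqxx.
  by apply: (IH _ m n).
have [l lE0 lE1] : exists2 l : k, (A 0 1)`_n = l * (A 0 0)`_m & (A 1 1)`_n = l * (A 1 0)`_m.
  have [a0|a0] := eqVneq (A 0 0)`_m 0.
    have c0 : (A 1 0)`_m != 0 by move: nz; rewrite a0 eqxx.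
    exists ((A 1 1)`_n / (A 1 0)`_m); rewrite ?divfK // a0 mulr0.
    by move/eqP: coef0; rewrite a0 mul0r eq_sym mulf_eq0 (negPf c0) orbF => /eqP.
  exists ((A 0 1)`_n / (A 0 0)`_m); rewrite ?divfK //.
  by apply: (mulfI a0); rewrite coef0 mulrA mulrCA divff // mulr1.
pose V : 'M[{poly k}]_2 := mx2 1 (- (l *: 'X^(n - m))) 0 1.
have dV : \det V = 1 by rewrite det_mx2 mulr1 mulr0 subr0.
have AV : A *m V = mx2 (A 0 0) (A 0 1 - l *: 'X^(n - m) * A 0 0)
                       (A 1 0) (A 1 1 - l *: 'X^(n - m) * A 1 0).
  rewrite {1}[A]mx2E mulmx2 !(mulr0, mulr1, add0r, addr0).
  by congr mx2; rewrite mulrN addrC mulrC.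
have cV : exists2 c : k, c != 0 & \det V = c%:P by exists 1; rewrite ?oner_eq0.
have step a b : (size a <= m.+1)%N -> (size b <= n.+1)%N -> b`_n = l * a`_m ->
    (size (b - l *: 'X^(n - m) * a)%R <= n)%N.
  move=> sa sb E; apply: size_topless.
    apply: size_subS => //; rewrite -{2}(subnK le_mn); apply: size_mulS => //.
    by apply: leq_trans (size_scale_leq _ _) _; rewrite size_polyXn.
  by rewrite coefB E -scalerAl coefZ coefXnM ltnNge leq_subr /= subKn // subrr.
have An' : forall i, (size ((A *m V) i 1%R) <= n)%N.
  by rewrite AV; apply: ord2P; rewrite mxE /=; apply: step.
apply: (reducible_basis_mul cV).
have A'0 : \det (A *m V) != 0 by rewrite det_mulmx dV mulr1.
have Bm : forall i, (size ((A *m V) i 0%R) <= m.+1)%N.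
  by rewrite AV; apply: ord2P; rewrite mxE /=.
move: (A *m V) An' Bm A'0 => B Bn Bm B0.
case: n Bn lt_N {An nsE sD coef0 lE0 lE1 step V dV AV cV le_mn} => [|n] Bn lt_N.
  have z i : B i 1 = 0 by apply/eqP; rewrite -size_poly_eq0 -leqn0.
  by move: B0; rewrite {1}[B]mx2E det_mx2 !z mul0r mulr0 subrr eqxx.
by apply: (IH _ m n) => //; rewrite addnS in lt_N.
Qed.

End Reduction.

(** * Every vertex has a reduced polynomial basis, and every type occurs *)

Section Tree.

Variables (k : fieldType) (F : fieldType) (iota : {rmorphism {poly k} -> F}).
Hypothesis iota_inj : injective iota.
Hypothesis iota_frac : forall x, exists a b, b != 0 /\ x = iota a / iota b.
Variables (f : {poly k}) (d : nat).
Hypotheses (f_monic : f \is monic) (f_irr : irreducible_poly f).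
Hypothesis hd : size f = d.+1.

Implicit Types (a p : {poly k}) (x y u : F) (A U : 'M[{poly k}]_2).
Implicit Types (g : 'M[F]_2).

Local Notation O := (loc_ring iota f).
Local Notation iotamx A := (map_mx iota A).
Local Notation frame := (frame f d).
Local Notation fdet := (fdet f).
Local Notation vtx := (vtx O).
Local Notation vtype := (vtype iota f d).

Let f0 : f != 0 := irredp_neq0 f_irr.
Let OO : subring O := subring_loc iota_inj f_irr.
Let X0 i : iota (f ^+ i) != 0.
Proof. by rewrite iota_neq0 // expf_neq0. Qed.

Lemma GL2_upper x : O x -> GL2 O (mx2 1 x 0 1).
Proof.
have o y : O y -> mx_over O (mx2 1 y 0 1).
  by move=> Oy; apply: ord2P; apply: ord2P; rewrite mxE /=;
     first [exact: Oy | exact: subring1 OO | exact: subring0 OO].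
move=> Ox; split; first exact: o.
exists (mx2 1 (- x) 0 1); first exact: o (subringN OO Ox).
by rewrite !mulmx2 mx2_1; split; congr mx2; ring.
Qed.

Lemma GL2_lower x : O x -> GL2 O (mx2 1 0 x 1).
Proof.
have o y : O y -> mx_over O (mx2 1 0 y 1).
  by move=> Oy; apply: ord2P; apply: ord2P; rewrite mxE /=;
     first [exact: Oy | exact: subring1 OO | exact: subring0 OO].
move=> Ox; split; first exact: o.
exists (mx2 1 0 (- x) 1); first exact: o (subringN OO Ox).
by rewrite !mulmx2 mx2_1; split; congr mx2; ring.
Qed.

Lemma GL2_diag x y : x != 0 -> y != 0 -> O x -> O x^-1 -> O y -> O y^-1 ->
  GL2 O (mx2 x 0 0 y).
Proof.
have o z t : O z -> O t -> mx_over O (mx2 z 0 0 t).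
  by move=> Oz Ot; apply: ord2P; apply: ord2P; rewrite mxE /=;
     first [exact: Oz | exact: Ot | exact: subring0 OO].
move=> x0 y0 Ox Oix Oy Oiy; split; first exact: o.
exists (mx2 x^-1 0 0 y^-1); first exact: o.
by rewrite !mulmx2 mx2_1 !(mulr0, mul0r, addr0, add0r) !divff ?mulVf.
Qed.

Lemma GL2_swap : GL2 O (mx2 0 1 1 0).
Proof.
have o : mx_over O (mx2 0 1 1 0).
  by apply: ord2P; apply: ord2P; rewrite mxE /=;
     first [exact: subring1 OO | exact: subring0 OO].
split=> //; exists (mx2 0 1 1 0) => //.
by rewrite !mulmx2 mx2_1; split; congr mx2; ring.
Qed.

(** [O] is a valuation ring, so one entry of the bottom row divides the other; after a possible swap
    of columns it clears the lower left entry. *)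
Lemma vtx_upper g : g \in unitmx -> exists x y z,
  [/\ x != 0, z != 0 & vtx g = vtx (mx2 x y 0 z)].
Proof.
suff H (a b c e : F) : mx2 a b c e \in unitmx -> e != 0 -> O (c / e) -> exists x y z,
  [/\ x != 0, z != 0 & vtx (mx2 a b c e) = vtx (mx2 x y 0 z)].
  rewrite [g]mx2E; move: (g 0 0) (g 0 1) (g 1 0) (g 1 1) => a b c e gu.
  have [e0|e0] := eqVneq e 0; last first.
    have [|Oc] := loc_ring_total iota_inj iota_frac f_irr (c / e); first exact: H.
    have [c0|c0] := eqVneq c 0.
      by apply: H => //; rewrite c0 mul0r; exact: subring0 OO.
    rewrite invf_div in Oc; rewrite -(vtx_mul_GL2 OO gu GL2_swap).
    rewrite mulmx2 !(mulr0, mulr1, add0r, addr0); apply: H => //.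
    move: gu; rewrite !unitmx2; apply: contraNneq => E.
    by rewrite -oppr_eq0 opprB E.
  rewrite -(vtx_mul_GL2 OO gu GL2_swap) mulmx2 !(mulr0, mulr1, add0r, addr0).
  have c0 : c != 0.
    by apply: contraTneq gu => c0; rewrite unitmx2 c0 e0 !mulr0 subrr eqxx.
  apply: H => //; last by rewrite e0 mul0r; exact: subring0 OO.
  rewrite unitmx2 in gu; rewrite unitmx2; apply: contraNneq gu => E.
  by rewrite -oppr_eq0 opprB E.
move=> gu e0 Oce; have Ou : O (- (c / e)) := subringN OO Oce.
rewrite -(vtx_mul_GL2 OO gu (GL2_lower Ou)) mulmx2 !(mulr0, mulr1, add0r, addr0).
have -> : c + e * - (c / e) = 0 by rewrite mulrN mulrC divfK // subrr.
exists (a + b * - (c / e)), b, e; split=> //.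
move: gu; rewrite unitmx2; apply: contraNneq => E.
have -> : a = b * c / e by apply/eqP; rewrite -subr_eq0 -E; apply/eqP; ring.
by rewrite divfK // subrr.
Qed.

Lemma loc_ring_clear x : exists i, O (iota (f ^+ i) * x).
Proof.
have [->|x0] := eqVneq x 0; first by exists 0%N; rewrite mulr0; exact: subring0 OO.
have [i [j [u [_ Ou _ E]]]] := loc_ring_decomp iota_inj iota_frac f_irr x0.
by exists i; rewrite mulrC E; apply: (subringM OO) => //; exact: loc_ring_poly.
Qed.

(** Units are stripped from the diagonal of a triangular matrix and a power of [f] clears
    denominators. Column operations change the corner only modulo the top left power of [f], so a
    polynomial can be put there. *)
Lemma vtx_fdet g : g \in unitmx -> exists A e, fdet A e /\ vtx g = vtx (iotamx A).
Proof.
move=> /vtx_upper[x [y [z [x0 z0 ->]]]].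
have [i [j [u [u0 Ou OVu xE]]]] := loc_ring_decomp iota_inj iota_frac f_irr x0.
have [i' [j' [u' [u'0 Ou' OVu' zE]]]] := loc_ring_decomp iota_inj iota_frac f_irr z0.
have [s Os] := loc_ring_clear (y / u').
have gu : mx2 x y 0 z \in unitmx by rewrite unitmx2 mulr0 subr0 mulf_neq0.
have Du : GL2 O (mx2 u^-1 0 0 u'^-1).
  by apply: GL2_diag; rewrite ?invrK ?invr_eq0.
(* In the scaling exponent, [i] and [i'] clear the diagonal entries and [s] clears the corner. *)
have E1 : iota (f ^+ (i + i' + s)) * (x / u) = iota (f ^+ (i' + s + j)).
  have -> : x = u * iota (f ^+ j) / iota (f ^+ i) by rewrite -xE mulfK.
  rewrite !exprD !rmorphM; move: (X0 i).
  move: (iota (f ^+ i)) (iota (f ^+ i')) (iota (f ^+ j)) (iota (f ^+ s)) => P1 P2 P3 P4 P0.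
  by field; rewrite P0 u0.
have E2 : iota (f ^+ (i + i' + s)) * (z / u') = iota (f ^+ (i + s + j')).
  have -> : z = u' * iota (f ^+ j') / iota (f ^+ i') by rewrite -zE mulfK.
  rewrite !exprD !rmorphM; move: (X0 i').
  move: (iota (f ^+ i')) (iota (f ^+ i)) (iota (f ^+ j')) (iota (f ^+ s)) => P1 P2 P3 P4 P0.
  by field; rewrite P0 u'0.
have Oy : O (iota (f ^+ (i + i' + s)) * (y / u')).
  rewrite exprD rmorphM -mulrA; apply: (subringM OO) => //; exact: loc_ring_poly.
have [p [t [Ot yE]]] := loc_ring_approx iota_inj f_irr (i' + s + j) Oy.
rewrite -(vtx_mul_GL2 OO gu Du) -(vtx_scale _ _ (X0 (i + i' + s))).
rewrite mulmx2 scale_mx2 !(mulr0, mul0r, add0r, addr0) E1 E2 yE.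
set M := mx2 _ _ _ _; have Mu : M \in unitmx.
  by rewrite unitmx2 mulr0 subr0 mulf_neq0.
exists (mx2 (f ^+ (i' + s + j)) p 0 (f ^+ (i + s + j'))),
  (i' + s + j + (i + s + j'))%N; split.
  by exists 1; rewrite ?oner_neq0 // det_mx2 mulr0 subr0 scale1r -exprD.
rewrite -(vtx_mul_GL2 OO Mu (GL2_upper (subringN OO Ot))) map_mx2 mulmx2.
rewrite rmorph0 !(mulr0, mul0r, add0r, addr0, mulr1).
by congr (vtx (mx2 _ _ _ _)); rewrite mulrN addrC addrK.
Qed.

Lemma fdet_frame A e : fdet A e -> exists U m n,
  [/\ frame (A *m U) m n e, (m <= n)%N & vtx (iotamx (A *m U)) = vtx (iotamx A)].
Proof.
move=> hA; have Au := unit_fdet iota_inj f_irr hA.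
have [U [m [n [[c c0 cU] h0 h1 sD]]]] := reduce_basis (fdet_neq0 f_irr hA).
have hU : fdet U 0 by exists c; rewrite // expr0 alg_polyC.
have mn : (m + n = e * d)%N.
  by move: sD; case: hA => b b0 ->; rewrite size_scale // (size_irreducible_exp _ hd) => -[].
have hAU : fdet (A *m U) e by rewrite -[e]addn0; exact: fdetM.
have [le_mn|/ltnW le_nm] := leqP m n.
  exists U, m, n; split=> //.
  by rewrite map_mxM (vtx_mul_GL2 OO Au) //; exact: GL2_unimodular.
pose S : 'M[{poly k}]_2 := mx2 0 1 1 0.
have hS : fdet S 0.
  exists (-1); first by rewrite oppr_eq0 oner_eq0.
  by rewrite det_mx2 mulr0 mulr1 sub0r expr0 scaleN1r.
have US : fdet (U *m S) 0 by exact: (fdetM hU hS).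
exists (U *m S), n, m; split=> //; last first.
  by rewrite map_mxM (vtx_mul_GL2 OO Au) //; exact: GL2_unimodular.
rewrite mulmxA; have -> : A *m U *m S = mx2 ((A *m U) 0 1) ((A *m U) 0 0)
    ((A *m U) 1 1) ((A *m U) 1 0).
  by rewrite {1}[A *m U]mx2E mulmx2 !(mulr0, mulr1, add0r, addr0).
split; last by rewrite addnC.
- have := fdetM hAU hS; rewrite addn0 {1}[A *m U]mx2E mulmx2.
  by rewrite !(mulr0, mulr1, add0r, addr0).
- by apply: ord2P; rewrite mxE /=.
- by apply: ord2P; rewrite mxE /=.
Qed.

Lemma vtype_exists g : g \in unitmx -> exists n b, vtype (vtx g) n b.
Proof.
move=> /vtx_fdet[A [e [hA ->]]].
have [U [m [n [hU mn E]]]] := fdet_frame hA.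
by exists (n - m)%N, (odd e), (A *m U), m, n, e; split=> //; lia.
Qed.

Lemma vtype_surj n (b : bool) : odd n = odd d && b ->
  exists2 g, g \in unitmx & vtype (vtx g) n b.
Proof.
move=> nb; have d0 := d_gt0 f_irr hd.
(* This exponent has parity [b] and satisfies n <= e d because d >= 1; the parity hypothesis makes e
   d - n even. *)
pose e := (b + 2 * n)%N; pose m := ((e * d - n)./2)%N.
have ne : (n <= e * d)%N by rewrite /e; nia.
have mE : (m + (m + n) = e * d)%N.
  have : odd (e * d - n) = false.
    by rewrite oddB // oddM nb /e oddD oddM /= addbF oddb andbC addbb.
  by rewrite /m; move: (e * d)%N ne; clear; lia.
(* Euclidean division of [f ^+ e] by 'X^m makes the determinant equal to [f ^+ e]. The quotient has
   degree e d - m = m + n and the remainder has degree below m. *)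
pose A : 'M[{poly k}]_2 := mx2 'X^m (- (f ^+ e %% 'X^m)) 1 (f ^+ e %/ 'X^m).
have Xm0 : 'X^m != 0 :> {poly k} by rewrite -size_poly_eq0 size_polyXn.
have hA : frame A m (m + n) e.
  split=> //.
  - exists 1; first exact: oner_neq0.
    by rewrite det_mx2 mulr1 opprK scale1r mulrC -divp_eq.
  - by apply: ord2P; rewrite mxE /= ?size_polyXn ?size_poly1.
  - apply: ord2P; rewrite mxE /= ?size_polyN.
      by have := ltn_modp (f ^+ e) 'X^m; rewrite Xm0 size_polyXn ltnS; move: (size _) => z; lia.
    rewrite size_divp // size_polyXn (size_irreducible_exp _ hd) /=; lia.
exists (iotamx A); first by rewrite (unit_fdet iota_inj f_irr (frame_fdet hA)).
exists A, m, (m + n)%N, e; split=> //.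
by rewrite /e oddD oddM /= addbF oddb.
Qed.

End Tree.

(** * Neighbours *)

Section Adjacency.

Variables (k : fieldType) (F : fieldType) (iota : {rmorphism {poly k} -> F}).
Hypothesis iota_inj : injective iota.
Hypothesis iota_frac : forall x, exists a b, b != 0 /\ x = iota a / iota b.
Variables (f : {poly k}).
Hypothesis (f_irr : irreducible_poly f).

Implicit Types (p : {poly k}) (x y u : F) (A U : 'M[{poly k}]_2).
Implicit Types (g : 'M[F]_2) (v w : set (set 'cV[F]_2)).

Local Notation O := (loc_ring iota f).
Local Notation iotamx A := (map_mx iota A).
Local Notation vtx := (vtx O).
Local Notation Lat := (Lat O).

Let f0 : f != 0 := irredp_neq0 f_irr.
Let OO : subring O := subring_loc iota_inj f_irr.
Definition loc_ideal : set F := [set iota f * x | x in O].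

Local Notation fO := loc_ideal.

Definition residue_mx p : 'M[{poly k}]_2 := mx2 f p 0 1.
Definition infty_mx : 'M[{poly k}]_2 := mx2 1 0 0 f.

Lemma fdet_residue_mx p : fdet f (residue_mx p) 1.
Proof. by exists 1; rewrite ?oner_neq0 // det_mx2 mulr1 mulr0 subr0 scale1r expr1. Qed.

Lemma fdet_infty_mx : fdet f infty_mx 1.
Proof. by exists 1; rewrite ?oner_neq0 // det_mx2 mul1r mulr0 subr0 scale1r expr1. Qed.

Lemma fO_sub x y : fO x -> fO y -> fO (x - y).
Proof.
case=> a Oa <- [b Ob <-]; exists (a - b); last by rewrite mulrBr.
exact: (subringB OO).
Qed.

Lemma fO_add x y : fO x -> fO y -> fO (x + y).
Proof.
case=> a Oa <- [b Ob <-]; exists (a + b); last by rewrite mulrDr.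
exact: (subringD OO).
Qed.

Lemma fO_mul x y : O x -> fO y -> fO (x * y).
Proof.
move=> Ox [b Ob <-]; exists (x * b); last by rewrite mulrCA.
exact: (subringM OO).
Qed.

Lemma fO_1 : ~ fO 1.
Proof.
case=> x Ox E; have := irreducible_dvdp1 f_irr.
by rewrite (loc_ring_dvd iota_inj f_irr Ox) // rmorph1 E.
Qed.

Definition vec x y : 'cV[F]_2 := \col_i if i == 0 then x else y.

Lemma vecE (c : 'cV[F]_2) : c = vec (c 0 0) (c 1 0).
Proof. by apply/colP; apply: ord2P; rewrite mxE. Qed.

Lemma mul_mx2_vec (a b c e x y : F) :
  mx2 a b c e *m vec x y = vec (a * x + b * y) (c * x + e * y).
Proof. by apply/colP; apply: ord2P; rewrite mxE sum_ord2 !mxE. Qed.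

Lemma Lat_vec g c : Lat g c <-> exists x y, [/\ O x, O y & c = g *m vec x y].
Proof.
split=> [[z Oz <-]|[x [y [Ox Oy ->]]]].
  by exists (z 0 0), (z 1 0); rewrite -vecE; split=> //; apply: Oz.
by exists (vec x y) => // i j; rewrite mxE; case: ifP.
Qed.

(** In the basis [g] the sublattice is the kernel of (x, y) -> x - p y modulo f, a form in which
    sublattices of index one are easy to compare. *)
Lemma Lat_residue g p : Lat (g *m iotamx (residue_mx p)) =
  [set c | exists x y, [/\ O x, O y, c = g *m vec x y & fO (x - iota p * y)]].
Proof.
rewrite map_mx2 rmorph0 rmorph1; apply/seteqP; split=> c.
  case/Lat_vec => x [y [Ox Oy ->]]; exists (iota f * x + iota p * y), y.
  rewrite -mulmxA mul_mx2_vec mul0r add0r mul1r addrK; split=> //; last by exists x.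
  by apply: (subringD OO); apply: (subringM OO) => //; exact: loc_ring_poly.
case=> x [y [Ox Oy -> [z Oz zE]]]; apply/Lat_vec; exists z, y; split=> //.
by rewrite -mulmxA mul_mx2_vec mul0r add0r mul1r zE subrK.
Qed.

Lemma Lat_infty g : Lat (g *m iotamx infty_mx) =
  [set c | exists x y, [/\ O x, O y, c = g *m vec x y & fO y]].
Proof.
rewrite map_mx2 rmorph0 rmorph1; apply/seteqP; split=> c.
  case/Lat_vec => x [y [Ox Oy ->]]; exists x, (iota f * y).
  rewrite -mulmxA mul_mx2_vec !mul0r add0r mul1r addr0; split=> //; last by exists y.
  by apply: (subringM OO) => //; exact: loc_ring_poly.
case=> x [y [Ox Oy -> [z Oz zE]]]; apply/Lat_vec; exists x, z; split=> //.
by rewrite -mulmxA mul_mx2_vec !mul0r add0r mul1r addr0 zE.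
Qed.

(* A surjection of O^2 onto the residue field is given by the images [r] and
   [s] of the basis, which are not both zero; its kernel is the sublattice
   attached to the point (r : s) of the projective line. *)
Lemma sublattice_cases g L' : g \in unitmx -> L' `<=` Lat g -> L' 0 ->
  quotients_iso (W := F^o) O (Lat g) L' O fO ->
  L' = Lat (g *m iotamx infty_mx) \/
  exists p, L' = Lat (g *m iotamx (residue_mx p)).
Proof.
move=> gu sub L'0 [phi [phiO phi_add phi_ker phi_surj]].
have O1 := subring1 OO; have O0 := subring0 OO.
have Lv x y : O x -> O y -> Lat g (g *m vec x y) by move=> Ox Oy; apply/Lat_vec; exists x, y.
pose r := phi (g *m vec 1 0); pose s := phi (g *m vec 0 1).
have Or : O r by apply/phiO/Lv. have Os : O s by apply/phiO/Lv.
have phi0 : fO (phi 0) by apply/phi_ker => //; rewrite -(mulmx0 _ g); apply/Lat_vec;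
  exists 0, 0; split=> //; congr (_ *m _); apply/colP => i; rewrite !mxE if_same.
have phiE x y : O x -> O y -> fO (phi (g *m vec x y) - (x * r + y * s)).
  move=> Ox Oy; have L2 : Lat g (g *m vec 0 y) by exact: Lv.
  have E1 : g *m vec x y = x *: (g *m vec 1 0) + g *m vec 0 y.
    rewrite scalemxAr -mulmxDr; congr (_ *m _).
    by apply/colP; apply: ord2P; rewrite !mxE ?mulr1 ?mulr0 ?addr0 ?add0r.
  have E2 : g *m vec 0 y = y *: (g *m vec 0 1) + 0.
    rewrite scalemxAr addr0; congr (_ *m _).
    by apply/colP; apply: ord2P; rewrite !mxE ?mulr1 ?mulr0.
  (* [phi] is linear only modulo [f O] and only on expressions a x + y. The second application, with
     y = 0, leaves a term [phi 0], which [phi0] absorbs. *)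
  have H1 := phi_add x _ _ Ox (Lv 1 0 O1 O0) L2.
  have H2 : fO (phi (y *: (g *m vec 0 1) + 0) - (y *: (phi (g *m vec 0 1) : F^o) + phi 0)).
    apply: phi_add => //; first exact: Lv.
    exact: sub.
  rewrite -E1 in H1; rewrite -E2 in H2.
  have := fO_add (fO_add H1 H2) phi0; congr fO.
  rewrite /r /s -/(_ * _); move: (phi _) (phi _) (phi _) (phi _) (phi _) => p1 p2 p3 p4 p5.
  rewrite /GRing.scale /=; ring.
have L'E : L' = [set c | exists x y, [/\ O x, O y, c = g *m vec x y & fO (x * r + y * s)]].
  apply/seteqP; split=> c.
    move=> L'c; have /Lat_vec[x [y [Ox Oy cE]]] := sub _ L'c.
    exists x, y; split=> //; have /phi_ker[_ /(_ L'c)] := sub _ L'c.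
    rewrite cE => H; have := fO_sub H (phiE x y Ox Oy); congr fO; ring.
  case=> x [y [Ox Oy -> H]]; have Lc := Lv x y Ox Oy.
  apply/(phi_ker _ Lc); have := fO_add (phiE x y Ox Oy) H; congr fO; ring.
have nonunit x : O x -> ~ O x^-1 -> fO x.
  by move=> Ox nx; have [y Oy ->] := loc_ring_nonunit Ox nx; exists y.
have [Oir|nr] := pselect (r != 0 /\ O r^-1).
  right; have [r0 OVr] := Oir.
  have Osr : O (- s / r) by apply: (subringM OO) => //; exact: (subringN OO).
  have [p [t [Ot pE]]] := loc_ring_approx iota_inj f_irr 1 Osr.
  exists p; rewrite Lat_residue L'E; apply/seteqP; split=> c [x [y [Ox Oy cE H]]];
    exists x, y; split=> //.
    have -> : x - iota p * y = r^-1 * (x * r + y * s) + y * (iota f * t).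
      have -> : iota p = - s / r - iota f * t by rewrite pE expr1 addrK.
      by field.
    by apply: fO_add; apply: fO_mul => //; exists t.
  have -> : x * r + y * s = r * (x - iota p * y) - r * y * (iota f * t).
    have -> : iota p = - s / r - iota f * t by rewrite pE expr1 addrK.
    by field.
  apply: fO_sub; apply: fO_mul => //; last by exists t.
  exact: (subringM OO).
have rf : fO r.
  have [r0|r0] := eqVneq r 0; first by exists 0; rewrite // mulr0.
  by apply: nonunit => // Oi; apply: nr.
have [Ois|ns] := pselect (s != 0 /\ O s^-1).
  left; have [s0 OVs] := Ois.
  rewrite Lat_infty L'E; apply/seteqP; split=> c [x [y [Ox Oy cE H]]];
    exists x, y; split=> //.
    have -> : y = s^-1 * ((x * r + y * s) - x * r) by field.
    by apply: fO_mul => //; apply: fO_sub => //; exact: fO_mul.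
  by apply: fO_add; [|rewrite mulrC]; exact: fO_mul.
have sf : fO s.
  have [s0|s0] := eqVneq s 0; first by exists 0; rewrite // mulr0.
  by apply: nonunit => // Oi; apply: ns.
(* If both basis vectors have image in [f O], so has everything, and 1 is not reached. *)
exfalso; apply: fO_1; have [c Lc H] := phi_surj 1 O1.
have /Lat_vec[x [y [Ox Oy cE]]] := Lc; rewrite cE in H.
have H2 : fO (x * r + y * s) by apply: fO_add; exact: fO_mul.
have := fO_add H (fO_add (phiE x y Ox Oy) H2); congr fO.
move: (phi _) => z; ring.
Qed.

Definition adjacent v w := exists L L', [/\ v L, w L', L' `<=` L &
  quotients_iso (W := F^o) O L L' O [set iota f * x | x in O]].

Definition neighbour g w := w = vtx (g *m iotamx infty_mx) \/
  exists p, w = vtx (g *m iotamx (residue_mx p)).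

Lemma adjacent_neighbour g w : g \in unitmx -> tree_vertices O w ->
  adjacent (vtx g) w -> neighbour g w.
Proof.
move=> gu /tree_verticesP[g' g'u ->] [L [L' [/vtxE[c c0 ->] /vtxE[c' c'0 ->] sub iso]]].
have cgu : c *: g \in unitmx by rewrite unitmxZ ?unitfE.
have L0 : Lat (c' *: g') 0.
  exists 0; last by rewrite mulmx0.
  by move=> i j; rewrite mxE; exact: subring0 OO.
have key (K : 'M[F]_2) : Lat (c' *: g') = Lat (c *: g *m K) -> vtx g' = vtx (g *m K).
  move=> E; rewrite -(vtx_scale _ g' c'0) [LHS](congr1 (@homothety_class F) E) -scalemxAl.
  exact: vtx_scale.
by have [/key|[p /key]] := sublattice_cases cgu sub L0 iso; [left|right; exists p].
Qed.

Lemma adjacent_residue g p : g \in unitmx ->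
  adjacent (vtx g) (vtx (g *m iotamx (residue_mx p))).
Proof.
move=> gu; exists (Lat g), (Lat (g *m iotamx (residue_mx p))); split; try exact: vtx_Lat.
  by rewrite Lat_residue => c [x [y [Ox Oy -> _]]]; apply/Lat_vec; exists x, y.
have coords x y : invmx g *m (g *m vec x y) = vec x y by rewrite mulKmx.
pose phi (c : 'cV[F]_2) : F^o := (invmx g *m c) 0 0 - iota p * (invmx g *m c) 1 0.
have phiE x y : phi (g *m vec x y) = x - iota p * y.
  by rewrite /phi coords !mxE.
exists phi; split.
- move=> c /Lat_vec[x [y [Ox Oy ->]]]; rewrite phiE.
  by apply: (subringB OO) => //; apply: (subringM OO) => //; exact: loc_ring_poly.
- move=> a c e _ _ _; have -> : phi (a *: c + e) = a *: phi c + phi e.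
    by rewrite /phi mulmxDr -scalemxAr !mxE /GRing.scale /=; ring.
  by rewrite subrr; exists 0; rewrite ?mulr0 //; exact: subring0 OO.
- move=> c /Lat_vec[x [y [Ox Oy ->]]]; rewrite phiE Lat_residue; split.
    by move=> H; exists x, y.
  case=> x' [y' [_ _ E H]].
  have /colP E2 : vec x y = vec x' y' by rewrite -(coords x y) E coords.
  by have := E2 0; have := E2 1; rewrite !mxE /= => -> ->.
- move=> m Om; exists (g *m vec m 0).
    by apply/Lat_vec; exists m, 0; split=> //; exact: subring0 OO.
  by rewrite phiE mulr0 subr0 subrr; exists 0; rewrite ?mulr0 //; exact: subring0 OO.
Qed.

Lemma infty_mx_swap g : g *m iotamx infty_mx *m mx2 0 1 1 0 =
  g *m mx2 0 1 1 0 *m iotamx (residue_mx 0).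
Proof.
rewrite -!mulmxA; congr (_ *m _).
by rewrite !map_mx2 !rmorph0 !rmorph1 !mulmx2; congr mx2; ring.
Qed.

Lemma adjacent_infty g : g \in unitmx ->
  adjacent (vtx g) (vtx (g *m iotamx infty_mx)).
Proof.
move=> gu; have S := GL2_swap iota_inj f_irr.
have u : g *m iotamx infty_mx \in unitmx.
  by rewrite unitmx_mul gu (unit_fdet iota_inj f_irr fdet_infty_mx).
rewrite -(vtx_mul_GL2 OO gu S) -(vtx_mul_GL2 OO u S) infty_mx_swap.
by apply: adjacent_residue; rewrite unitmx_mul gu (GL2_unitmx S).
Qed.

Lemma neighbour_adjacent g w : g \in unitmx -> neighbour g w -> adjacent (vtx g) w.
Proof.
by move=> gu [->|[p ->]]; [exact: adjacent_infty | exact: adjacent_residue].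
Qed.

(** The two kinds of matrices are inverse to each other up to the scalar f and a unipotent factor.
    Thus inclusion of lattices, although directed, induces a symmetric relation on homothety
    classes. *)
Lemma neighbour_sym g w : g \in unitmx -> neighbour g w ->
  exists g', [/\ g' \in unitmx, w = vtx g' & neighbour g' (vtx g)].
Proof.
have F0 : iota f != 0 by rewrite iota_neq0.
move=> gu [->|[p ->]]; [exists (g *m iotamx infty_mx) | exists (g *m iotamx (residue_mx p))].
  rewrite unitmx_mul gu (unit_fdet iota_inj f_irr fdet_infty_mx); split=> //.
  right; exists 0; rewrite -(vtx_scale _ g F0) -mulmxA; congr vtx.
  rewrite -[in LHS](mulmx1 g) scalemxAr; congr (_ *m _).
  by rewrite !map_mx2 mx2_1 scale_mx2 mulmx2 rmorph0 rmorph1; congr mx2; ring.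
have ru := unit_fdet iota_inj f_irr (fdet_residue_mx p).
rewrite unitmx_mul gu ru; split=> //; left.
have U : GL2 O (mx2 1 (- iota p) 0 1).
  by apply: (GL2_upper iota_inj f_irr); apply: (subringN OO); exact: loc_ring_poly.
have Iu := unit_fdet iota_inj f_irr fdet_infty_mx.
have rIu : g *m iotamx (residue_mx p) *m iotamx infty_mx \in unitmx.
  by rewrite !unitmx_mul gu ru.
rewrite -(vtx_mul_GL2 OO rIu U) -(vtx_scale _ g F0) -!mulmxA; congr vtx.
rewrite -[in LHS](mulmx1 g) scalemxAr; congr (_ *m _).
by rewrite !map_mx2 mx2_1 scale_mx2 !mulmx2 !rmorph0 !rmorph1; congr mx2; ring.
Qed.

Lemma vtx_residue_mod g p p' : g \in unitmx -> f %| p - p' ->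
  vtx (g *m iotamx (residue_mx p)) = vtx (g *m iotamx (residue_mx p')).
Proof.
move=> gu /dvdpP[q E].
have ru := unit_fdet iota_inj f_irr (fdet_residue_mx p').
have u : g *m iotamx (residue_mx p') \in unitmx by rewrite unitmx_mul gu.
have U : GL2 O (mx2 1 (iota q) 0 1).
  by apply: (GL2_upper iota_inj f_irr); exact: loc_ring_poly.
rewrite -(vtx_mul_GL2 OO u U) -mulmxA; congr (vtx (_ *m _)).
have -> : p = p' + q * f by rewrite -E addrC subrK.
by rewrite !map_mx2 !rmorph0 !rmorph1 !mulmx2 rmorphD rmorphM; congr mx2; ring.
Qed.

End Adjacency.

(** * First minima of the lattices attached to residues *)

Section ReducedBasis.

Variables (k : fieldType) (f : {poly k}) (d : nat).
Hypotheses (f_irr : irreducible_poly f) (hd : size f = d.+1).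

Implicit Types (a b p : {poly k}) (A U V : 'M[{poly k}]_2).

Local Notation fdet := (fdet f).
Local Notation residue_mx := (residue_mx f).

Let f0 : f != 0 := irredp_neq0 f_irr.

(* A basis of [{(x, y) | x = p y mod f}] that is reduced at infinity, when the
   first coordinate is given weight [- n]. *)
Definition reduced n p j := exists U, [/\ fdet U 0,
  (size ((residue_mx p *m U) 0%R 0%R) <= (n + j).+1)%N /\
  (size ((residue_mx p *m U) 1%R 0%R) <= j.+1)%N,
  (size ((residue_mx p *m U) 0%R 1%R) <= (d - j).+1)%N,
  (size ((residue_mx p *m U) 1%R 1%R) <= (d - n - j).+1)%N &
  (n + 2 * j <= d)%N].

Lemma residue_mulE p U i : (residue_mx p *m U) 0 i = f * U 0 i + p * U 1 i /\
  (residue_mx p *m U) 1 i = U 1 i.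
Proof. by rewrite !mxE !sum_ord2 !mxE /= mul0r mul1r add0r. Qed.

Lemma mul_dvd_small p : f %| p -> (size p <= d)%N -> p = 0.
Proof.
move=> fp sp; apply: contrapT => /eqP p0; have := dvdp_leq p0 fp.
by rewrite hd ltnNge sp.
Qed.

Lemma fdet_col_neq0 U e i : fdet U e -> (U 0 i == 0) && (U 1 i == 0) = false.
Proof.
move=> hU; have := fdet_neq0 f_irr hU; rewrite {1}[U]mx2E det_mx2.
apply: contraNF => /andP[/eqP u0 /eqP u1]; move: i u0 u1.
by apply: ord2P => -> ->; rewrite !(mul0r, mulr0) subrr.
Qed.

(** The factor 'X^n in the second row realizes the weight. Reducing this matrix, of determinant
    degree d + n, gives column degrees m1 <= m2 with m1 + m2 = d + n, and j = m1 - n. *)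
Lemma reduced_exists n p : (n < d)%N -> exists j, reduced n p j.
Proof.
move=> lt_nd; pose A : 'M[{poly k}]_2 := mx2 f p 0 'X^n.
have X0 : 'X^n != 0 :> {poly k} by rewrite -size_poly_eq0 size_polyXn.
have sA : size (\det A) = (d + n).+1.
  by rewrite det_mx2 mulr0 subr0 size_mul // hd size_polyXn addnS.
have A0 : \det A != 0 by rewrite -size_poly_gt0 sA.
have [U [m1 [m2 [[c c0 cU] h0 h1 sE]]]] := reduce_basis A0.
have {c c0 cU} hU : fdet U 0 by exists c; rewrite // expr0 alg_polyC.
have {}sE : (m1 + m2 = d + n)%N by move: sE; rewrite sA => -[].
have AE V i : (A *m V) 0 i = (residue_mx p *m V) 0 i /\
    (A *m V) 1 i = 'X^n * (residue_mx p *m V) 1 i.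
  by rewrite !mxE !sum_ord2 !mxE /= !mul0r !add0r mul1r.
wlog le_m : U m1 m2 h0 h1 sE hU / (m1 <= m2)%N => [H|].
  have [le_m|/ltnW le_m] := leqP m1 m2; first exact: (H U m1 m2).
  pose S : 'M[{poly k}]_2 := mx2 0 1 1 0.
  have hS : fdet S 0.
    exists (-1); first by rewrite oppr_eq0 oner_eq0.
    by rewrite det_mx2 mulr0 mulr1 sub0r expr0 scaleN1r.
  have US : A *m (U *m S) =
      mx2 ((A *m U) 0 1) ((A *m U) 0 0) ((A *m U) 1 1) ((A *m U) 1 0).
    by rewrite mulmxA {1}[A *m U]mx2E mulmx2 !(mulr0, mulr1, add0r, addr0).
  apply: (H (U *m S) m2 m1) => //.
  - by rewrite US; apply: ord2P; rewrite mxE /=.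
  - by rewrite US; apply: ord2P; rewrite mxE /=.
  - by rewrite addnC.
  - exact: (fdetM hU hS).
have szX a s : (size ('X^n * a)%R <= s.+1)%N -> a != 0 -> (size a + n <= s.+1)%N.
  by move=> + a0; rewrite mulrC size_mulXn // addnC.
(* If m1 < n, the second coordinate of the first column vanishes, and the first one is a multiple of
   [f] of degree below d, hence zero as well. *)
have n_le : (n <= m1)%N.
  rewrite leqNgt; apply/negP => lt_m1n.
  have [E0 E1] := AE U 0; have [R0 R1] := residue_mulE p U 0.
  have u1 : U 1 0 = 0.
    apply: contrapT => /eqP u1.
    have := szX (U 1 0) m1; rewrite -{1}R1 -E1 => /(_ (h0 1) u1).
    by move: u1; rewrite -size_poly_gt0; move: (size _) => z; lia.
  have u0 : f * U 0 0 = 0.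
    apply: mul_dvd_small; first exact: dvdp_mulIl.
    have := h0 0; rewrite E0 R0 u1 mulr0 addr0; move: (size _) => z; lia.
  have := fdet_col_neq0 0 hU; rewrite u1 eqxx andbT => /negP; apply.
  by move/eqP: u0; rewrite mulf_eq0 (negPf f0).
have Eb i s : (size ((A *m U) 1%R i) <= s.+1)%N -> (n <= s)%N ->
    (size ((residue_mx p *m U) 1%R i) <= (s - n).+1)%N.
  have [_ ->] := AE U i; have [->|nz] := eqVneq ((residue_mx p *m U) 1 i) 0.
    by rewrite size_poly0.
  by move=> /szX/(_ nz); move: (size _) => z; lia.
exists (m1 - n)%N; exists U; split=> //; [split| | |].
- by have [<- _] := AE U 0; rewrite subnKC.
- by apply: Eb.
- by have [<- _] := AE U 1; rewrite (_ : d - (m1 - n) = m2)%N //; lia.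
- rewrite (_ : d - n - (m1 - n) = m2 - n)%N; last by lia.
  by apply: Eb => //; apply: leq_trans le_m.
- lia.
Qed.

(* Solutions of [a = p b mod f] below the second minimum are multiples of the
   first basis vector. *)
Lemma reduced_solutions n p j J : reduced n p j -> (n + 2 * J < d)%N ->
  exists a0 b0, [/\ ~~ ((a0 == 0) && (b0 == 0)), f %| a0 - p * b0,
    (size a0 <= (n + j).+1)%N, (size b0 <= j.+1)%N &
    forall a b, (size a <= (n + J).+1)%N -> (size b <= J.+1)%N -> f %| a - p * b ->
      exists2 c : {poly k}, (size c <= J.+1 - j)%N & a = c * a0 /\ b = c * b0].
Proof.
case=> U [hU [s00 s10] s01 s11 le_nj] lt_J.
set V := residue_mx p *m U in s00 s10 s01 s11.
have hV : fdet V 1 := fdetM (fdet_residue_mx f p) hU.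
have [V00 V10] := residue_mulE p U 0; have [V01 V11] := residue_mulE p U 1.
exists (V 0 0), (V 1 0); split=> //.
- by rewrite (fdet_col_neq0 0 hV).
- by rewrite V00 V10 addrK dvdp_mulIl.
move=> a b sa sb /dvdpP[z zE].
have [c c0 cE] := hU; have {}cE : \det U = c%:P by rewrite cE expr0 alg_polyC.
(* [x] and [y] are the coordinates of (a, b) in the reduced basis: U^(-1) applied to (z, b), where a
   - p b = z f. *)
pose x := (c^-1)%:P * (U 1 1 * z - U 0 1 * b).
pose y := (c^-1)%:P * (U 0 0 * b - U 1 0 * z).
have cc : c%:P * (c^-1)%:P = 1 :> {poly k} by rewrite -polyCM divff.
have detU : U 0 0 * U 1 1 - U 0 1 * U 1 0 = c%:P by rewrite -cE {5}[U]mx2E det_mx2.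
have bE : V 1 0 * x + V 1 1 * y = b.
  rewrite V10 V11 /x /y -[RHS]mul1r -cc -detU; ring.
have zE2 : U 0 0 * x + U 0 1 * y = z.
  rewrite /x /y -[RHS]mul1r -cc -detU; ring.
have aE : V 0 0 * x + V 0 1 * y = a.
  have -> : a = f * z + p * b by rewrite mulrC -zE subrK.
  rewrite V00 V01 -zE2 -{1}bE V10 V11; ring.
pose W : 'M[{poly k}]_2 := mx2 (V 0 0) (V 0 1) ('X^n * V 1 0) ('X^n * V 1 1).
have sX (u : {poly k}) s : (size u <= s.+1)%N -> (size ('X^n * u)%R <= (n + s).+1)%N.
  by move=> su; apply: size_mulS => //; rewrite size_polyXn.
have W0 i : (size (W i 0%R) <= (n + j).+1)%N.
  by move: i; apply: ord2P; rewrite mxE //=; exact: sX.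
have W1 i : (size (W i 1%R) <= (d - j).+1)%N.
  move: i; apply: ord2P; rewrite mxE //=; apply: leq_trans (sX _ _ s11) _; lia.
have detV : \det W = 'X^n * \det V.
  by rewrite [V]mx2E !det_mx2 !mxE /=; ring.
have sW : size (\det W) = (n + j + (d - j)).+1.
  rewrite detV; case: hV => e e0 ->; rewrite expr1 mulrC size_mulXn ?size_scale ?hd //.
    lia.
  by rewrite scaler_eq0 negb_or e0.
have WaE : W 0 0 * x + W 0 1 * y = a by rewrite [W 0 0]mxE [W 0 1]mxE.
have WbE : W 1 0 * x + W 1 1 * y = 'X^n * b.
  by rewrite [W 1 0]mxE [W 1 1]mxE /= -!mulrA -mulrDr bE.
have [Hx Hy] := cramer_size W0 W1 sW WaE WbE sa (sX _ _ sb).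
(* A nonzero [y] would require d - j <= n + J, against n + 2 J < d and n + 2 j <= d. *)
have y0 : y = 0.
  apply: contrapT => /eqP y0; have := Hy y0.
  by move: y0; rewrite -size_poly_gt0; move: (size y) => s; lia.
exists x; last by rewrite -aE -bE y0 !mulr0 !addr0 !(mulrC x).
have [->|x0] := eqVneq x 0; first by rewrite size_poly0.
by have := Hx x0; move: (size x) => s; lia.
Qed.

(** The weight offsets the gap n = m' - m: both terms of each entry get the same bound, m' + j in
    the first column and m + d - j in the second. *)
Lemma reduced_frame n p j A m m' e : reduced n p j -> frame f d A m m' e ->
  (m + n = m')%N -> exists2 U, fdet U 0 &
  frame f d (A *m (residue_mx p *m U)) (m' + j) (m + (d - j)) e.+1.
Proof.
case=> U [hU [s00 s10] s01 s11 le_nj] [hA A0 A1 mm] nm; exists U => //; split.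
- by have := fdetM hA (fdetM (fdet_residue_mx f p) hU); rewrite (addnC e).
- move=> i; rewrite mxE sum_ord2; apply: size_addS.
    by apply: leq_trans (size_mulS (A0 i) s00) _; lia.
  exact: size_mulS (A1 i) s10.
- move=> i; rewrite mxE sum_ord2; apply: size_addS.
    exact: size_mulS (A0 i) s01.
  by apply: leq_trans (size_mulS (A1 i) s11) _; lia.
- rewrite mulSn -mm; lia.
Qed.

Lemma frame_infty A m m' e : frame f d A m m' e ->
  frame f d (A *m infty_mx f) m (m' + d) e.+1.
Proof.
case=> hA A0 A1 mm.
have -> : A *m infty_mx f = mx2 (A 0 0) (A 0 1 * f) (A 1 0) (A 1 1 * f).
  by rewrite {1}[A]mx2E mulmx2 !(mulr0, mulr1, add0r, addr0).
split.
- have := fdetM hA (fdet_infty_mx f).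
  by rewrite addn1 {1}[A]mx2E mulmx2 !(mulr0, mulr1, add0r, addr0).
- by apply: ord2P; rewrite mxE /=.
- by apply: ord2P; rewrite mxE /=; apply: size_mulS; rewrite // hd.
- rewrite mulSn -mm; lia.
Qed.

Lemma frame_residue0 A m m' e : frame f d A m m' e ->
  frame f d (A *m residue_mx 0) (m + d) m' e.+1.
Proof.
case=> hA A0 A1 mm.
have AE : A *m residue_mx 0 = mx2 (A 0 0 * f) (A 0 1) (A 1 0 * f) (A 1 1).
  by rewrite {1}[A]mx2E mulmx2 !(mulr0, mulr1, add0r, addr0).
split.
- by have := fdetM hA (fdet_residue_mx f 0); rewrite (addnC e).
- by rewrite AE; apply: ord2P; rewrite mxE /=; apply: size_mulS; rewrite // hd.
- by rewrite AE; apply: ord2P; rewrite mxE /=.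
- rewrite mulSn -mm; lia.
Qed.

End ReducedBasis.

(** * Counting residues *)

Local Close Scope classical_set_scope.

Section Counting.

Variables (k : finFieldType) (f : {poly k}) (d : nat).
Hypotheses (f_irr : irreducible_poly f) (hd : size f = d.+1).
Variables (K : finFieldType) (pi : {rmorphism {poly k} -> K}).
Hypothesis pi_eq0 : forall a, (pi a == 0) = (f %| a).
Hypothesis pi_surj : forall x, exists a, pi a == x.

Implicit Types (a b c p : {poly k}) (x : K).

Local Notation q := #|k|.

Let f0 : f != 0 := irredp_neq0 f_irr.

Definition res_lift x : {poly k} := xchoose (pi_surj x).

Lemma res_liftK x : pi (res_lift x) = x.
Proof. exact/eqP/(xchooseP (pi_surj x)). Qed.

Lemma pi_eq a b : (pi a == pi b) = (f %| a - b).
Proof. by rewrite -subr_eq0 -rmorphB pi_eq0. Qed.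

Lemma npolyp_eq m (a : {poly_m k}) p : (size p <= m)%N -> a = p :> {poly k} ->
  a = npolyp m p.
Proof. by move=> sp e; apply: val_inj; exact: etrans e (esym (npolypK sp)). Qed.

Lemma npolyp_inj m p p' : (size p <= m)%N -> (size p' <= m)%N ->
  npolyp m p = npolyp m p' -> p = p'.
Proof. by move=> sp sp' e; rewrite -(npolypK sp) -(npolypK sp') e. Qed.

Lemma pi_small_inj m : (m <= d)%N -> injective (fun a : {poly_m k} => pi a).
Proof.
move=> le_md a b /eqP; rewrite pi_eq => /(mul_dvd_small hd) E.
apply: val_inj; apply/eqP; rewrite -subr_eq0; apply/eqP/E.
by apply: size_subS; apply: leq_trans (size_npoly _) _.
Qed.

Lemma card_residue_field : #|K| = (q ^ d)%N.
Proof.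
rewrite -(card_npoly k d); apply/esym/(bij_eq_card (f := fun a : {poly_d k} => pi a)).
have gK : cancel (fun x => npolyp d (res_lift x %% f)) (fun a : {poly_d k} => pi a).
  move=> x; rewrite npolypK; last by rewrite -ltnS -hd ltn_modp.
  have E : res_lift x %% f - res_lift x = - (res_lift x %/ f * f).
    by rewrite {2}(divp_eq (res_lift x) f) opprD addrCA subrr addr0.
  by apply/eqP; rewrite -{2}(res_liftK x) pi_eq E dvdpNr dvdp_mull.
exists (fun x => npolyp d (res_lift x %% f)) => // a.
by apply: (pi_small_inj (leqnn d)); rewrite gK.
Qed.

Variable n : nat.
Hypothesis lt_nd : (n < d)%N.
Variable j : K -> nat.
Hypothesis red_j : forall x, reduced f d n (res_lift x) (j x).

Definition solutions J x := [set ab : {poly_((n + J).+1) k} * {poly_(J.+1) k} |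
  pi ab.1 == x * pi ab.2].

Lemma pi_res_lift_eq a b x : (pi a == x * pi b) = (f %| a - res_lift x * b).
Proof. by rewrite -{1}(res_liftK x) -rmorphM pi_eq. Qed.

(** Below the second minimum the solutions are the multiples of the first vector by polynomials of
    degree at most J - j. If j > J, truncated subtraction gives exponent 0, which counts the zero
    solution. *)
Lemma card_solutions J x : (n + 2 * J < d)%N -> #|solutions J x| = (q ^ (J.+1 - j x))%N.
Proof.
move=> lt_J; have [a0 [b0 [nz ab0 sa0 sb0 gen]]] := reduced_solutions f_irr hd (red_j x) lt_J.
set m := (J.+1 - j x)%N in gen *.
have sz (a c : {poly k}) s : (size c <= m)%N -> (size a <= (s + j x).+1)%N ->
    (size (c * a)%R <= (s + J).+1)%N.
  rewrite /m; have [le_j|lt_j] := leqP (j x) J.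
    rewrite subSn // => sc sa; apply: leq_trans (size_mulS sc sa) _.
    by rewrite addnCA subnK.
  have -> : (J.+1 - j x = 0)%N by apply/eqP; rewrite subn_eq0.
  by rewrite leqn0 size_poly_eq0 => /eqP ->; rewrite mul0r size_poly0.
have sz1 (c : {poly_m k}) : (size ((c : {poly k}) * a0)%R <= (n + J).+1)%N.
  by apply: sz => //; exact: size_npoly.
have sz2 (c : {poly_m k}) : (size ((c : {poly k}) * b0)%R <= J.+1)%N.
  by apply: (sz b0 _ 0%N) => //; exact: size_npoly.
pose G (c : {poly_m k}) : {poly_((n + J).+1) k} * {poly_(J.+1) k} :=
  (npolyp (n + J).+1 ((c : {poly k}) * a0), npolyp J.+1 ((c : {poly k}) * b0)).
have G_inj : injective G.
  move=> c c' [/npolyp_inj E1 /npolyp_inj E2]; apply: val_inj => /=.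
  have {}E1 := E1 (sz1 c) (sz1 c'); have {}E2 := E2 (sz2 c) (sz2 c').
  by move: nz; rewrite negb_and => /orP[a00|b00]; [apply: (mulIf a00)|apply: (mulIf b00)].
rewrite -(card_npoly k m) -cardsT -(card_imset _ G_inj); apply: eq_card => ab.
rewrite inE pi_res_lift_eq; apply/idP/imsetP => [|[c _ ->]].
  case: ab => a b /= ab; have [c sc [aE bE]] := gen a b (size_npoly a) (size_npoly b) ab.
  exists (npolyp m c) => //; congr (_, _); apply: npolyp_eq => //.
    by rewrite npolypK.
  by rewrite npolypK.
by rewrite /G /= !npolypK // mulrCA -mulrBr dvdp_mull.
Qed.

Definition solutions' J x := [set ab in solutions J x | ab.2 != 0].

Lemma pi_small_eq0 m (a : {poly_m k}) : (m <= d)%N -> (pi a == 0) = (a == 0).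
Proof.
move=> le_m; rewrite -(inj_eq (pi_small_inj le_m)) /= rmorph0; congr (_ == _).
Qed.

(** If b = 0, then f divides a, whose degree is below d; only the zero solution is lost. *)
Lemma card_solutions' J x : (n + 2 * J < d)%N ->
  #|solutions' J x| = (q ^ (J.+1 - j x) - 1)%N.
Proof.
move=> lt_J; rewrite -(card_solutions x lt_J).
pose z : {poly_((n + J).+1) k} * {poly_(J.+1) k} := (0, 0).
have z_in : z \in solutions J x by rewrite inE /= rmorph0 mulr0.
have := cardsD1 z (solutions J x); rewrite z_in => ->; rewrite add1n subn1 /=; apply: eq_card => -[a b].
rewrite !inE /= -pair_eqE /=; have [->|b0] := eqVneq b 0; last first.
  by rewrite andbT andbF.
rewrite andbF andbT rmorph0 mulr0 (pi_small_eq0 a); last by lia.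
by case: eqP.
Qed.

(** Double counting: a pair with b != 0 is a solution for exactly one residue, the quotient
    [pi a / pi b]. *)
Lemma sum_solutions' J : (n + 2 * J < d)%N ->
  (\sum_x #|solutions' J x| = q ^ (n + J).+1 * (q ^ J.+1 - 1))%N.
Proof.
move=> lt_J.
have -> : (q ^ (n + J).+1 * (q ^ J.+1 - 1) =
    #|[set ab : {poly_((n + J).+1) k} * {poly_(J.+1) k} | ab.2 != 0%R]|)%N.
  pose X := finset.setX [set: {poly_((n + J).+1) k}] [set~ (0 : {poly_(J.+1) k})].
  have <- : #|X| = (q ^ (n + J).+1 * (q ^ J.+1 - 1))%N.
    by rewrite cardsX cardsT cardsC1 !card_npoly subn1.
  by apply: eq_card => -[a b]; rewrite !inE.
rewrite -sum1dep_card.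
rewrite (partition_big (fun ab : {poly_((n + J).+1) k} * {poly_(J.+1) k} =>
  pi ab.1 / pi ab.2) predT) //=.
apply: eq_bigr => x _; rewrite sum1dep_card; apply: eq_card => -[a b].
rewrite !inE /=; have [_|b0] := eqVneq b 0; first by rewrite /= ?andbF.
rewrite /= ?andbT; have pb : pi b != 0 by rewrite pi_small_eq0 //; lia.
by apply/eqP/eqP => [->|<-]; rewrite ?mulfK ?divfK.
Qed.

(** For j <= J the number q^(J+1-j) - 1 exceeds q (q^(J-j) - 1) by q - 1, and for j > J both vanish.
    So the totals for J and J - 1 isolate the number of residues with j <= J. *)
Lemma card_le_index J : (n + 2 * J < d)%N ->
  #|[set x | (j x <= J)%N]| = (q ^ (n + 2 * J).+1)%N.
Proof.
move=> lt_J; have q1 : (1 < q)%N := finNzRing_gt1 k.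
have M1 := sum_solutions' lt_J.
(* This is the total for J - 1; for J = 0 both sides are zero. *)
have M0 : (\sum_x (q ^ (J - j x) - 1) = q ^ (n + J) * (q ^ J - 1))%N.
  case: J lt_J {M1} => [|J] lt_J.
    by rewrite expn0 subnn muln0; apply: big1 => x _.
  have lt_J' : (n + 2 * J < d)%N by lia.
  rewrite addnS -(sum_solutions' lt_J'); apply: eq_bigr => x _.
  by rewrite card_solutions'.
have step : (\sum_x #|solutions' J x| =
    q * (\sum_x (q ^ (J - j x) - 1)) + (q - 1) * #|[set x | (j x <= J)%N]|)%N.
  have -> : ((q - 1) * #|[set x | (j x <= J)%N]| =
      \sum_x (if (j x <= J)%N then q - 1 else 0))%N.
    by rewrite -big_mkcond sum_nat_cond_const mulnC.
  rewrite big_distrr -big_split /=.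
  apply: eq_bigr => x _; rewrite card_solutions' //.
  case: leqP => le_j.
    rewrite subSn // expnS; have : (0 < q ^ (J - j x))%N by rewrite expn_gt0 ltnW.
    by move: (q ^ _)%N q1 => z; move: q => r; clear; nia.
  have [-> ->] : (J.+1 - j x = 0 /\ J - j x = 0)%N by lia.
  by rewrite expn0 subnn muln0.
have qJ : (q ^ (n + 2 * J).+1 = q ^ (n + J).+1 * q ^ J)%N.
  by rewrite -expnD; congr (q ^ _)%N; lia.
have qq : (0 < q - 1)%N by rewrite subn_gt0.
apply/eqP; rewrite -(eqn_pmul2l qq) qJ; apply/eqP.
move: step; rewrite M1 M0 !expnS.
have : (0 < q ^ J)%N by rewrite expn_gt0 ltnW.
move: (q ^ (n + J))%N (q ^ J)%N #|_| q1 => u v w; move: q => r r1 v0.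
move=> E; have {}E : (r * u * (r * v - 1) - r * (u * (v - 1)) = (r - 1) * w)%N by rewrite E addKn.
have e1 : (r * v - 1 = (r - 1) * v + (v - 1))%N.
  rewrite -{1}(subnK (ltnW r1)) mulnDl mul1n addnBA //.
rewrite -E e1 mulnDr [(r * (u * _))%N]mulnA addnK; ring.
Qed.

(** In a first minimum of degree 0 the second coordinate is a nonzero constant, and dividing by it
    leaves a polynomial of degree at most n. Conversely (w, 1) is a nonzero solution for J = 0, so
    the count there exceeds 1. *)
Lemma index0 x : j x = 0 <-> exists2 w : {poly_(n.+1) k}, true & x = pi w.
Proof.
have lt0 : (n + 2 * 0 < d)%N by rewrite muln0 addn0.
split=> [j0|[w _ xE]].
  have [a0 [b0 [nz ab0 sa0 sb0 _]]] := reduced_solutions f_irr hd (red_j x) lt0.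
  rewrite j0 addn0 in sa0 sb0.
  have b00 : b0 != 0.
    apply: contraNneq nz => b00; rewrite b00 eqxx andbT; apply/eqP.
    apply: (mul_dvd_small hd); last exact: leq_trans sa0 _.
    by move: ab0; rewrite b00 mulr0 subr0.
  have bc := size1_polyC sb0; have c0 : b0`_0 != 0.
    by apply: contraNneq b00 => c0; rewrite bc c0 polyC0.
  have sw : (size ((b0`_0)^-1 *: a0) <= n.+1)%N by apply: leq_trans (size_scale_leq _ _) _.
  exists (npolyp n.+1 ((b0`_0)^-1 *: a0)); rewrite // npolypK //.
  have pc : pi (b0`_0)%:P != 0.
    by rewrite pi_eq0; apply: ndvdp_const.
  apply: (mulIf pc); rewrite -[RHS]rmorphM [_ * _%:P]mulrC mul_polyC scalerA divff // scale1r.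
  by apply/esym/eqP; rewrite -bc pi_res_lift_eq.
apply/eqP; rewrite -leqn0 -ltnS; move: (card_solutions x lt0).
pose z : {poly_((n + 0).+1) k} * {poly_1 k} := (0, 0).
pose z' : {poly_((n + 0).+1) k} * {poly_1 k} := (npolyp (n + 0).+1 w, npolyp 1 1).
have sw : (size w <= (n + 0).+1)%N by rewrite addn0 size_npoly.
have zz' : z != z'.
  apply/eqP => /(congr1 (fun ab : {poly_((n + 0).+1) k} * {poly_1 k} => (ab.2 : {poly k}))).
  by rewrite /= npolypK ?size_poly1 // => /esym/eqP; rewrite oner_eq0.
have z_in : z \in solutions 0 x by rewrite inE /= rmorph0 mulr0.
have z'_in : z' \in solutions 0 x.
  by rewrite inE /= !npolypK ?size_poly1 // rmorph1 mulr1 xE.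
have le2 : (1 < #|solutions 0 x|)%N by apply/card_gt1P; exists z, z'.
move=> E; rewrite E in le2.
rewrite ltnNge; apply/negP => j1; move: le2.
by rewrite (_ : 1 - j x = 0)%N ?expn0 //; apply/eqP; rewrite subn_eq0.
Qed.

End Counting.

(** * Affine maps and homographies over k on the residue field *)

Section Quadratic.

Variables (k : finFieldType) (K : finFieldType) (pi : {rmorphism {poly k} -> K}).

Implicit Types (a b c e : k) (x y : K).

Local Notation q := #|k|.
Local Notation "c %:K" := (pi c%:P) (at level 2, format "c %:K").

Let c0 : (0 : k)%:K = 0. Proof. by rewrite polyC0 rmorph0. Qed.
Let c1 : (1 : k)%:K = 1. Proof. by rewrite polyC1 rmorph1. Qed.

Lemma const_inj : injective (fun c : k => c%:K).
Proof.
move=> a b ab; apply/eqP; rewrite -subr_eq0; apply/negPn/negP => ab0.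
have : (a - b)%:K * (a - b)^-1%:K = 1 by rewrite -rmorphM -polyCM divff // c1.
by rewrite polyCB rmorphB ab subrr mul0r => /esym/eqP; rewrite oner_eq0.
Qed.

Lemma const_eq0 c : (c%:K == 0) = (c == 0).
Proof. by rewrite -c0 (inj_eq const_inj). Qed.

Lemma frobeniusD x y : (x + y) ^+ q = x ^+ q + y ^+ q.
Proof.
have [p p_pr p_char] := finPcharP k.
have pK : p \in [pchar K].
  by rewrite inE p_pr -(rmorph_nat pi) -polyC_natr (pcharf0 p_char) c0 eqxx.
apply: exprDn_pchar; rewrite (card_pprimeChar p_char).
apply: (pnat_mul_test) || rewrite pnatX; apply/orP; left.
by rewrite pnatE.
Qed.

Lemma frobenius0 : (0 : K) ^+ q = 0.
Proof. by rewrite expr0n eqn0Ngt (ltnW (finNzRing_gt1 k)). Qed.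

Lemma frobeniusN x : (- x) ^+ q = - x ^+ q.
Proof.
by apply/eqP; rewrite -addr_eq0 -frobeniusD addNr frobenius0.
Qed.

Lemma frobenius_const c : c%:K ^+ q = c%:K.
Proof. by rewrite -rmorphXn -polyC_exp expf_card. Qed.

Lemma card_frobenius_fix m : (0 < m)%N -> (#|[set x : K | x ^+ (q ^ m) == x]| <= q ^ m)%N.
Proof.
move=> m0; have q1 := finNzRing_gt1 k.
have qm : (1 < q ^ m)%N by rewrite -{1}(expn0 q) ltn_exp2l.
pose P : {poly K} := 'X^(q ^ m) - 'X.
have sP : size P = (q ^ m).+1.
  by rewrite size_polyDl ?size_polyXn // size_polyN size_polyX ltnS.
have P0 : P != 0 by rewrite -size_poly_eq0 sP.
rewrite cardE -ltnS -sP; apply: max_poly_roots => //; last exact: enum_uniq.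
apply/allP => x; rewrite mem_enum inE => /eqP E.
by rewrite /root !hornerE ?hornerXn E subrr.
Qed.

Lemma frobenius_fix_set : [set x : K | x ^+ q == x] = [set c%:K | c : k].
Proof.
apply/esym/eqP; rewrite eqEcard; apply/andP; split.
  by apply/fintype.subsetP => _ /imsetP[c _ ->]; rewrite inE frobenius_const.
rewrite (card_imset _ const_inj); have := card_frobenius_fix (ltn0Sn 0).
by rewrite expn1.
Qed.

Lemma frobenius_fixP x : x ^+ q = x <-> exists c, x = c%:K.
Proof.
split=> [/eqP E|[c ->]]; last exact: frobenius_const.
have : x \in [set x : K | x ^+ q == x] by rewrite inE.
by rewrite frobenius_fix_set => /imsetP[c _ ->]; exists c.
Qed.

(** Degree at least 3 over k, phrased as independence of 1, x, x^2 because coincidences of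
    homographies produce exactly such relations. *)
Definition quadratic_free x := forall a b c,
  a%:K * x ^+ 2 + b%:K * x + c%:K = 0 -> [/\ a = 0, b = 0 & c = 0].

(** The elements of F_(q^2) outside k, described by Frobenius so that no embedding of F_(q^2) into
    [K] is presupposed. *)
Definition quadratic_set := [set x : K | (x ^+ (q ^ 2) == x) && (x ^+ q != x)].

Lemma frobenius2 x : x ^+ (q ^ 2) = (x ^+ q) ^+ q.
Proof. by rewrite -exprM. Qed.

(** Frobenius sends a root of a quadratic over k to its other root. As the sum of the two roots lies
    in k, applying Frobenius again returns to x. *)
Lemma quadratic_freeP x : x ^+ q != x -> x \notin quadratic_set -> quadratic_free x.
Proof.
move=> xq; rewrite inE xq andbT => xqq a b c E.
have nc e : x != e%:K by apply: contraNneq xq => ->; rewrite frobenius_const.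
have [a0|a0] := eqVneq a 0.
  rewrite a0 c0 mul0r add0r in E; have [b0|b0] := eqVneq b 0.
    by split=> //; apply/eqP; rewrite -const_eq0 -E b0 c0 mul0r add0r.
  have /eqP[] := nc (- c / b); have bK : b%:K != 0 by rewrite const_eq0.
  apply: (mulfI bK); rewrite -rmorphM -polyCM mulrCA divff // mulr1 polyCN rmorphN.
  by apply/eqP; rewrite -addr_eq0 E.
case/eqP: xqq; have aK : a%:K != 0 by rewrite const_eq0.
set y := x ^+ q.
have E2 : a%:K * y ^+ 2 + b%:K * y + c%:K = 0.
  have := congr1 (fun z => z ^+ q) E; rewrite !frobeniusD !exprMn !frobenius_const.
  by rewrite frobenius0 -expr2.
have : (x - y) * (a%:K * (x + y) + b%:K) = 0.
  by rewrite -(subrr 0) -{1}E -E2; ring.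
move/eqP; rewrite mulf_eq0 subr_eq0 eq_sym (negPf xq) /= => /eqP E3.
have yE : y = - (b / a)%:K - x.
  apply: (mulfI aK); rewrite mulrBr mulrN -rmorphM -polyCM mulrCA divff // mulr1.
  have -> : a%:K * y = (a%:K * (x + y) + b%:K) - b%:K - a%:K * x by ring.
  by rewrite E3 sub0r.
rewrite frobenius2 -/y yE frobeniusD !frobeniusN frobenius_const -/y yE; ring.
Qed.

Lemma not_const x a b : x ^+ q != x -> a%:K * x + b%:K = 0 -> a = 0 /\ b = 0.
Proof.
move=> xq E; have [a0|a0] := eqVneq a 0.
  by split=> //; apply/eqP; rewrite -const_eq0 -E a0 c0 mul0r add0r.
case/eqP: xq; apply/frobenius_fixP; exists (- b / a).
have aK : a%:K != 0 by rewrite const_eq0.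
apply: (mulfI aK); rewrite -rmorphM -polyCM mulrCA divff // mulr1 polyCN rmorphN.
by apply/eqP; rewrite -addr_eq0 E.
Qed.

Lemma card_quadratic_set_le : (#|quadratic_set| <= q ^ 2 - q)%N.
Proof.
have -> : quadratic_set = [set x : K | x ^+ (q ^ 2) == x] :\: [set x : K | x ^+ q == x].
  by apply/setP => x; rewrite !inE andbC.
rewrite cardsD; have -> : [set x : K | x ^+ (q ^ 2) == x] :&: [set x : K | x ^+ q == x] =
    [set x : K | x ^+ q == x].
  by apply/setP => x; rewrite !inE; apply: andb_idl => /eqP E; rewrite frobenius2 !E.
by rewrite frobenius_fix_set (card_imset _ const_inj) leq_sub2r // card_frobenius_fix.
Qed.

Lemma card_set_neq0 : #|[set a : k | a != 0]| = (q - 1)%N.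
Proof. by rewrite subn1 -(cardC1 (0 : k)); apply: eq_card => a; rewrite !inE. Qed.

(** The elements a x + b with a != 0 are q^2 - q in number, already the maximum allowed by the
    number of roots of X^(q^2) - X. *)
Lemma quadratic_set_affine x : x \in quadratic_set ->
  quadratic_set = [set ab.1%:K * x + ab.2%:K | ab in [set ab : k * k | ab.1 != 0]].
Proof.
move=> xQ; have := xQ; rewrite inE => /andP[/eqP xqq xq].
apply/esym/eqP; rewrite eqEcard; apply/andP; split.
  apply/fintype.subsetP => _ /imsetP[[a b] ab ->]; move: ab; rewrite inE /= => a0.
  have fE : (a%:K * x + b%:K) ^+ q = a%:K * x ^+ q + b%:K.
    by rewrite frobeniusD exprMn !frobenius_const.
  rewrite inE frobenius2 fE frobeniusD exprMn !frobenius_const -frobenius2 xqq eqxx /=.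
  by rewrite (inj_eq (addIr _)) (inj_eq (mulfI _)) // const_eq0.
rewrite card_in_imset; last first.
  move=> [a b] [a' b'] _ _ /= E.
  have [/eqP + /eqP] : a - a' = 0 /\ b - b' = 0.
    apply: (not_const xq); rewrite !polyCB !rmorphB.
    by rewrite -(subrr (a'%:K * x + b'%:K)) -{1}E; ring.
  by rewrite !subr_eq0 => /eqP -> /eqP ->.
apply: leq_trans card_quadratic_set_le _.
have -> : [set ab : k * k | ab.1 != 0] = finset.setX [set a : k | a != 0] [set: k].
  by apply/setP => -[a b]; rewrite !inE andbT.
by rewrite cardsX card_set_neq0 cardsT mulnBl mul1n mulnn.
Qed.

Lemma card_quadratic_set x : x \in quadratic_set -> #|quadratic_set| = (q ^ 2 - q)%N.
Proof.
move=> xQ; have := xQ; rewrite inE => /andP[/eqP xqq xq].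
rewrite {1}(quadratic_set_affine xQ) card_in_imset; last first.
  move=> [a b] [a' b'] _ _ /= E.
  have [/eqP + /eqP] : a - a' = 0 /\ b - b' = 0.
    apply: (not_const xq); rewrite !polyCB !rmorphB.
    by rewrite -(subrr (a'%:K * x + b'%:K)) -{1}E; ring.
  by rewrite !subr_eq0 => /eqP -> /eqP ->.
have -> : [set ab : k * k | ab.1 != 0] = finset.setX [set a : k | a != 0] [set: k].
  by apply/setP => -[a b]; rewrite !inE andbT.
by rewrite cardsX card_set_neq0 cardsT mulnBl mul1n mulnn.
Qed.

(** The denominator is multiplied out. It cannot vanish: otherwise the invertible matrix would kill
    the vector (x, 1). *)
Definition homographic x y := exists a b c e,
  a * e - b * c != 0 /\ y * (c%:K * x + e%:K) = a%:K * x + b%:K.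

Lemma homographic_quadratic x y : x \in quadratic_set -> homographic x y ->
  y \in quadratic_set.
Proof.
rewrite inE => /andP[/eqP xqq xq] [a [b [c [e [D E]]]]].
have nz : c%:K * x + e%:K != 0.
  apply: contraNneq D => /(not_const xq)[-> ->]; by rewrite !mulr0 subrr.
rewrite inE; apply/andP; split.
  apply/eqP; apply: (mulIf nz); rewrite E.
  have := congr1 (fun z => z ^+ (q ^ 2)) E.
  rewrite exprMn !(frobenius2 (_ + _)) !frobeniusD !exprMn !frobenius_const.
  by rewrite -!frobenius2 xqq.
apply/eqP => /frobenius_fixP[z zE]; move: D; rewrite zE in E.
have [/eqP + /eqP] : z * c - a = 0 /\ z * e - b = 0.
  apply: (not_const xq); rewrite !polyCB !rmorphB !polyCM !rmorphM.
  by rewrite -(subrr (a%:K * x + b%:K)) -{1}E; ring.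
rewrite !subr_eq0 => /eqP <- /eqP <-; by rewrite mulrAC eqxx.
Qed.

(* PGL_2(k) acts freely on the elements of degree at least 3 over k. *)
Lemma card_homographic x (P : pred K) : quadratic_free x ->
  (forall y, P y <-> homographic x y) -> #|[set y : K | P y]| = (q ^ 3 - q)%N.
Proof.
move=> xfree HP.
have xnc c : x + c%:K != 0.
  apply/eqP => E; have [|_ /eqP] := xfree 0 1 c.
    by rewrite c0 c1 mul0r add0r mul1r.
  by rewrite oner_eq0.
have divE (u v : k) : v != 0 -> (u / v)%:K = u%:K / v%:K.
  move=> v0; have vK : v%:K != 0 by rewrite const_eq0.
  by apply: (mulIf vK); rewrite divfK // -rmorphM -polyCM divfK.
pose T := (k * k * option k)%type.
(* Normal forms of PGL_2(k): [None] stands for the maps fixing infinity, [Some z] for those sending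
   - z to infinity. There are (q - 1) q (q + 1) of them. *)
pose G (t : T) : K := match t.2 with
  | None => t.1.1%:K * x + t.1.2%:K
  | Some z => t.1.2%:K + t.1.1%:K / (x + z%:K) end.
pose D := [set t : T | t.1.1 != 0].
have -> : [set y : K | P y] = [set G t | t in D].
  apply/setP => y; rewrite inE; apply/idP/imsetP.
    case/HP => a [b [c [e [De E]]]]; have [cz|cz] := eqVneq c 0.
      rewrite cz mulr0 subr0 mulf_eq0 negb_or in De; case/andP: De => a0 e0.
      exists (a / e, b / e, None); first by rewrite inE /= mulf_neq0 ?invr_eq0.
      have eK : e%:K != 0 by rewrite const_eq0.
      rewrite cz c0 mul0r add0r in E.
      by apply: (mulIf eK); rewrite E /G /= !divE //; field.
    have cK : c%:K != 0 by rewrite const_eq0.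
    exists ((b * c - a * e) / c ^+ 2, a / c, Some (e / c)).
      by rewrite inE /= mulf_neq0 ?invr_eq0 ?expf_neq0 // -oppr_eq0 opprB.
    have xe := xnc (e / c); rewrite /G /=.
    rewrite divE // in xe; rewrite !divE ?expf_neq0 //.
    rewrite polyCB rmorphB !polyCM !rmorphM.
    have xe' : c%:K * x + e%:K != 0.
      apply: contraNneq xe => xe; apply/eqP/(mulfI cK).
      by rewrite mulrDr mulrCA divff // mulr1 mulr0.
    apply: (mulIf xe'); rewrite E; field.
    by rewrite cK mulrC xe'.
  case=> -[[a b] [z|]]; rewrite inE /= => a0 ->; apply/HP; rewrite /G /=.
    exists b, (a + b * z), 1, z; split.
      by rewrite mulr1 -oppr_eq0 opprB addrK.
    rewrite c1 mul1r polyCD rmorphD polyCM rmorphM mulrDl divfK //; ring.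
  exists a, b, 0, 1; rewrite mulr1 mulr0 subr0; split=> //.
  by rewrite c0 c1 mul0r add0r mulr1.
have quad a b c : a%:K * x ^+ 2 + b%:K * x + c%:K = 0 -> [/\ a = 0, b = 0 & c = 0] := @xfree a b c.
rewrite card_in_imset; last first.
  move=> [[a b] o] [[a' b'] o']; rewrite !inE /= => a0 a'0; rewrite /G /=.
  (* Each coincidence of two normal forms becomes, after clearing denominators, a quadratic relation
     for [x], whose coefficients must vanish. *)
  have mixed a1 b1 a2 b2 z : a1 != 0 ->
      a1%:K * x + b1%:K = b2%:K + a2%:K / (x + z%:K) -> False.
    move=> a10 E; have [/eqP] : [/\ a1 = 0, a1 * z + b1 - b2 = 0 & b1 * z - b2 * z - a2 = 0].
      apply: quad; rewrite !(polyCB, polyCD, polyCM) !(rmorphB, rmorphD, rmorphM).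
      have := congr1 (fun y => y * (x + z%:K)) E; rewrite mulrDl (mulrDl b2%:K) divfK // => /eqP.
      by rewrite -subr_eq0 => /eqP <-; ring.
    by rewrite (negPf a10).
  case: o o' => [z|] [z'|] E.
  - have E2 := congr1 (fun y => y * (x + z%:K) * (x + z'%:K)) E.
    have F1 : (b%:K + a%:K / (x + z%:K)) * (x + z%:K) * (x + z'%:K) =
        (b%:K * (x + z%:K) + a%:K) * (x + z'%:K) by rewrite mulrDl divfK.
    have F2 : (b'%:K + a'%:K / (x + z'%:K)) * (x + z%:K) * (x + z'%:K) =
        (b'%:K * (x + z'%:K) + a'%:K) * (x + z%:K) by rewrite mulrAC mulrDl divfK.
    rewrite F1 F2 in E2.
    have [B1 B2 B3] : [/\ b - b' = 0, (b - b') * (z + z') + a - a' = 0 &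
        (b - b') * (z * z') + a * z' - a' * z = 0].
      apply: quad; rewrite !(polyCB, polyCD, polyCM) !(rmorphB, rmorphD, rmorphM).
      by move/eqP: E2; rewrite -subr_eq0 => /eqP <-; ring.
    move: B2 B3; rewrite B1 !mul0r !add0r => /eqP; rewrite subr_eq0 => /eqP aa.
    rewrite -aa -mulrBr => /eqP; rewrite mulf_eq0 (negPf a0) /= subr_eq0 => /eqP ->.
    by move/eqP: B1; rewrite subr_eq0 => /eqP ->.
  - by case: (mixed _ _ _ _ _ a'0 (esym E)).
  - by case: (mixed _ _ _ _ _ a0 E).
  - have [_ /eqP + /eqP] : [/\ 0 = 0 :> k, a - a' = 0 & b - b' = 0].
      apply: quad; rewrite c0 mul0r add0r !polyCB !rmorphB.
      by rewrite -(subrr (a'%:K * x + b'%:K)) -{1}E; ring.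
    by rewrite !subr_eq0 => /eqP -> /eqP ->.
have -> : D = finset.setX (finset.setX [set a : k | a != 0] [set: k]) [set: option k].
  by apply/setP => -[[a b] o]; rewrite !inE !andbT.
rewrite !cardsX card_set_neq0 !cardsT card_option.
move: #|k| => r; have -> : (r ^ 3 - r = r * (r ^ 2 - 1 ^ 2))%N.
  by rewrite mulnBr exp1n muln1 -expnS.
by rewrite subn_sqr addn1 mulnA [(r * (r - 1))%N]mulnC.
Qed.

(* Affine maps [y = a x + w], [deg w <= n], act freely outside the
   polynomials of degree at most [n]. *)
Lemma card_affine n (x : K) (P : pred K) :
  injective (fun w : {poly_(n.+1) k} => pi w) ->
  (forall w : {poly_(n.+1) k}, x != pi w) ->
  (forall y, P y <-> exists a (w : {poly_(n.+1) k}), a != 0 /\ y = a%:K * x + pi w) ->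
  #|[set y : K | P y]| = ((q - 1) * q ^ n.+1)%N.
Proof.
move=> pi_inj xn HP.
pose D := finset.setX [set a : k | a != 0] [set: {poly_(n.+1) k}].
pose G (aw : k * {poly_(n.+1) k}) : K := aw.1%:K * x + pi aw.2.
have -> : [set y : K | P y] = [set G aw | aw in D].
  apply/setP => y; rewrite inE; apply/idP/imsetP.
    by case/HP => a [w [a0 ->]]; exists (a, w); rewrite // !inE a0.
  by case=> -[a w]; rewrite !inE andbT /= => a0 ->; apply/HP; exists a, w.
rewrite card_in_imset ?cardsX ?card_set_neq0 ?cardsT ?card_npoly //.
rewrite /G => -[a w] [a' w'] _ _ /= E.
have [aa|aa] := eqVneq a a'.
  by move: E; rewrite aa => /addrI/pi_inj ->.
have aaK : (a - a')%:K != 0 by rewrite const_eq0 subr_eq0.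
have sw : (size ((a - a')^-1 *: ((w' : {poly k}) - w))%R <= n.+1)%N.
  apply: leq_trans (size_scale_leq _ _) _; apply: size_subS; exact: size_npoly.
case/eqP: (xn (npolyp n.+1 ((a - a')^-1 *: ((w' : {poly k}) - w)))).
apply: (mulfI aaK); rewrite npolypK // -[RHS]rmorphM mul_polyC scalerA divff ?subr_eq0 //.
rewrite scale1r !rmorphB /=.
have -> : pi w' = a%:K * x + pi w - a'%:K * x by rewrite E addrC addKr.
by ring.
Qed.

End Quadratic.

Local Open Scope classical_set_scope.

(** * Orbits of edges *)

Section IndexQuadratic.

Variables (k : finFieldType) (f : {poly k}) (d : nat).
Hypotheses (f_irr : irreducible_poly f) (hd : size f = d.+1).
Variables (K : finFieldType) (pi : {rmorphism {poly k} -> K}).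
Hypothesis pi_eq0 : forall a, (pi a == 0) = (f %| a).
Hypothesis pi_surj : forall x, exists a, pi a == x.

(** If a x^2 + b x + c = 0 with a != 0, a first minimum (a1, b1) yields the solution (- b a1 - c b1,
    a a1) of no larger degree. Since 2 j < d it is a constant multiple of (a1, b1), so x = a1 / b1
    lies in k, which j > 0 forbids. *)
Lemma index_quadratic_free x j : reduced f d 0 (res_lift pi_surj x) j ->
  (0 < j)%N -> (2 * j < d)%N -> quadratic_free pi x.
Proof.
move=> red j0 jd; have lt0 : (0 + 2 * 0 < d)%N by rewrite muln0; lia.
have nc (u : k) : x != pi u%:P.
  apply/eqP => xE; have [a1 [b1 [_ _ _ _ gen]]] := reduced_solutions f_irr hd red lt0.
  have [||| c sc [_ c1]] := gen u%:P 1.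
  - by rewrite add0n; exact: size_polyC_leq1.
  - by rewrite size_poly1.
  - by rewrite -(pi_res_lift_eq pi_eq0) rmorph1 mulr1 xE.
  have /eqP cz : c == 0 by rewrite -size_poly_leq0; apply: leq_trans sc _; lia.
  by move/eqP: c1; rewrite cz mul0r oner_eq0.
have divE (u v : k) : v != 0 -> pi (u / v)%:P = pi u%:P / pi v%:P.
  move=> v0; have vK : pi v%:P != 0 by rewrite const_eq0.
  by apply: (mulIf vK); rewrite divfK // -rmorphM -polyCM divfK.
have c0 : pi (0 : k)%:P = 0 by rewrite polyC0 rmorph0.
move=> a b c E; have [a0|a0] := eqVneq a 0.
  rewrite a0 c0 mul0r add0r in E; have [b0|b0] := eqVneq b 0.
    split=> //; apply/eqP; rewrite -(const_eq0 pi) -E b0 c0 mul0r add0r //.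
  have /eqP[] := nc (- c / b); have bK : pi b%:P != 0 by rewrite const_eq0.
  apply: (mulfI bK); rewrite divE // mulrCA divff // mulr1 polyCN rmorphN.
  by apply/eqP; rewrite -addr_eq0 E.
have [a1 [b1 [nz ab1 sa1 sb1 gen]]] := reduced_solutions f_irr hd red (J := j) jd.
have ab1' : pi a1 = x * pi b1 by apply/eqP; rewrite (pi_res_lift_eq pi_eq0).
have b10 : pi b1 != 0.
  apply: contraNneq nz => b1z; apply/andP; split; apply/eqP/(mul_dvd_small hd).
  - by rewrite -pi_eq0 ab1' b1z mulr0.
  - by apply: leq_trans sa1 _; lia.
  - by rewrite -pi_eq0 b1z.
  - by apply: leq_trans sb1 _; lia.
have [||| e se [_ E2]] := gen (- (b *: a1) - c *: b1) (a *: a1).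
- apply: size_subS; rewrite ?size_polyN.
    by apply: leq_trans (size_scale_leq _ _) _.
  by apply: leq_trans (size_scale_leq _ _) _.
- by apply: leq_trans (size_scale_leq _ _) _.
- rewrite -(pi_res_lift_eq pi_eq0); apply/eqP.
  rewrite -!mul_polyC rmorphB rmorphN !rmorphM ab1'.
  have -> : pi c%:P = - (pi a%:P * x ^+ 2 + pi b%:P * x).
    by apply/eqP; rewrite -addr_eq0 addrC E.
  by ring.
have eE : e = (e`_0)%:P by apply: size1_polyC; apply: leq_trans se _; lia.
have /eqP[] := nc (e`_0 / a); have aK : pi a%:P != 0 by rewrite const_eq0.
rewrite divE // -eE; apply: (mulfI aK); rewrite mulrCA divff // mulr1.
by apply: (mulIf b10); rewrite -mulrA -ab1' -!rmorphM mul_polyC E2.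
Qed.

End IndexQuadratic.

Section EdgeOrbits.

Variables (k : fieldType) (F : fieldType) (iota : {rmorphism {poly k} -> F}).
Hypothesis iota_inj : injective iota.
Hypothesis iota_frac : forall x, exists a b, b != 0 /\ x = iota a / iota b.
Variables (f : {poly k}) (d : nat).
Hypotheses (f_monic : f \is monic) (f_irr : irreducible_poly f).
Hypothesis hd : size f = d.+1.

Implicit Types (p : {poly k}) (A B C U W : 'M[{poly k}]_2) (h : 'M[F]_2).

Local Notation O := (loc_ring iota f).
Local Notation R := (pole_ring iota f d).
Local Notation iotamx A := (map_mx iota A).
Local Notation frame := (frame f d).
Local Notation fdet := (fdet f).
Local Notation vtx := (vtx O).
Local Notation vtype := (vtype iota f d).
Local Notation residue_mx := (residue_mx f).

Let OO : subring O := subring_loc iota_inj f_irr.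
Let RR : subring R := subring_pole iota_inj f_irr f_monic hd.

Lemma vtype_fdet A e : fdet A e -> exists n, vtype (vtx (iotamx A)) n (odd e).
Proof.
move=> hA; have [U [m [m' [hU mm E]]]] := fdet_frame iota_inj f_irr hd hA.
by exists (m' - m)%N, (A *m U), m, m', e; split=> //; lia.
Qed.

(* Automorphisms of the vector bundle O(m) + O(m + n), written in the two basis
   vectors of a frame. *)
Definition flag_auto n U := [/\ fdet U 0, (size (U 0%R 0%R) <= 1)%N,
  U 1 0 = 0 \/ n = 0%N /\ (size (U 1%R 0%R) <= 1)%N,
  (size (U 0%R 1%R) <= n.+1)%N & (size (U 1%R 1%R) <= 1)%N].

Lemma flag_auto_frame n U A m m' e : flag_auto n U -> frame A m m' e ->
  (m + n = m')%N -> frame (A *m U) m m' e.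
Proof.
case=> hU s00 s10 s01 s11 [hA A0 A1 mm] nm; split=> //.
- by have := fdetM hA hU; rewrite addn0.
- move=> i; rewrite mxE sum_ord2; apply: size_addS.
    by have := size_mulS (A0 i) s00; rewrite addn0.
  case: s10 => [->|[n0 s10]]; first by rewrite mulr0 size_poly0.
  by have := size_mulS (A1 i) s10; rewrite -nm n0 !addn0.
- move=> i; rewrite mxE sum_ord2; apply: size_addS.
    by have := size_mulS (A0 i) s01; rewrite nm.
  by have := size_mulS (A1 i) s11; rewrite addn0.
Qed.

Lemma frame_flag_auto n U A B m m' e e' : frame A m m' e -> frame B m m' e' ->
  (m + n = m')%N -> fdet U 0 -> B = A *m U -> flag_auto n U.
Proof.
move=> hA hB nm hU BE; have [u00 u10 u01 u11] := frame_unimodular_size hd hA hB BE.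
have small (p : {poly k}) s t : (p != 0 -> (size p + s <= t.+1)%N) -> (s <= t)%N ->
    (size p <= (t - s).+1)%N.
  have [->|p0] := eqVneq p 0; first by rewrite size_poly0.
  by move=> /(_ isT); move: (size p) => z; lia.
split=> //.
- by have := small _ _ _ u00 (leqnn m); rewrite subnn.
- have [n0|n0] := posnP n; last first.
    left; apply: contrapT => /eqP nz; have := u10 nz.
    by move: nz; rewrite -size_poly_gt0; move: (size _) => z; lia.
  by right; split=> //; have := small _ _ _ u10; rewrite -nm n0 addn0 subnn; exact.
- by have := small _ _ _ u01; rewrite -nm addKn; apply; exact: leq_addr.
- by have := small _ _ _ u11 (leqnn m'); rewrite subnn.
Qed.

(** The bits of the two ends differ, so unordered pairs can be compared end by end: there are no
    inversions. *)
Lemma pair_vtype_eq v w v' w' n b n1 n2 : vtype v n b -> vtype v' n b ->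
  vtype w n1 (~~ b) -> vtype w' n2 (~~ b) -> [set v; w] = [set v'; w'] ->
  v = v' /\ w = w'.
Proof.
move=> hv hv' hw hw' E.
have nb u i j : vtype u i b -> vtype u j (~~ b) -> False.
  move=> h1 h2; have [_ bb] := vtype_fun iota_inj iota_frac f_irr hd h1 h2.
  by case: b bb {hv hv' hw hw' E h1 h2}.
have : [set v'; w'] v by rewrite -E; left.
have : [set v'; w'] w by rewrite -E; right.
case=> [wv'|->]; first by rewrite wv' in hw; case: (nb _ _ _ hv' hw).
by case=> [->//|vw']; rewrite vw' in hv; case: (nb _ _ _ hv hw').
Qed.

Definition residue_edge A p :=
  edge_orbit R [set vtx (iotamx A); vtx (iotamx (A *m residue_mx p))].

Lemma residue_edgeE A p : residue_edge A p =
  edge_orbit R [set vtx (iotamx A); vtx (iotamx (A *m residue_mx p))].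
Proof. by []. Qed.

Lemma vtx_mulmx_fdet A U e : fdet A e -> fdet U 0 ->
  vtx (iotamx (A *m U)) = vtx (iotamx A).
Proof.
move=> hA hU; rewrite map_mxM (vtx_mul_GL2 OO) ?(unit_fdet iota_inj f_irr hA) //.
exact: GL2_unimodular.
Qed.

(** An element carrying one edge to the other fixes the vertex of [A], hence acts on the frame as
    some [U]. The condition says that the homography of [U] sends p to p' modulo f. *)
Lemma residue_edge_eq A m m' e n p p' : frame A m m' e -> (m + n = m')%N ->
  residue_edge A p = residue_edge A p' <->
  exists U, flag_auto n U /\ f %| U 0 0 * p + U 0 1 - p' * (U 1 0 * p + U 1 1).
Proof.
move=> hA nm; have fA := frame_fdet hA.
have Au := frame_unit iota_inj f_irr hA.
have fR p0 : fdet (A *m residue_mx p0) e.+1.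
  by have := fdetM fA (fdet_residue_mx f p0); rewrite addn1.
rewrite /residue_edge edge_orbit_eqP //; split.
  case=> h hR E.
  have hv : vtype (vtx (iotamx A)) n (odd e) by exists A, m, m', e.
  have hv' := vtype_act iota_inj f_monic f_irr hd hR hv.
  have [n1 hw] := vtype_fdet (fR p'); have [n2 hw0] := vtype_fdet (fR p).
  have hw' := vtype_act iota_inj f_monic f_irr hd hR hw0.
  have [E1 E2] := pair_vtype_eq hv hv' hw hw' E.
  have [r [C [hC CE]]] := pole_frame iota_inj f_monic f_irr hd hR hA.
  have hX i : iota (f ^+ i) != 0 by rewrite iota_neq0 // expf_neq0 // irredp_neq0.
  have vC : vtx (iotamx C) = vtx (iotamx A) by rewrite CE vtx_scale // E1.
  have [s [t LE]] := vtx_eq_Lat iota_inj iota_frac f_irr (frame_fdet hC) fA vC.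
  have hC' := frameZ f_irr hd s hC; have hA' := frameZ f_irr hd t hA.
  have [ee [U hU CU]] := Lat_eq_unimodular iota_inj f_irr hd
    (frame_fdet hA') (frame_fdet hC') (esym LE).
  (* Comparing determinants gives e + 2 t = e + 2 r + 2 s; the powers of [f] then cancel and leave h
     A = A U. *)
  have rst : t = (r + s)%N by lia.
  have mt : (m + r * d + s * d = m + t * d)%N by rewrite rst; lia.
  have mt' : (m' + r * d + s * d = m' + t * d)%N by rewrite rst; lia.
  rewrite mt mt' in hC'.
  have fU : flag_auto n U.
    by apply: (frame_flag_auto hA' hC' _ hU CU); lia.
  have hAU : h *m iotamx A = iotamx (A *m U).
    have := congr1 (fun M => map_mx iota M) CU.
    rewrite -scalemxAl !iotamxZ CE scalerA -rmorphM -exprD addnC -rst.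
    exact: (scalerI (hX t)).
  exists U; split=> //.
  have vE : vtx (iotamx (A *m residue_mx p')) = vtx (iotamx (A *m U *m residue_mx p)).
    by rewrite E2 [in LHS]map_mxM mulmxA hAU -map_mxM.
  have fAU : fdet (A *m U *m residue_mx p) e.+1.
    by have := fdetM (fdetM fA hU) (fdet_residue_mx f p); rewrite addn0 addn1.
  have [i [j LE2]] := vtx_eq_Lat iota_inj iota_frac f_irr (fR p') fAU vE.
  have [ij [W hW WE]] := Lat_eq_unimodular iota_inj f_irr hd
    (fdetZ i (fR p')) (fdetZ j fAU) LE2.
  have {}ij : i = j by lia.
  have WE2 : U *m residue_mx p = residue_mx p' *m W.
    have A0 := fdet_neq0 f_irr (fdetZ i fA).
    have Iu : iotamx (f ^+ i *: A) \in unitmx by rewrite unit_iotamx.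
    apply: (iotamx_inj iota_inj); rewrite -[LHS](mulKmx Iu) -[RHS](mulKmx Iu).
    congr (_ *m _); rewrite -!map_mxM; congr (map_mx _ _).
    by move: WE; rewrite -ij -!scalemxAl -!mulmxA.
  (* The second columns of both sides give the congruence. *)
  have := congr1 (fun M : 'M_2 => M 0 1) WE2; have := congr1 (fun M : 'M_2 => M 1 1) WE2.
  rewrite !mxE !sum_ord2 !mxE /= !mulr1 mul0r add0r mul1r => -> ->.
  by rewrite [p' * _]mulrC addrK dvdp_mulr.
case=> U [fU /dvdpP[z zE]]; have hAU := flag_auto_frame fU hA nm.
have hU : fdet U 0 by case: fU.
exists (iotamx (A *m U) *m invmx (iotamx A)).
  exact: (frame_transfer iota_inj f_irr hA hAU).
(* [W] is the conjugate of [U] by the two residue matrices; its upper right entry is a polynomial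
   precisely because of the divisibility. *)
pose W : 'M[{poly k}]_2 := mx2 (U 0 0 - p' * U 1 0) z (f * U 1 0) (U 1 0 * p + U 1 1).
have WE : U *m residue_mx p = residue_mx p' *m W.
  rewrite {1}[U]mx2E !mulmx2; congr mx2; try ring.
  by rewrite [f * z]mulrC -zE; ring.
have hW : fdet W 0.
  case: hU => c c0; rewrite expr0 alg_polyC => cE; exists c; rewrite // expr0 alg_polyC.
  apply: (mulfI (irredp_neq0 f_irr)).
  have := congr1 determinant WE; rewrite !det_mulmx cE.
  have dR p0 : \det (residue_mx p0) = f by rewrite det_mx2 mulr1 mulr0 subr0.
  by rewrite !dR mulrC => <-.
congr ([set _; _]); first by rewrite mulmxKV // (vtx_mulmx_fdet fA hU).
rewrite (map_mxM iota A (residue_mx p)) mulmxA mulmxKV // -map_mxM -mulmxA WE mulmxA.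
by rewrite (vtx_mulmx_fdet (fR p') hW).
Qed.

End EdgeOrbits.

(** A numbering onto [I_c] matches the labels 0, ..., c - 1 carried by the edges of
    [multigraph_of]. *)
Definition has_card (T : Type) (A : set T) (c : nat) : Prop :=
  exists b : T -> nat, set_bij A `I_c b.

(** * Counting the values of a map through its fibres *)

Section Transversal.

Variables (T : finType) (E : Type) (D : {set T}) (G : T -> E).

Lemma fiber_transversal : exists S : {set T}, [/\ S \subset D,
  {in S &, injective G}, forall x, x \in D -> exists2 y, y \in S & G x = G y &
  #|D| = (\sum_(y in S) #|[set x in D | `[< G x = G y >]]%SET|)%N].
Proof.
pose rep x := odflt x [pick y in D | `[< G y = G x >]].
have repP x : x \in D -> rep x \in D /\ G (rep x) = G x.
  by move=> xD; rewrite /rep; case: pickP => [y /andP[yD /asboolP]|/(_ x)] //=;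
     rewrite xD; case: asboolP.
have rep_eq x y : x \in D -> y \in D -> G x = G y -> rep x = rep y.
  move=> xD yD E1; rewrite /rep.
  have -> : [pick z in D | `[< G z = G x >]] = [pick z in D | `[< G z = G y >]].
    by apply: eq_pick => z; rewrite E1.
  case: pickP => [//|/(_ y)]; by rewrite yD; case: asboolP.
exists (rep @: D); split.
- by apply/fintype.subsetP => _ /imsetP[x xD ->]; case: (repP x xD).
- move=> _ _ /imsetP[x xD ->] /imsetP[y yD ->] E1; apply: rep_eq => //.
  by case: (repP x xD) => _ <-; case: (repP y yD) => _ <-.
- by move=> x xD; exists (rep x); [exact: imset_f | case: (repP x xD)].
rewrite -sum1_card (partition_big rep (mem (rep @: D))); last first.
  by move=> x xD; exact: imset_f.
apply: eq_bigr => _ /imsetP[y yD ->]; rewrite sum1dep_card; apply: eq_card => x.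
rewrite !inE; have [xD|] := boolP (x \in D) => //=.
apply/eqP/asboolP => [xy|E1].
  by case: (repP x xD) => _ <-; rewrite xy.
by apply: rep_eq => //; rewrite E1; case: (repP y yD).
Qed.

Lemma image_has_card (S : {set T}) : {in S &, injective G} ->
  has_card [set G x | x in [set x | x \in S]] #|S|.
Proof.
move=> G_inj; pose b e := find (fun x => `[< G x = e >]) (enum S).
have bE x : x \in S -> b (G x) = index x (enum S).
  move=> xS; rewrite /b /index; apply: eq_in_find => y; rewrite mem_enum => yS /=.
  by apply/asboolP/eqP => [/G_inj|->//]; apply.
exists b; split.
- by move=> _ [x xS <-]; rewrite /= bE // cardE index_mem mem_enum.
- move=> e e'; rewrite !inE => -[x xS <-] [y yS <-]; rewrite !bE // => E1.
  by congr G; rewrite -[x](nth_index x (s := enum S)) ?mem_enum // E1 nth_index ?mem_enum.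
- move=> i /=; rewrite cardE => i_lt.
  have [x0 _] : exists x0 : T, x0 \in S.
    by case: (enum S) (mem_enum S) i_lt => // x s /(_ x) + _; rewrite mem_head => /esym xS; exists x.
  have xS : nth x0 (enum S) i \in S by rewrite -mem_enum mem_nth.
  exists (G (nth x0 (enum S) i)); first by exists (nth x0 (enum S) i).
  by rewrite bE // index_uniq // enum_uniq.
Qed.

Lemma image_transversal (S : {set T}) : S \subset D ->
  (forall x, x \in D -> exists2 y, y \in S & G x = G y) ->
  [set G x | x in [set x | x \in D]] = [set G x | x in [set x | x \in S]].
Proof.
move=> sSD cov; apply/seteqP; split=> _ [x /= xD <-].
  by have [y yS ->] := cov x xD; exists y.
by exists x => //; exact: (fintype.subsetP sSD).
Qed.

Lemma image_uniform_has_card s c : (0 < s)%N -> #|D| = (c * s)%N ->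
  (forall y, y \in D -> #|[set x in D | `[< G x = G y >]]%SET| = s) ->
  has_card [set G x | x in [set x | x \in D]] c.
Proof.
move=> s0 cD unif; have [S [sSD G_inj cov sum]] := fiber_transversal.
have -> : c = #|S|.
  apply/eqP; rewrite -(eqn_pmul2r s0) -cD sum; apply/eqP.
  by rewrite -sum_nat_const; apply: eq_bigr => y /(fintype.subsetP sSD)/unif.
by rewrite (image_transversal sSD cov); exact: image_has_card.
Qed.

End Transversal.

(** * Orbits of edges sorted by the types of their ends *)

Section Joins.

Variables (k : fieldType) (F : fieldType) (iota : {rmorphism {poly k} -> F}).
Hypothesis iota_inj : injective iota.
Hypothesis iota_frac : forall x, exists a b, b != 0 /\ x = iota a / iota b.
Variables (f : {poly k}) (d : nat).
Hypotheses (f_monic : f \is monic) (f_irr : irreducible_poly f).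
Hypothesis hd : size f = d.+1.

Implicit Types (p : {poly k}) (A U : 'M[{poly k}]_2) (g h : 'M[F]_2).

Local Notation O := (loc_ring iota f).
Local Notation R := (pole_ring iota f d).
Local Notation iotamx A := (map_mx iota A).
Local Notation frame := (frame f d).
Local Notation fdet := (fdet f).
Local Notation vtx := (vtx O).
Local Notation vtype := (vtype iota f d).
Local Notation residue_mx := (residue_mx f).
Local Notation residue_edge := (residue_edge iota f d).

Let RR : subring R := subring_pole iota_inj f_irr f_monic hd.

(** The ends are ordered so that edges can be counted from a fixed one; [joins_sym] turns the order
    round. *)
Definition joins E n b n' b' := exists v w, [/\ tree_vertices O v,
  tree_vertices O w, adjacent iota f v w, vtype v n b /\ vtype w n' b' &
  E = edge_orbit R [set v; w]].

Lemma tree_vtx g : g \in unitmx -> tree_vertices O (vtx g).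
Proof. by move=> gu; apply/tree_verticesP; exists g. Qed.

Lemma joins_sym E n b n' b' : joins E n b n' b' -> joins E n' b' n b.
Proof.
case=> v [w [/tree_verticesP[g gu ->] tw vw [tv tyw] ->]].
have nb := adjacent_neighbour iota_inj f_irr gu tw vw.
have [g' [gu' wE nb']] := neighbour_sym iota_inj f_irr gu nb.
exists w, (vtx g); split=> //; first exact: tree_vtx.
  by rewrite wE; apply: (neighbour_adjacent iota_inj f_irr).
by congr edge_orbit; rewrite setUC.
Qed.

Lemma joins_fun E n b n1 n2 : joins E n b n1 (~~ b) -> joins E n b n2 (~~ b) -> n1 = n2.
Proof.
case=> v [w [/tree_verticesP[g gu ->] /tree_verticesP[g' gu' ->] _ [tv tw] ->]].
case=> v' [w' [/tree_verticesP[h hu ->] /tree_verticesP[h' hu' ->] _ [tv' tw'] E1]].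
have [l lR E2] := (edge_orbit_eqP O RR _ _ _ _).1 E1.
have tlv := vtype_act iota_inj f_monic f_irr hd lR tv.
have tlw := vtype_act iota_inj f_monic f_irr hd lR tw.
have [_ wE] := pair_vtype_eq iota_inj iota_frac f_irr hd tv' tlv tw' tlw E2.
by rewrite wE in tw'; have [] := vtype_fun iota_inj iota_frac f_irr hd tlw tw'.
Qed.

(** The group is transitive on the vertices of a given type, so each such orbit of edges has a
    member at the vertex of [A]. *)
Lemma joins_frame E A m m' e n n' : frame A m m' e -> (m + n = m')%N ->
  joins E n (odd e) n' (~~ odd e) <->
  exists w, [/\ neighbour iota f (iotamx A) w, tree_vertices O w, vtype w n' (~~ odd e) &
    E = edge_orbit R [set vtx (iotamx A); w]].
Proof.
move=> hA nm; have Au := frame_unit iota_inj f_irr hA.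
have tA : vtype (vtx (iotamx A)) n (odd e) by exists A, m, m', e.
split; last first.
  case=> w [nb tw tyw ->]; exists (vtx (iotamx A)), w; split=> //.
    exact: tree_vtx.
  exact: (neighbour_adjacent iota_inj f_irr).
case=> v [w [tv tw vw [tyv tyw] ->]].
have [A0 [_ [_ [_ [h [_ _ _ EA [hR vE]]]]]]] := vtype_orbit iota_inj f_irr hd tA tyv.
have {}vE : v = vtx (h *m iotamx A) by rewrite vE; apply: vtx_mulr.
have hu := GL2_unitmx hR; have hAu : h *m iotamx A \in unitmx by rewrite unitmx_mul hu.
rewrite vE in vw *; have nb := adjacent_neighbour iota_inj f_irr hAu tw vw.
have [g [gu gE nbg]] : exists g, [/\ g \in unitmx, w = vtx (h *m g) &
    neighbour iota f (iotamx A) (vtx g)].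
  case: nb => [->|[p ->]].
    exists (iotamx A *m iotamx (infty_mx f)); rewrite mulmxA; split=> //; last by left.
    by rewrite unitmx_mul Au (unit_fdet iota_inj f_irr (fdet_infty_mx f)).
  exists (iotamx A *m iotamx (residue_mx p)); rewrite mulmxA; split=> //.
    by rewrite unitmx_mul Au (unit_fdet iota_inj f_irr (fdet_residue_mx f p)).
  by right; exists p.
exists (vtx g); split=> //; first exact: tree_vtx.
  rewrite gE in tyw; have := vtype_act iota_inj f_monic f_irr hd (GL2_invmx hR) tyw.
  by rewrite mulKmx.
by rewrite gE; apply/esym/(edge_orbit_eqP O RR); exists h.
Qed.

Lemma joins_exists v w : tree_vertices O v -> tree_vertices O w -> adjacent iota f v w ->
  exists n b n', joins (edge_orbit R [set v; w]) n b n' (~~ b).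
Proof.
move=> tv tw vw; have /tree_verticesP[g gu vE] := tv.
have [n [b tyv]] := vtype_exists iota_inj iota_frac f_monic f_irr hd gu.
rewrite -vE in tyv; case: (tyv) => A [m [m' [e [hA nm eb EA]]]].
have Au := frame_unit iota_inj f_irr hA.
have [n' tyw] : exists n', vtype w n' (~~ b).
  rewrite EA in vw; have := adjacent_neighbour iota_inj f_irr Au tw vw.
  have fA := frame_fdet hA; rewrite -eb; case=> [->|[p ->]]; rewrite -map_mxM.
    have := vtype_fdet iota_inj f_irr hd (fdetM fA (fdet_infty_mx f)).
    by rewrite addn1.
  have := vtype_fdet iota_inj f_irr hd (fdetM fA (fdet_residue_mx f p)).
  by rewrite addn1.
by exists n, b, n', v, w.
Qed.

Lemma vtype_infty A m m' e n : frame A m m' e -> (m + n = m')%N ->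
  vtype (vtx (iotamx (A *m infty_mx f))) (n + d) (~~ odd e).
Proof.
move=> hA nm; exists (A *m infty_mx f), m, (m' + d)%N, e.+1; split=> //; last by lia.
exact: frame_infty.
Qed.

Lemma vtype_residue A m m' e n p j : frame A m m' e -> (m + n = m')%N ->
  reduced f d n p j ->
  vtype (vtx (iotamx (A *m residue_mx p))) (d - n - 2 * j) (~~ odd e).
Proof.
move=> hA nm red; have [U hU hF] := reduced_frame f_irr hd red hA nm.
have fR : fdet (A *m residue_mx p) e.+1.
  by have := fdetM (frame_fdet hA) (fdet_residue_mx f p); rewrite addn1.
have [_ [_ _ _ _ le_d]] := red.
exists (A *m (residue_mx p *m U)), (m' + j)%N, (m + (d - j))%N, e.+1; split=> //.
  by lia.
rewrite mulmxA; apply/esym; exact: (vtx_mulmx_fdet iota_inj f_irr fR hU).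
Qed.

(** Translations by polynomials of degree at most n reach every class modulo [f] once n >= d. *)
Lemma residue_edge_far A m m' e n p : frame A m m' e -> (m + n = m')%N -> (d <= n)%N ->
  residue_edge A p = residue_edge A 0.
Proof.
move=> hA nm le_dn; have f0 := irredp_neq0 f_irr.
apply/(residue_edge_eq iota_inj iota_frac f_monic f_irr hd p 0 hA nm).
exists (mx2 1 (- (p %% f)) 0 1); split.
  split; rewrite ?mxE /= ?size_poly1 //.
  - by exists 1; rewrite ?oner_neq0 // det_mx2 mulr1 mulr0 subr0 scale1r.
  - by left.
  - rewrite size_polyN; apply: leq_trans (leqW le_dn).
    by rewrite -ltnS -hd ltn_modp.
rewrite !mxE /= !mul0r subr0 mul1r {1}(divp_eq p f) addrK.
by rewrite dvdp_mull.
Qed.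

End Joins.

Lemma has_card1 (T : Type) (A : set T) x : A x -> (forall y, A y -> y = x) -> has_card A 1.
Proof.
move=> Ax Au; exists (fun=> 0%N); split.
- by move=> y _.
- by move=> y z; rewrite !inE => /Au -> /Au ->.
- by case=> // _; exists x.
Qed.

Lemma nat_of_index_eq (d n j J : nat) : (n + 2 * j <= d)%N -> (n + 2 * J <= d)%N ->
  (d - n - 2 * j = d - n - 2 * J)%N -> j = J.
Proof. lia. Qed.

(** * Numbers of edges between given types *)

Section EdgeCounts.

Variables (k : finFieldType) (F : fieldType) (iota : {rmorphism {poly k} -> F}).
Hypothesis iota_inj : injective iota.
Hypothesis iota_frac : forall x, exists a b, b != 0 /\ x = iota a / iota b.
Variables (f : {poly k}) (d : nat).
Hypotheses (f_monic : f \is monic) (f_irr : irreducible_poly f).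
Hypothesis hd : size f = d.+1.
Variables (K : finFieldType) (pi : {rmorphism {poly k} -> K}).
Hypothesis pi_eq0 : forall a, (pi a == 0) = (f %| a).
Hypothesis pi_surj : forall x, exists a, pi a == x.

Implicit Types (p : {poly k}) (A U : 'M[{poly k}]_2) (g : 'M[F]_2) (x y : K).

Local Notation q := #|k|.
Local Notation O := (loc_ring iota f).
Local Notation R := (pole_ring iota f d).
Local Notation iotamx A := (map_mx iota A).
Local Notation frame := (frame f d).
Local Notation fdet := (fdet f).
Local Notation vtx := (vtx O).
Local Notation vtype := (vtype iota f d).
Local Notation residue_mx := (residue_mx f).
Local Notation residue_edge := (residue_edge iota f d).
Local Notation joins := (joins iota f d).
Local Notation res_lift := (res_lift pi_surj).


(** Seen from the index n + d all residues give the same edge, and the one remaining neighbour has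
    index n + 2 d, which differs from n. *)
Lemma card_edges_far n b : odd n = odd d && ~~ b ->
  has_card [set E | joins E (n + d) b n (~~ b)] 1.
Proof.
move=> nb; have [|g gu [A [m [m' [e [hA nm eb _]]]]]] :=
    vtype_surj iota_inj f_monic f_irr hd (n := (n + d)%N) (b := b).
  by rewrite oddD nb; case: (odd d); case: b {nb}.
have le_d : (d <= n + d)%N by rewrite leq_addl.
have far p := residue_edge_far iota_inj iota_frac f_monic f_irr hd p hA nm le_d.
apply: (@has_card1 _ _ (residue_edge A 0)) => [|E] /=; rewrite -eb.
  apply/(joins_frame iota_inj f_monic f_irr hd _ n hA nm).
  exists (vtx (iotamx (A *m residue_mx 0))); split=> //.
  - by right; exists 0; rewrite map_mxM.
  - apply: tree_vtx; have := frame_residue0 f_irr hd hA; exact: frame_unit.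
  - exists (A *m residue_mx 0), (m + d)%N, m', e.+1; split=> //; last by lia.
    exact: frame_residue0.
move=> /(joins_frame iota_inj f_monic f_irr hd E n hA nm)[w [nbw tw tyw ->]].
case: nbw => [wE|[p wE]].
  have := vtype_infty iota f_irr hd hA nm; rewrite map_mxM -wE => tyw'.
  have [n_eq _] := vtype_fun iota_inj iota_frac f_irr hd tyw tyw'.
  by have := d_gt0 f_irr hd; lia.
by rewrite -(far p) residue_edgeE map_mxM wE.
Qed.

Section Near.

Variables (n m m' e : nat) (A : 'M[{poly k}]_2).
Hypotheses (lt_nd : (n < d)%N) (hA : frame A m m' e) (nm : (m + n = m')%N).
Variable j : K -> nat.
Hypothesis red_j : forall x, reduced f d n (res_lift x) (j x).

Local Notation G := (fun x => residue_edge A (res_lift x)).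

Lemma index_le x : (n + 2 * j x <= d)%N.
Proof. by case: (red_j x) => U []. Qed.

Lemma residue_edge_lift p : residue_edge A p = residue_edge A (res_lift (pi p)).
Proof.
rewrite residue_edgeE; congr (edge_orbit _ [set _; _]).
have Au := frame_unit iota_inj f_irr hA.
rewrite !map_mxM; apply: (vtx_residue_mod iota_inj f_irr Au).
by rewrite -(pi_eq pi_eq0) res_liftK.
Qed.

Lemma joins_index x : joins (G x) n (odd e) (d - n - 2 * j x) (~~ odd e).
Proof.
apply/(joins_frame iota_inj f_monic f_irr hd _ _ hA nm).
exists (vtx (iotamx (A *m residue_mx (res_lift x)))); split=> //.
- by right; exists (res_lift x); rewrite map_mxM.
- apply: tree_vtx; have := fdetM (frame_fdet hA) (fdet_residue_mx f (res_lift x)).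
  exact: unit_fdet.
- exact: (vtype_residue iota_inj f_irr hd hA nm (red_j x)).
Qed.

(** The neighbour at infinity has index n + d, which equals d - n - 2 J only for n = J = 0; this is
    the case excluded by 0 < n + J. All other neighbours come from residues. *)
Lemma edges_index J : (0 < n + J)%N -> (n + 2 * J <= d)%N ->
  [set E | joins E n (odd e) (d - n - 2 * J) (~~ odd e)] =
  [set G x | x in [set x | x \in [set x : K | j x == J]%SET]].
Proof.
move=> nJ le_nJ; apply/seteqP; split=> E /=; last first.
  by case=> x; rewrite inE => /eqP <- <-; exact: joins_index.
move=> EJ; have := EJ.
move=> /(joins_frame iota_inj f_monic f_irr hd E _ hA nm)[w [nbw tw tyw EE]].
case: nbw => [wE|[p wE]].
  have := vtype_infty iota f_irr hd hA nm; rewrite map_mxM -wE => tyw'.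
  by have [n_eq _] := vtype_fun iota_inj iota_frac f_irr hd tyw tyw'; lia.
have {}EE : E = G (pi p).
  by rewrite -residue_edge_lift EE residue_edgeE map_mxM wE.
exists (pi p) => //=; rewrite inE; apply/eqP.
have := joins_index (pi p); rewrite -EE => EJ'.
have := joins_fun iota_inj iota_frac f_monic f_irr hd EJ' EJ.
exact: nat_of_index_eq (index_le _) le_nJ.
Qed.

Lemma index_edge x y : G x = G y -> j x = j y.
Proof.
move=> E; have := joins_index x; rewrite E => Ex.
have := joins_fun iota_inj iota_frac f_monic f_irr hd Ex (joins_index y).
exact: nat_of_index_eq (index_le _) (index_le _).
Qed.

Lemma residue_edge_lift_eq x y : G x = G y <->
  exists U, flag_auto f n U /\ pi (U 0 0) * x + pi (U 0 1) = y * (pi (U 1 0) * x + pi (U 1 1)).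
Proof.
have E := residue_edge_eq iota_inj iota_frac f_monic f_irr hd (res_lift x) (res_lift y) hA nm.
have EE U : (f %| U 0 0 * res_lift x + U 0 1 - res_lift y * (U 1 0 * res_lift x + U 1 1)) =
    (pi (U 0 0) * x + pi (U 0 1) == y * (pi (U 1 0) * x + pi (U 1 1))).
  by rewrite -(pi_eq pi_eq0) rmorphM !rmorphD !rmorphM !res_liftK.
split=> [/E[U [fU]]|[U [fU H]]]; last by apply/E; exists U; rewrite EE H.
by rewrite EE => /eqP H; exists U.
Qed.

(** For n > 0 the automorphisms are triangular, and dividing by the lower right constant normalizes
    them. *)
Lemma residue_edge_affine x y : (0 < n)%N -> G x = G y <->
  exists a (w : {poly_(n.+1) k}), a != 0 /\ y = pi a%:P * x + pi w.
Proof.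
move=> n0; rewrite residue_edge_lift_eq; split.
  case=> U [[hU s00 s10 s01 s11] E].
  have u10 : U 1 0 = 0 by case: s10 => // -[n00]; rewrite n00 in n0.
  have E00 := size1_polyC s00; have E11 := size1_polyC s11.
  move: E; rewrite u10 rmorph0 mul0r add0r E00 E11.
  move: (U 0 0)`_0 (U 1 1)`_0 E00 E11 => a b E00 E11 E.
  have : a * b != 0.
    have := fdet_neq0 f_irr hU; rewrite {1}[U]mx2E det_mx2 u10 mulr0 subr0 E00 E11.
    by rewrite -polyCM polyC_eq0.
  rewrite mulf_eq0 negb_or => /andP[a0 b0].
  have sw : (size (b^-1 *: U 0%R 1%R)%R <= n.+1)%N.
    by apply: leq_trans (size_scale_leq _ _) _.
  exists (b^-1 * a), (npolyp n.+1 (b^-1 *: U 0 1)).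
  rewrite mulf_neq0 ?invr_eq0 //; split=> //.
  have bK : pi b%:P != 0 by rewrite const_eq0.
  rewrite npolypK // -mul_polyC; apply: (mulIf bK); rewrite -E mulrDl.
  have bb : pi (b^-1)%:P * pi b%:P = 1 by rewrite -rmorphM -polyCM mulVf // rmorph1.
  by rewrite polyCM !rmorphM -[LHS]mul1r -bb; ring.
case=> a [w [a0 yE]]; exists (mx2 a%:P w 0 1); split.
  split; rewrite ?mxE /= ?size_poly1 ?size_polyC ?a0 ?size_npoly //; last by left.
  by exists a; rewrite // det_mx2 mulr1 mulr0 subr0 expr0 alg_polyC.
by rewrite !mxE /= rmorph0 rmorph1 mul0r add0r mulr1.
Qed.

Lemma residue_edge_homographic x y : n = 0%N -> G x = G y <-> homographic pi x y.
Proof.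
move=> n0; rewrite residue_edge_lift_eq; split.
  case=> U [[hU s00 s10 s01 s11] E].
  have {}s10 : (size (U 1%R 0%R) <= 1)%N by case: s10 => [->|[]]; rewrite ?size_poly0.
  rewrite n0 in s01.
  exists (U 0 0)`_0, (U 0 1)`_0, (U 1 0)`_0, (U 1 1)`_0.
  rewrite -!size1_polyC // E; split=> //.
  have := fdet_neq0 f_irr hU; rewrite {1}[U]mx2E det_mx2.
  rewrite {1}(size1_polyC s00) {1}(size1_polyC s01) {1}(size1_polyC s10) {1}(size1_polyC s11).
  by rewrite -!polyCM -polyCB polyC_eq0.
case=> a [b [c [t [D E]]]]; exists (mx2 a%:P b%:P c%:P t%:P); split; last by rewrite !mxE /= E.
split; rewrite ?mxE /= ?size_polyC_leq1 //.
- by exists (a * t - b * c); rewrite // det_mx2 -!polyCM -polyCB expr0 alg_polyC.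
- by right; split=> //; exact: size_polyC_leq1.
- by apply: leq_trans (size_polyC_leq1 _) _.
Qed.

Local Notation D J := [set x : K | j x == J]%SET.

Lemma fiber_edges (P : rel K) J : (forall x y, G x = G y <-> P x y) ->
  forall y, y \in D J -> #|[set x in D J | `[< G x = G y >]]%SET| = #|[set x | P y x]%SET|.
Proof.
move=> HP y; rewrite inE => /eqP yJ; apply: eq_card => x; rewrite !inE.
apply/andP/idP => [[_ /asboolP/esym/HP]//|/HP E].
have xy := index_edge E; split; first by rewrite -xy yJ.
by apply/asboolP; exact: esym E.
Qed.

Lemma card_index J : (0 < J)%N -> (n + 2 * J < d)%N ->
  #|D J| = (q ^ (n + 2 * J).+1 - q ^ (n + 2 * J.-1).+1)%N.
Proof.
move=> J0 lt_J; have lt_J' : (n + 2 * J.-1 < d)%N by lia.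
rewrite -(card_le_index f_irr hd pi_eq0 lt_nd red_j lt_J).
rewrite -(card_le_index f_irr hd pi_eq0 lt_nd red_j lt_J').
rewrite -cardsDS; last by apply/fintype.subsetP => x; rewrite !inE => ?; lia.
by apply: eq_card => x; rewrite !inE; apply/eqP/andP => [|[]]; lia.
Qed.

(** Residues of index 0 are classes of polynomials of degree at most n, permuted transitively by
    translations. *)
Lemma card_edges_reflect : (0 < n)%N ->
  has_card [set E | joins E n (odd e) (d - n) (~~ odd e)] 1.
Proof.
move=> n0; have := edges_index (J := 0); rewrite !muln0 !subn0 !addn0 => -> //; last exact: ltnW.
have lt0 : (n + 2 * 0 < d)%N by rewrite muln0 addn0.
have jE x := index0 f_irr hd pi_eq0 lt_nd red_j x.
have [x0 x00] : exists x0, j x0 = 0%N.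
  exists 0; apply/jE; exists (npolyp n.+1 0) => //.
  by rewrite npolypK ?size_poly0 // rmorph0.
apply: (@has_card1 _ _ (G x0)); first by exists x0; rewrite //= inE x00.
move=> _ [x /= + <-]; rewrite inE => /eqP/jE[w _ ->].
move/jE: x00 => [w0 _ ->]; apply/(residue_edge_affine _ _ n0).
have sw : (size ((w0 : {poly k}) - w)%R <= n.+1)%N by apply: size_subS; exact: size_npoly.
exists 1, (npolyp n.+1 ((w0 : {poly k}) - w)); split; first exact: oner_neq0.
by rewrite npolypK // rmorph1 mul1r rmorphB addrC subrK.
Qed.

(** The q^(n+2l+1) - q^(n+2l-1) residues of index l fall into classes of size (q - 1) q^(n+1), and
    the quotient is (q + 1) q^(2l-2). *)
Lemma card_edges_inner l : (0 < n)%N -> (0 < l)%N -> (n + 2 * l < d)%N ->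
  has_card [set E | joins E n (odd e) (d - n - 2 * l) (~~ odd e)]
    (q ^ (2 * l - 1) + q ^ (2 * l - 2)).
Proof.
move=> n0 l0 lt_l; have q1 : (1 < q)%N := finNzRing_gt1 k.
rewrite edges_index //; [|lia|exact: ltnW].
have HP x y : G x = G y <-> `[< exists a (w : {poly_(n.+1) k}), a != 0 /\ y = pi a%:P * x + pi w >].
  by rewrite (residue_edge_affine _ _ n0); split => [/asboolP|/asboolP].
apply: (@image_uniform_has_card _ _ _ _ ((q - 1) * q ^ n.+1)%N).
- by rewrite muln_gt0 subn_gt0 q1 expn_gt0 ltnW.
- rewrite card_index //; case: l l0 {lt_l} => // l _.
  have -> : (2 * l.+1 - 1 = (2 * l).+1)%N by lia.
  have -> : (2 * l.+1 - 2 = 2 * l)%N by lia.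
  have -> : (q ^ (n + 2 * l.+1).+1 = q ^ 2 * (q ^ (2 * l) * q ^ n.+1))%N.
    by rewrite -!expnD; congr (q ^ _)%N; lia.
  have -> : (q ^ (n + 2 * l.+1.-1).+1 = q ^ (2 * l) * q ^ n.+1)%N.
    by rewrite -!expnD; congr (q ^ _)%N; lia.
  rewrite [(q ^ (2 * l).+1)%N]expnS; move: (q ^ (2 * l))%N (q ^ n.+1)%N => u v.
  have qq : (q ^ 2 - 1 = (q - 1) * (q + 1))%N by rewrite -subn_sqr exp1n.
  by rewrite -{2}[(u * v)%N]mul1n -mulnBl qq; ring.
- move=> y yD; rewrite (fiber_edges HP) //; move: yD; rewrite inE => /eqP yl.
  apply: (card_affine (pi := pi) (x := y)).
  + exact: (pi_small_inj hd pi_eq0).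
  + move=> w; apply/eqP => yw.
    have : j y = 0%N by apply/(index0 f_irr hd pi_eq0 lt_nd red_j); exists w.
    by rewrite yl; lia.
  + by move=> x; split=> [/asboolP|] H; [|apply/asboolP].
Qed.

Lemma homographicP : n = 0%N -> forall x y, G x = G y <-> `[< homographic pi x y >].
Proof.
by move=> n0 x y; rewrite (residue_edge_homographic _ _ n0); split => [/asboolP|/asboolP].
Qed.

Lemma card_homographic_fiber y : n = 0%N -> quadratic_free pi y ->
  #|[set x : K | `[< homographic pi y x >]]%SET| = (q ^ 3 - q)%N.
Proof.
move=> n0 yfree; apply: (card_homographic yfree).
by move=> x; split=> [/asboolP|] H; [|apply/asboolP].
Qed.

(** Here q^(2l+1) - q^(2l-1) residues fall into free orbits of PGL_2(k), of size q^3 - q. *)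
Lemma card_edges_zero l : n = 0%N -> (0 < l)%N -> (2 * l < d)%N ->
  has_card [set E | joins E 0 (odd e) (d - 2 * l) (~~ odd e)] (q ^ (2 * l - 2)).
Proof.
move=> n0 l0 lt_l; have q1 : (1 < q)%N := finNzRing_gt1 k.
have := edges_index (J := l); rewrite n0 subn0 add0n => ->; rewrite ?add0n //; last exact: ltnW.
apply: (@image_uniform_has_card _ _ _ _ (q ^ 3 - q)%N).
- by rewrite subn_gt0 -{1}(expn1 q) ltn_exp2l.
- rewrite card_index // n0 ?add0n //; case: l l0 {lt_l} => // l _.
  have -> : (2 * l.+1 - 2 = 2 * l)%N by lia.
  by rewrite mulnBr -expnD -expnSr /=; congr (q ^ _ - _)%N; lia.
- move=> y yD; rewrite (fiber_edges (homographicP n0)) //.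
  move: yD; rewrite inE => /eqP yl; apply: card_homographic_fiber => //.
  have := red_j y; rewrite n0 yl => ry.
  exact: (index_quadratic_free f_irr hd pi_eq0 ry).
Qed.

Lemma not_const_index y : n = 0%N -> (0 < j y)%N -> y ^+ q != y.
Proof.
move=> n0 jy; apply/eqP => /(frobenius_fixP pi)[c yE].
have : j y = 0%N; last by lia.
apply/(index0 f_irr hd pi_eq0 lt_nd red_j); exists (npolyp n.+1 c%:P) => //.
by rewrite npolypK // (leq_trans (size_polyC_leq1 c)).
Qed.

(** Orbits of two sizes occur, q^2 - q inside F_(q^2) and q^3 - q elsewhere, so a transversal is
    split accordingly instead of dividing once. *)
Lemma card_edges_zero_zero l : n = 0%N -> (0 < l)%N -> d = (2 * l)%N -> exists c,
  has_card [set E | joins E 0 (odd e) 0 (~~ odd e)] c /\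
  (c * (q + 1) = q ^ (d - 2) + q)%N.
Proof.
move=> n0 l0 dl; have q1 : (1 < q)%N := finNzRing_gt1 k.
have E0 : (d - n - 2 * l = 0)%N by lia.
have := edges_index (J := l); rewrite E0 n0 => ->; try lia.
have [S [sSD G_inj cov sum]] := fiber_transversal (D l) G.
have /= -> := image_transversal sSD cov; exists #|S|; split; first exact: image_has_card.
have jS y : y \in S -> j y = l by move/(fintype.subsetP sSD); rewrite inE => /eqP.
have fib y : y \in S -> #|[set x in D l | `[< G x = G y >]]%SET| =
    if y \in quadratic_set k K then (q ^ 2 - q)%N else (q ^ 3 - q)%N.
  move=> yS; rewrite (fiber_edges (homographicP n0)) ?(fintype.subsetP sSD) //.
  have yq : y ^+ q != y by apply: not_const_index; rewrite // jS.
  case: ifPn => yQ; last by apply: card_homographic_fiber n0 (quadratic_freeP yq yQ).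
  rewrite -(card_quadratic_set pi yQ); apply: eq_card => x; rewrite inE.
  apply/asboolP/idP => [|xQ]; first exact: homographic_quadratic.
  move: xQ; rewrite (quadratic_set_affine pi yQ) => /imsetP[[a b] ab ->].
  move: ab; rewrite inE /= => a0; exists a, b, 0, 1.
  by rewrite polyC0 rmorph0 polyC1 rmorph1 mul0r add0r mulr1 mulr1 mulr0 subr0.
(* [card_le_index] stops short of J = d / 2, so index l is counted as the complement of the smaller
   ones in the q^d residues. *)
have cD : #|D l| = (q ^ (2 * l - 1) * (q - 1))%N.
  have lt_l' : (n + 2 * l.-1 < d)%N by lia.
  have := card_le_index f_irr hd pi_eq0 lt_nd red_j lt_l'.
  have := cardsC [set x | (j x <= l.-1)%N]%SET.
  rewrite (card_residue_field f_irr hd pi_eq0 pi_surj) => cC cE.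
  have -> : D l = (~: [set x | (j x <= l.-1)%N])%SET.
    apply/setP => x; rewrite !inE; have := index_le x; rewrite n0 dl => ?.
    by apply/eqP/idP; lia.
  move: cC; rewrite cE n0 add0n dl => cC.
  have E1 : (2 * l.-1).+1 = (2 * l - 1)%N by lia.
  have E2 : (q ^ (2 * l) = q * q ^ (2 * l - 1))%N by rewrite -expnS; congr (q ^ _)%N; lia.
  move: cC; rewrite E1 E2 mulnBr muln1 [(q * _)%N]mulnC => <-; by rewrite addKn.
pose SQ := [set y in S | y \in quadratic_set k K]%SET.
pose SN := [set y in S | y \notin quadratic_set k K]%SET.
have cS : #|S| = (#|SQ| + #|SN|)%N.
  rewrite -(cardsID (quadratic_set k K) S); congr (_ + _)%N;
    by apply: eq_card => y; rewrite !inE // andbC.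
have cDS : #|D l| = (#|SQ| * (q ^ 2 - q) + #|SN| * (q ^ 3 - q))%N.
  rewrite sum (eq_bigr _ fib) (bigID (mem (quadratic_set k K))) /=; congr (_ + _)%N.
    rewrite (eq_bigr (fun=> (q ^ 2 - q)%N)); last by move=> y /andP[_ ->].
    by rewrite sum_nat_cond_const; congr (_ * _)%N; apply: eq_card => y; rewrite !inE.
  rewrite (eq_bigr (fun=> (q ^ 3 - q)%N)); last by move=> y /andP[_ /negPf ->].
  by rewrite sum_nat_cond_const; congr (_ * _)%N; apply: eq_card => y; rewrite !inE.
have q2 : (q ^ 2 - q = q * (q - 1))%N by rewrite mulnBr muln1 mulnn.
have q3 : (q ^ 3 - q = q * (q - 1) * (q + 1))%N.
  by rewrite -mulnA -subn_sqr exp1n mulnBr muln1 -expnS.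
have qq0 : (0 < q * (q - 1))%N by rewrite muln_gt0 subn_gt0 q1 ltnW.
(* The class equation divided by q (q - 1). *)
have key : (q ^ (d - 2) = #|SQ| + #|SN| * (q + 1))%N.
  apply/eqP; rewrite -(eqn_pmul2l qq0); apply/eqP.
  have -> : (q * (q - 1) * q ^ (d - 2) = #|D l|)%N.
    rewrite cD (_ : 2 * l - 1 = (d - 2).+1)%N; last by lia.
    by rewrite expnS; ring.
  by rewrite cDS q2 q3; ring.
(* Affine maps are transitive on F_(q^2) outside k, so there is at most one such orbit. With none,
   [key] would make q + 1 divide q^(d-2), to which it is coprime. *)
have SQ1 : #|SQ| = 1%N.
  have le1 : (#|SQ| <= 1)%N.
    rewrite leqNgt; apply/negP => /card_gt1P[x [y [xS yS]]].
    rewrite [x \in SQ]inE in xS; rewrite [y \in SQ]inE in yS.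
    case/andP: xS => xS xQ; case/andP: yS => yS yQ /eqP[].
    apply: (G_inj _ _ xS yS); apply/(residue_edge_homographic _ _ n0).
    move: yQ; rewrite (quadratic_set_affine pi xQ) => /imsetP[[a b] ab ->].
    move: ab; rewrite inE /= => a0; exists a, b, 0, 1.
    by rewrite polyC0 rmorph0 polyC1 rmorph1 mul0r add0r mulr1 mulr1 mulr0 subr0.
  apply/eqP; rewrite eqn_leq le1 lt0n; apply/eqP => SQ0.
  have cop : coprime (q + 1) (q ^ (d - 2)).
    by rewrite coprimeXr // addn1 coprimeSn.
  have : (q + 1 %| q ^ (d - 2))%N by rewrite key SQ0 add0n dvdn_mull.
  by rewrite /coprime in cop *; move/gcdn_idPl; rewrite (eqP cop); lia.
by rewrite cS key SQ1; ring.
Qed.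

End Near.

End EdgeCounts.

(** * From edge counts to an isomorphism of multigraphs *)

Lemma multigraph_of_iso (V E V' : Type) (G : multigraph V E) (vs : set V')
    (mult : V' -> V' -> nat -> Prop) (phi : V -> V') :
  set_bij (vertices G) vs phi ->
  (forall e, edges G e -> exists x y c, mult x y c /\ phi @` ends G e = [set x; y]) ->
  (forall x y c, mult x y c ->
    has_card [set e | edges G e /\ phi @` ends G e = [set x; y]] c) ->
  multigraph_iso G (multigraph_of vs mult).
Proof.
move=> phi_bij complete counts.
pose Es P := [set e | edges G e /\ phi @` ends G e = P].
(* The numbering depends only on the set of ends, so a pair listed as (x, y), as (y, x) or for
   several parameters is numbered once. [numP] then compares cardinalities to see that its range is
   the listed [c]. *)
pose num P : E -> nat := get [set b : E -> nat | exists c, set_bij (Es P) `I_c b].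
have numP x y c : mult x y c -> set_bij (Es [set x; y]) `I_c (num [set x; y]).
  move=> /[dup] /counts[b bB] xyc.
  have [c' c'B] : exists c', set_bij (Es [set x; y]) `I_c' (num [set x; y]).
    by apply: (@getPex _ [set b : E -> nat | exists c, set_bij (Es [set x; y]) `I_c b]); exists b, c.
  suff -> : c = c' by [].
  have eqII i (u : E -> nat) : set_bij (Es [set x; y]) `I_i u -> (Es [set x; y] #= `I_i)%card.
    by move=> ui; apply/card_set_bijP; exists u.
  by apply/card_eq_II; apply: card_eq_trans (eqII _ _ c'B); rewrite card_eq_sym; exact: eqII bB.
exists phi, (fun e => (phi @` ends G e, num (phi @` ends G e) e)).
split=> //; split.
- move=> e eG /=; have [x [y [c [xyc exy]]]] := complete e eG.
  exists x, y, c; split=> //=; rewrite exy.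
  by have [+ _ _] := numP _ _ _ xyc; apply.
- move=> e e'; rewrite !inE => eG e'G [E1 E2].
  have [x [y [c [xyc exy]]]] := complete e eG.
  have [_ inj _] := numP _ _ _ xyc.
  apply: inj; rewrite ?inE; try by split=> //; rewrite -E1.
  by move: E2; rewrite -E1 exy.
- move=> [P i] /= [x [y [c [xyc /= -> ic]]]].
  have [_ _ surj] := numP _ _ _ xyc.
  have [e [eG exy] ei] := surj i ic.
  by exists e; rewrite //= exy ei.
Qed.

(** * The quotient graph described by types *)

Section QuotientGraph.

Variables (k : finFieldType) (F : fieldType) (iota : {rmorphism {poly k} -> F}).
Hypothesis iota_inj : injective iota.
Hypothesis iota_frac : forall x, exists a b, b != 0 /\ x = iota a / iota b.
Variables (f : {poly k}) (d : nat).
Hypotheses (f_monic : f \is monic) (f_irr : irreducible_poly f).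
Hypothesis hd : size f = d.+1.
Variables (K : finFieldType) (pi : {rmorphism {poly k} -> K}).
Hypothesis pi_eq0 : forall a, (pi a == 0) = (f %| a).
Hypothesis pi_surj : forall x, exists a, pi a == x.

Local Notation O := (loc_ring iota f).
Local Notation R := (pole_ring iota f d).
Local Notation iotamx A := (map_mx iota A).
Local Notation frame := (frame f d).
Local Notation vtx := (vtx O).
Local Notation vtype := (vtype iota f d).
Local Notation joins := (joins iota f d).
Local Notation res_lift := (res_lift pi_surj).

Let RR : subring R := subring_pole iota_inj f_irr f_monic hd.

Definition loc_graph := {|
  vertices := vertex_orbit R @` tree_vertices O;
  edges := edge_orbit R @` [set e | exists v w, [/\ tree_vertices O v,
    tree_vertices O w, adjacent iota f v w \/ adjacent iota f w v & e = [set v; w]]];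
  ends := fun E : set (set (set (set 'cV[F]_2))) =>
    vertex_orbit R @` \bigcup_(e in E) e |}.

(** The type is constant on an orbit of vertices, so the choice made by [get] is forced there. *)
Definition otype (o : set (set (set 'cV[F]_2))) : nat * bool :=
  get [set nb | exists2 v, o v & vtype v nb.1 nb.2].

(** For odd [d] the bit is the parity of n, which leaves one vertex for each n. For even [d] the
    index is even and the bit is free, which gives X_n and X_n'. *)
Definition admissible : set (nat * bool) := [set nb | odd nb.1 = odd d && nb.2].

Lemma admissibleE n b : admissible (n, b) = (odd n = odd d && b).
Proof. by []. Qed.

Lemma otypeE v n b : tree_vertices O v -> vtype v n b ->
  otype (vertex_orbit R v) = (n, b).
Proof.
move=> /tree_verticesP[g gu ->] tv.
have ov : vertex_orbit R (vtx g) (vtx g).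
  rewrite (vertex_orbit_vtx O RR); exists 1%:M; first exact: GL2_1 RR.
  by rewrite mul1mx.
have [w ow tw] : [set nb | exists2 v, vertex_orbit R (vtx g) v & vtype v nb.1 nb.2]
    (otype (vertex_orbit R (vtx g))).
  by apply: getPex; exists (n, b); exists (vtx g).
have [h hR hE] : [set vtx (h *m g) | h in GL2 R] w.
  by rewrite -(vertex_orbit_vtx O RR).
have := vtype_act iota_inj f_monic f_irr hd hR tv; rewrite hE => tw'.
have [n_eq b_eq] := vtype_fun iota_inj iota_frac f_irr hd tw' tw.
by rewrite [LHS]surjective_pairing n_eq b_eq.
Qed.

Lemma tree_vtype v : tree_vertices O v -> exists n b, vtype v n b.
Proof.
by move=> /tree_verticesP[g gu ->]; exact: (vtype_exists iota_inj iota_frac f_monic f_irr hd).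
Qed.

Lemma otype_bij : set_bij (vertices loc_graph) admissible otype.
Proof.
split.
- move=> _ [v tv <-]; have [n [b tyv]] := tree_vtype tv.
  by rewrite /admissible /= (otypeE tv tyv); exact: vtype_parity tyv.
- move=> o o'; rewrite !inE => -[v tv <-] [w tw <-].
  have [n [b tyv]] := tree_vtype tv; have [n' [b' tyw]] := tree_vtype tw.
  rewrite (otypeE tv tyv) (otypeE tw tyw) => -[nn bb]; rewrite -nn -bb in tyw.
  have [A [m [m' [e [h [_ _ _ vE [hR wE]]]]]]] := vtype_orbit iota_inj f_irr hd tyv tyw.
  by rewrite vE wE; apply/(vertex_orbit_eqP O RR); exists h.
- move=> [n b] nb; have [g gu tg] := vtype_surj iota_inj f_monic f_irr hd nb.
  exists (vertex_orbit R (vtx g)); last by apply: otypeE tg; exact: tree_vtx.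
  by exists (vtx g) => //; exact: tree_vtx.
Qed.

Lemma edges_joins E : edges loc_graph E -> exists n b n', joins E n b n' (~~ b).
Proof.
case=> _ [v [w [tv tw [vw|wv] ->]]] <-.
  exact: (joins_exists iota_inj iota_frac f_monic f_irr hd).
rewrite setUC; exact: (joins_exists iota_inj iota_frac f_monic f_irr hd).
Qed.

Lemma joins_edges E n b n' b' : joins E n b n' b' -> edges loc_graph E.
Proof.
case=> v [w [tv tw vw _ ->]]; exists [set v; w] => //.
by exists v, w; split=> //; left.
Qed.

Lemma ends_edge_orbit v w : tree_vertices O v -> tree_vertices O w ->
  ends loc_graph (edge_orbit R [set v; w]) = [set vertex_orbit R v; vertex_orbit R w].
Proof.
move=> /tree_verticesP[g gu ->] /tree_verticesP[g' gu' ->] /=.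
have orb h l : GL2 R h -> vertex_orbit R (vtx (h *m l)) = vertex_orbit R (vtx l).
  by move=> hR; apply/esym/(vertex_orbit_eqP O RR); exists h.
rewrite (edge_orbit_vtx O RR); apply/seteqP; split=> o.
  case=> x [_ [h hR <-] [->|->]] <-; first by left; exact: orb.
  by right; exact: orb.
have id1 : [set [set vtx (h *m g); vtx (h *m g')] | h in GL2 R] [set vtx g; vtx g'].
  by exists 1%:M; [exact: GL2_1 RR | rewrite !mul1mx].
by case=> ->; [exists (vtx g)|exists (vtx g')] => //; exists [set vtx g; vtx g'] => //;
   [left|right].
Qed.

Lemma joins_ends E n b n' b' : joins E n b n' b' ->
  otype @` ends loc_graph E = [set (n, b); (n', b')].
Proof.
case=> v [w [tv tw _ [tyv tyw] ->]]; rewrite ends_edge_orbit // image_setU !image_set1.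
by rewrite (otypeE tv tyv) (otypeE tw tyw).
Qed.

Lemma joins_admissible E n b n' b' : joins E n b n' b' ->
  admissible (n, b) /\ admissible (n', b').
Proof.
by case=> v [w [_ _ _ [tyv tyw] _]]; split; [exact: vtype_parity tyv|exact: vtype_parity tyw].
Qed.

(** The cases come from the neighbour at infinity, from residues with d <= n (all equivalent to 0),
    and from residues of index l = j with n < d. *)
Lemma joins_cases E n b n' : joins E n b n' (~~ b) ->
  [\/ n' = n + d, n = n' + d | exists l, n + n' + 2 * l = d]%N.
Proof.
move=> EJ; have [v [w [_ _ _ [[A [m [m' [e [hA nm eb vE]]]] _] _]]]] := EJ.
rewrite -eb in EJ; have Au := frame_unit iota_inj f_irr hA.
have /(joins_frame iota_inj f_monic f_irr hd E n' hA nm)[w' [nbw tw tyw EE]] := EJ.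
case: nbw => [wE|[p wE]].
  have := vtype_infty iota f_irr hd hA nm; rewrite map_mxM -wE => tyw'.
  by have [-> _] := vtype_fun iota_inj iota_frac f_irr hd tyw tyw'; constructor 1.
rewrite -map_mxM in wE.
have [le_dn|lt_nd] := leqP d n; last first.
  have [j red] := reduced_exists f_irr hd p lt_nd.
  have := vtype_residue iota_inj f_irr hd hA nm red; rewrite -wE => tyw'.
  have [nE _] := vtype_fun iota_inj iota_frac f_irr hd tyw tyw'.
  by constructor 3; exists j; case: red => U [_ _ _ _]; lia.
have far : E = residue_edge iota f d A 0.
  rewrite -(residue_edge_far iota_inj iota_frac f_monic f_irr hd p hA nm le_dn).
  by rewrite EE wE.
have J0 : joins E n (odd e) (n - d) (~~ odd e).
  apply/(joins_frame iota_inj f_monic f_irr hd E _ hA nm).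
  exists (vtx (iotamx (A *m residue_mx f 0))); split=> //.
  - by right; exists 0; rewrite map_mxM.
  - apply: tree_vtx; have := frame_residue0 f_irr hd hA; exact: frame_unit.
  - exists (A *m residue_mx f 0), (m + d)%N, m', e.+1; split=> //; last by lia.
    exact: frame_residue0.
have -> := joins_fun iota_inj iota_frac f_monic f_irr hd EJ J0.
by constructor 2; rewrite subnK.
Qed.

Lemma near_frame n b : admissible (n, b) -> (n < d)%N -> exists A m m' e j,
  [/\ frame A m m' e, (m + n = m')%N, odd e = b &
      forall x, reduced f d n (res_lift x) (j x)].
Proof.
move=> nb lt_nd.
have [g gu [A [m [m' [e [hA nm eb _]]]]]] := vtype_surj iota_inj f_monic f_irr hd nb.
have /boolp.choice[j hj] : forall x, exists j, reduced f d n (res_lift x) j.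
  by move=> x; exact: reduced_exists.
by exists A, m, m', e, j.
Qed.

Variables (V' : Type) (mk : nat * bool -> V') (vs : set V')
  (mult : V' -> V' -> nat -> Prop).
Hypothesis mk_bij : set_bij admissible vs mk.
Hypothesis mult_complete : forall n b n', admissible (n, b) -> admissible (n', ~~ b) ->
  [\/ n' = n + d, n = n' + d | exists l, n + n' + 2 * l = d]%N ->
  exists x y c, mult x y c /\ [set mk (n, b); mk (n', ~~ b)] = [set x; y].
Hypothesis mult_correct : forall x y c, mult x y c -> exists n b n',
  [/\ admissible (n, b), admissible (n', ~~ b), [set x; y] = [set mk (n, b); mk (n', ~~ b)] &
      has_card [set E | joins E n b n' (~~ b)] c].

Lemma set2_eq (T : Type) (a b a' b' : T) : [set a; b] = [set a'; b'] ->
  (a = a' /\ b = b') \/ (a = b' /\ b = a').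
Proof.
move=> E; have : [set a'; b'] a by rewrite -E; left.
have : [set a'; b'] b by rewrite -E; right.
have : [set a; b] a' by rewrite E; left.
have : [set a; b] b' by rewrite E; right.
by do 4![case=> ?]; subst; auto.
Qed.

(** The labels [mk] and the list [mult] are parameters, so both parities of [d] share this argument.
    An edge met from its other end is turned round by [joins_sym]. *)
Lemma loc_graph_iso : multigraph_iso loc_graph (multigraph_of vs mult).
Proof.
have [mk_in mk_inj mk_surj] := mk_bij.
apply: (@multigraph_of_iso _ _ _ _ _ _ (mk \o otype)).
- exact: set_bij_comp otype_bij mk_bij.
- move=> E /edges_joins[n [b [n' EJ]]]; have [a a'] := joins_admissible EJ.
  have [x [y [c [xyc xyE]]]] := mult_complete a a' (joins_cases EJ).
  by exists x, y, c; rewrite -image_comp (joins_ends EJ) image_setU !image_set1 xyE.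
- move=> x y c /mult_correct[n [b [n' [a a' -> ]]]].
  congr has_card; apply/seteqP; split=> E /=.
    move=> EJ; split; first exact: joins_edges EJ.
    by rewrite -image_comp (joins_ends EJ) image_setU !image_set1.
  case=> /edges_joins[n1 [b1 [n1' EJ]]]; rewrite -image_comp (joins_ends EJ).
  rewrite image_setU !image_set1 => EE.
  have [a1 a1'] := joins_admissible EJ.
  have inj u w : admissible u -> admissible w -> mk u = mk w -> u = w.
    by move=> au aw; apply: mk_inj; rewrite inE.
  case: (set2_eq EE) => -[E1 E2].
    have [nn bb] := inj _ _ a1 a E1; have [nn' _] := inj _ _ a1' a' E2.
    by move: EJ; rewrite nn bb nn'.
  have [nn bb] := inj _ _ a1 a' E1; have [nn' _] := inj _ _ a1' a E2.
  move: EJ; rewrite nn bb nn' negbK; exact: (joins_sym iota_inj f_irr).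
Qed.

End QuotientGraph.

(** * Matching the lists for odd and even d *)

Section NearCounts.

Variables (k : finFieldType) (F : fieldType) (iota : {rmorphism {poly k} -> F}).
Hypothesis iota_inj : injective iota.
Hypothesis iota_frac : forall x, exists a b, b != 0 /\ x = iota a / iota b.
Variables (f : {poly k}) (d : nat).
Hypotheses (f_monic : f \is monic) (f_irr : irreducible_poly f).
Hypothesis hd : size f = d.+1.
Variables (K : finFieldType) (pi : {rmorphism {poly k} -> K}).
Hypothesis pi_eq0 : forall a, (pi a == 0) = (f %| a).
Hypothesis pi_surj : forall x, exists a, pi a == x.

Local Notation q := #|k|.
Local Notation joins := (joins iota f d).
Local Notation edges_between n b n' := [set E | joins E n b n' (~~ b)].
Local Notation admissible := (admissible d).

Lemma has_card_reflect n b : admissible (n, b) -> (0 < n)%N -> (n < d)%N ->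
  has_card (edges_between n b (d - n)) 1.
Proof.
move=> nb n0 lt_nd.
have [A [m [m' [e [j [hA nm <- red]]]]]] := near_frame iota_inj f_monic f_irr hd pi_surj nb lt_nd.
exact: (card_edges_reflect iota_inj iota_frac f_monic f_irr hd pi_eq0 lt_nd hA nm red).
Qed.

Lemma has_card_inner n b l : admissible (n, b) -> (0 < n)%N -> (0 < l)%N ->
  (n + 2 * l < d)%N ->
  has_card (edges_between n b (d - n - 2 * l)) (q ^ (2 * l - 1) + q ^ (2 * l - 2)).
Proof.
move=> nb n0 l0 lt_l; have lt_nd : (n < d)%N by lia.
have [A [m [m' [e [j [hA nm <- red]]]]]] := near_frame iota_inj f_monic f_irr hd pi_surj nb lt_nd.
exact: (card_edges_inner iota_inj iota_frac f_monic f_irr hd pi_eq0 lt_nd hA nm red).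
Qed.

Lemma has_card_zero b l : admissible (0%N, b) -> (0 < l)%N -> (2 * l < d)%N ->
  has_card (edges_between 0%N b (d - 2 * l)) (q ^ (2 * l - 2)).
Proof.
move=> nb l0 lt_l; have lt_nd := d_gt0 f_irr hd.
have [A [m [m' [e [j [hA nm <- red]]]]]] := near_frame iota_inj f_monic f_irr hd pi_surj nb lt_nd.
exact: (card_edges_zero iota_inj iota_frac f_monic f_irr hd pi_eq0 lt_nd hA nm red).
Qed.

Lemma has_card_zero_zero b : admissible (0%N, b) -> ~~ odd d ->
  exists c, has_card (edges_between 0%N b 0%N) c /\ (c * (q + 1) = q ^ (d - 2) + q)%N.
Proof.
move=> nb de; have lt_nd := d_gt0 f_irr hd.
have [A [m [m' [e [j [hA nm <- red]]]]]] := near_frame iota_inj f_monic f_irr hd pi_surj nb lt_nd.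
have d2 : d = (2 * d./2)%N by move: de lt_nd; clear; lia.
have l0 : (0 < d./2)%N by move: de lt_nd; clear; lia.
exact: (card_edges_zero_zero iota_inj iota_frac f_monic f_irr hd pi_eq0 lt_nd hA nm red erefl l0 d2).
Qed.

Lemma loc_graph_odd : odd d -> multigraph_iso (loc_graph iota f d) (odd_graph q d).
Proof.
move=> d_odd; have d0 := d_gt0 f_irr hd.
have adm n b : admissible (n, b) <-> odd n = b by rewrite admissibleE d_odd.
apply: (loc_graph_iso iota_inj iota_frac f_monic f_irr hd (mk := fst)).
- split=> //.
  + by move=> [n b] [n' b']; rewrite !inE => /adm <- /adm <- /= ->.
  + by move=> n _; exists (n, odd n) => //; exact/adm.
- move=> n b n' /adm nb /adm nb' [->|->|[l nl]] /=.
  + by exists n, (n + d)%N, 1%N; split=> //; constructor.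
  + by exists n', (n' + d)%N, 1%N; split; [constructor | rewrite setUC].
  have [n0|n0] := posnP n.
    have [n'0|n'0] := posnP n'; first by move: d_odd; rewrite -nl n0 n'0; lia.
    (* For n = 0 and l = 0 the pair {0, d} is already a shift; this is why [Odd_reflect] asks for
       positive indices. *)
    have [l0|l0] := posnP l.
      by exists 0%N, (0 + d)%N, 1%N; split; [constructor | congr [set _; _]; lia].
    exists 0%N, (d - 2 * l)%N, (q ^ (2 * l - 2))%N; split; last by congr [set _; _]; lia.
    by constructor; lia.
  have [n'0|n'0] := posnP n'.
    have [l0|l0] := posnP l.
      by exists 0%N, (0 + d)%N, 1%N; split; [constructor | rewrite setUC; congr [set _; _]; lia].
    exists 0%N, (d - 2 * l)%N, (q ^ (2 * l - 2))%N.
    split; last by rewrite setUC; congr [set _; _]; lia.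
    by constructor; lia.
  have [l0|l0] := posnP l.
    exists n, (d - n)%N, 1%N; split; last by congr [set _; _]; lia.
    by constructor; lia.
  exists n, (d - n - 2 * l)%N, (q ^ (2 * l - 1) + q ^ (2 * l - 2))%N.
  split; last by congr [set _; _]; lia.
  by constructor; lia.
- move=> x y c [n|n n1 nd|n l n1 l1 nl|l l1 dl].
  (* The shift edge is counted from its larger end. *)
  + exists (n + d)%N, (odd (n + d)), n; split; [exact/adm| |by rewrite setUC|].
      by apply/adm; rewrite oddD d_odd; case: (odd n).
    apply: (card_edges_far iota_inj iota_frac f_monic f_irr hd).
    by rewrite oddD d_odd; case: (odd n).
  + exists n, (odd n), (d - n)%N; split=> //; [exact/adm|apply/adm; lia|].
    by apply: has_card_reflect; [exact/adm| |lia].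
  + exists n, (odd n), (d - n - 2 * l)%N; split=> //; [exact/adm|apply/adm; lia|].
    by apply: has_card_inner; [exact/adm| | |lia].
  + exists 0%N, false, (d - 2 * l)%N; split=> //; [exact/adm|apply/adm; lia|].
    by apply: has_card_zero; [exact/adm| |lia].
Qed.

Definition even_mk (nb : nat * bool) := if nb.2 then X' nb.1 else X nb.1.

Lemma loc_graph_even : ~~ odd d -> multigraph_iso (loc_graph iota f d) (even_graph q d).
Proof.
move=> d_even; have d0 := d_gt0 f_irr hd.
have adm n b : admissible (n, b) <-> ~~ odd n.
  by rewrite admissibleE (negPf d_even) /=; case: (odd n).
apply: (loc_graph_iso iota_inj iota_frac f_monic f_irr hd (mk := even_mk)).
- split.
  + by move=> [n [|]] /adm.
  + by move=> [n [|]] [n' [|]] _ _ //= [->].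
  + by move=> [n|n] /= ne; [exists (n, false) | exists (n, true)] => //; exact/adm.
- move=> n b n' /adm ne /adm n'e [n'E|nE|[l nl]].
  + exists (even_mk (n, b)), (even_mk (n', ~~ b)), 1%N; split=> //.
    by rewrite n'E; case: (b); constructor.
  + exists (even_mk (n', ~~ b)), (even_mk (n, b)), 1%N; split; last by rewrite setUC.
    by rewrite nE; case: (b); constructor.
  have [n0|n0] := posnP n.
    have [n'0|n'0] := posnP n'.
      exists (X 0), (X' 0); rewrite n0 n'0.
      have eE : [set even_mk (0%N, b); even_mk (0%N, ~~ b)] = [set X 0; X' 0].
        by case: (b) => //=; rewrite setUC.
      have [d2|d2] := eqVneq d 2.
        by exists 1%N; split=> //; constructor.
      by exists (q * (q ^ (d - 3) + 1) %/ (q + 1))%N; split=> //; constructor; lia.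
    have [l0|l0] := posnP l.
      exists (even_mk (n, b)), (even_mk (n', ~~ b)), 1%N; split=> //.
      by rewrite (_ : n' = n + d)%N; [case: (b); constructor|lia].
    exists (even_mk (n, b)), (even_mk (n', ~~ b)), (q ^ (2 * l - 2))%N; split=> //.
    rewrite n0 (_ : n' = d - 2 * l)%N; last by lia.
    by case: (b); constructor; lia.
  have [n'0|n'0] := posnP n'.
    have [l0|l0] := posnP l.
      exists (even_mk (n', ~~ b)), (even_mk (n, b)), 1%N; split; last by rewrite setUC.
      by rewrite (_ : n = n' + d)%N; [case: (b); constructor|lia].
    exists (even_mk (n', ~~ b)), (even_mk (n, b)), (q ^ (2 * l - 2))%N.
    split; last by rewrite setUC.
    rewrite n'0 (_ : n = d - 2 * l)%N; last by lia.
    by case: (b); constructor; lia.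
  have [l0|l0] := posnP l.
    case: b => /=.
      (* [Even_reflect] lists a pair from its unprimed vertex only, so a primed start is read from
         the other end, with n = d - n'. *)
      exists (X n'), (X' n), 1%N; split; last by rewrite setUC.
      by rewrite (_ : n = d - n')%N; [constructor; lia|lia].
    exists (X n), (X' n'), 1%N; split=> //.
    by rewrite (_ : n' = d - n)%N; [constructor; lia|lia].
  exists (even_mk (n, b)), (even_mk (n', ~~ b)), (q ^ (2 * l - 1) + q ^ (2 * l - 2))%N.
  split=> //; rewrite (_ : n' = d - n - 2 * l)%N; last by lia.
  by case: (b); constructor; lia.
- have far n b : ~~ odd n -> has_card [set E | joins E (n + d) b n (~~ b)] 1.
    move=> ne; apply: (card_edges_far iota_inj iota_frac f_monic f_irr hd).
    by rewrite (negPf d_even) (negPf ne).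
  move=> x y c [n ne|n ne|n ne n2 nd|n l ne l1 n2 nl|n l ne l1 n2 nl|l l1 nl|l l1 nl|d2|d2].
  + exists (n + d)%N, true, n; split; [apply/adm; lia|exact/adm|by rewrite setUC|exact: far].
  + exists (n + d)%N, false, n; split; [apply/adm; lia|exact/adm|by rewrite setUC|exact: far].
  + exists n, false, (d - n)%N; split=> //; [exact/adm|apply/adm; lia|].
    by apply: has_card_reflect; [exact/adm|lia|lia].
  + exists n, false, (d - n - 2 * l)%N; split=> //; [exact/adm|apply/adm; lia|].
    by apply: has_card_inner; [exact/adm|lia| |lia].
  + exists n, true, (d - n - 2 * l)%N; split=> //; [exact/adm|apply/adm; lia|].
    by apply: has_card_inner; [exact/adm|lia| |lia].
  + exists 0%N, false, (d - 2 * l)%N; split=> //; [exact/adm|apply/adm; lia|].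
    by apply: has_card_zero; [exact/adm| |lia].
  + exists 0%N, true, (d - 2 * l)%N; split=> //; [exact/adm|apply/adm; lia|].
    by apply: has_card_zero; [exact/adm| |lia].
  + exists 0%N, false, 0%N; split=> //; [exact/adm|exact/adm|].
    have a0 : admissible (0%N, false) by apply/adm.
    have [c' [c'B c'E]] := has_card_zero_zero a0 d_even.
    suff -> : (q * (q ^ (d - 3) + 1) %/ (q + 1) = c')%N by [].
    (* From c' (q + 1) = q^(d-2) + q = q (q^(d-3) + 1) the division is exact; d > 2 keeps the
       truncated d - 3 faithful. *)
    have -> : (q * (q ^ (d - 3) + 1) = c' * (q + 1))%N.
      by rewrite c'E mulnDr muln1 -expnS; congr (q ^ _ + _)%N; lia.
    by rewrite mulnK // addn1.
  + exists 0%N, false, 0%N; split=> //; [exact/adm|exact/adm|].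
    have a0 : admissible (0%N, false) by apply/adm.
    have [c' [c'B c'E]] := has_card_zero_zero a0 d_even.
    (* For d = 2 the relation reads c' (q + 1) = 1 + q. *)
    have c1 : c' = 1%N; last by move: c'B; rewrite c1.
    apply/eqP; rewrite -(eqn_pmul2r (m := (q + 1)%N)) ?addn1 //.
    by rewrite -addn1 c'E d2 subnn expn0 mul1n addnC.
Qed.

End NearCounts.

Lemma O_at_loc_ring (k : fieldType) (f : {poly k}) : irreducible_poly f ->
  O_at f = @loc_ring k (ratfun k) (@FracField.tofrac {poly k}) f.
Proof. by move=> f_irr; apply/seteqP; split=> x /(valuation_ring_nu x f_irr). Qed.

Lemma O_poles_at_pole_ring (k : fieldType) (f : {poly k}) d : f \is monic ->
  irreducible_poly f -> size f = d.+1 ->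
  O_poles_at f = @pole_ring k (ratfun k) (@FracField.tofrac {poly k}) f d.
Proof.
by move=> f_monic f_irr hd; apply/seteqP; split=> x /(O_poles_atP x f_monic f_irr hd).
Qed.

(** Here the abstract field with its embedding of k[t] is specialized to the fraction field, and
    valuations give way to explicit fractions. *)
Lemma quotient_graphE (k : finFieldType) (f : {poly k}) d : f \is monic ->
  irreducible_poly f -> size f = d.+1 ->
  quotient_graph f = @loc_graph k (ratfun k) (@FracField.tofrac {poly k}) f d.
Proof.
move=> f_monic f_irr hd; rewrite /quotient_graph /tree_edges /tree_adjacent.
by rewrite (O_at_loc_ring f_irr) (O_poles_at_pole_ring f_monic f_irr hd).
Qed.

Lemma residue_field_exists (k : finFieldType) (f : {poly k})
    (mi : monic_irreducible_poly f) :
  exists pi : {rmorphism {poly k} -> {poly %/ f with mi}},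
    (forall a, (pi a == 0) = (f %| a)) /\ (forall x, exists a, pi a == x).
Proof.
pose pi : {rmorphism {poly k} -> {poly %/ f}} := in_qpoly f.
exists (pi : {rmorphism {poly k} -> {poly %/ f with mi}}); split=> [a|x].
  by rewrite -val_eqE /= mk_monicE // -Pdiv.IdomainMonic.modpE ?mi.
exists (val x); apply/eqP/val_inj => /=.
rewrite Pdiv.CommonRing.rmodp_small //.
exact: size_mk_monic.

Qed.

Theorem mainTheorem1 (k : finFieldType) (q : nat) (hq : #|k| = q)
    (f : {poly k}) (f_monic : f \is monic) (f_irr : irreducible_poly f)
    (d : nat) (hd : size f = d.+1) (d_ge1 : (1 <= d)%N) :
  (odd d -> multigraph_iso (quotient_graph f) (odd_graph q d)) /\
  (~~ odd d -> multigraph_iso (quotient_graph f) (even_graph q d)).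
Proof.
rewrite (quotient_graphE f_monic f_irr hd) -hq.
have mi : monic_irreducible_poly f by split.
have [pi [pi_eq0 pi_surj]] := residue_field_exists mi.
split=> [d_odd|d_even].
  exact: (loc_graph_odd (@tofrac_inj k) (@ratfun_fraction k) f_monic f_irr hd pi_eq0 pi_surj).
exact: (loc_graph_even (@tofrac_inj k) (@ratfun_fraction k) f_monic f_irr hd pi_eq0 pi_surj).
Qed.
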